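(* In the Bradley–Terry model, let $r>2$ be a fixed integer and suppose $b_n^{11}/c_n^6=o\big(n^{1/2}/(\log n)^{5/2}\big)$. Under the homogeneous null $H_0:\beta_2=\cdots=\beta_r$ (true parameter satisfying it), with $\hat{\boldsymbol\beta}^0$ the maximizer of $\ell_{bt}$ over $\{\boldsymbol\gamma\in\mathbb R^{n-1}:\gamma_2=\cdots=\gamma_r\}$, the statistic $2\{\ell_{bt}(\hat{\boldsymbol\beta})-\ell_{bt}(\hat{\boldsymbol\beta}^0)\}$ converges in distribution to the chi-square distribution with $r-2$ degrees of freedom as $n\to\infty$.
   Context: All quantities may depend on $n$; asymptotics are as $n\to\infty$. Bradley–Terry model: $n$ items; for each pair $1\le i<j\le n$ a number of comparisons $k_{ij}=k_{ji}\in\{1,\dots,K\}$ with $K$ a fixed constant; $a_{ij}\sim\mathrm{Binomial}(k_{ij},p_{ij})$ with $p_{ij}=e^{\beta_i-\beta_j}/(1+e^{\beta_i-\beta_j})$, $a_{ji}=k_{ij}-a_{ij}$, and $a_{ij}$, $1\le i<j\le n$, mutually independent. $\beta_1=0$; the parameter is $\boldsymbol\beta=(\beta_2,\dots,\beta_n)^\top$. $d_i=\sum_{j\ne i}a_{ij}$. $\ell_{bt}(\boldsymbol\gamma)=\sum_{i=1}^n\gamma_id_i-\sum_{1\le i<j\le n}k_{ij}\log(e^{\gamma_i}+e^{\gamma_j})$ with $\gamma_1=0$; $\hat{\boldsymbol\beta}$ is its maximizer over $\mathbb R^{n-1}$. $b_n=\max_{i\ne j}(1+e^{\beta_i-\beta_j})^2/e^{\beta_i-\beta_j}$,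 $c_n=\min_{i\ne j}(1+e^{\beta_i-\beta_j})^2/e^{\beta_i-\beta_j}$ at the true parameter. *)

(* Defs.v *)
From HB Require Import structures.
From mathcomp Require Import all_boot all_order all_algebra.
From mathcomp Require Import all_classical all_reals all_analysis.
Set Implicit Arguments. Unset Strict Implicit. Unset Printing Implicit Defensive.
Import Order.TTheory GRing.Theory Num.Theory.
Import numFieldNormedType.Exports.
Local Open Scope classical_set_scope.
Local Open Scope ring_scope.

(* Items 1..n of the paper are indexed by 'I_n = {0,..,n-1}: paper item i+1 <-> index i.
   So beta_1 = 0 becomes  beta ord0 = 0  (i.e. value at index 0). *)

(* An outcome for n items: a(i,j) for i<j (values >= K+1 impossible, fixed by K).
   Only entries with (i < j) are meaningful; validity forces the others to be 0. *)
Definition outcome (n K : nat) := {ffun 'I_n * 'I_n -> 'I_K.+1}.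

Definition valid_outcome (n K : nat) (k : 'I_n -> 'I_n -> nat) (a : outcome n K) : bool :=
  [forall i : 'I_n, forall j : 'I_n,
     if (i < j)%N then (a (i, j) <= k i j)%N else (nat_of_ord (a (i, j)) == 0%N)].

Definition aij (n K : nat) (k : 'I_n -> 'I_n -> nat) (a : outcome n K) (i j : 'I_n) : nat :=
  if (i < j)%N then nat_of_ord (a (i, j)) else (k i j - a (j, i))%N.

Definition dscore (n K : nat) (k : 'I_n -> 'I_n -> nat) (a : outcome n K) (i : 'I_n) : nat :=
  (\sum_(j < n | j != i) aij k a i j)%N.

Definition btp {R : realType} (x y : R) : R := expR (x - y) / (1 + expR (x - y)).

Definition bt_prob {R : realType} (n K : nat) (k : 'I_n -> 'I_n -> nat)
    (beta : 'I_n -> R) (a : outcome n K) : R :=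
  if valid_outcome k a then
    \prod_(i < n) \prod_(j < n | (i < j)%N)
      ('C(k i j, a (i, j))%:R * btp (beta i) (beta j) ^+ a (i, j)
         * (1 - btp (beta i) (beta j)) ^+ (k i j - a (i, j)))
  else 0.

Definition bt_cdf {R : realType} (n K : nat) (k : 'I_n -> 'I_n -> nat)
    (beta : 'I_n -> R) (T : outcome n K -> R) (x : R) : R :=
  \sum_(a : outcome n K | T a <= x) bt_prob k beta a.

Definition ell_bt {R : realType} (n K : nat) (k : 'I_n -> 'I_n -> nat)
    (a : outcome n K) (g : 'I_n -> R) : R :=
  \sum_(i < n) g i * (dscore k a i)%:R
  - \sum_(i < n) \sum_(j < n | (i < j)%N) (k i j)%:R * ln (expR (g i) + expR (g j)).

(* parameter space: gamma_1 = 0 (paper), i.e. value 0 at index 0 *)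
Definition full_space {R : realType} (n : nat) (g : 'I_n -> R) : Prop :=
  forall i : 'I_n, nat_of_ord i = 0%N -> g i = 0.

(* null space: additionally gamma_2 = ... = gamma_r (indices 1..r-1) *)
Definition null_space {R : realType} (n r : nat) (g : 'I_n -> R) : Prop :=
  full_space g /\
  forall i j : 'I_n, (1 <= i)%N -> (i < r)%N -> (1 <= j)%N -> (j < r)%N -> g i = g j.

Definition is_maximizer {R : realType} (n K : nat) (k : 'I_n -> 'I_n -> nat)
    (a : outcome n K) (S : ('I_n -> R) -> Prop) (g : 'I_n -> R) : Prop :=
  S g /\ forall h, S h -> ell_bt k a h <= ell_bt k a g.

Definition vfun {R : realType} (x : R) : R := (1 + expR x) ^+ 2 / expR x.

Definition b_n {R : realType} (n : nat) (beta : 'I_n -> R) : R :=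
  \big[Num.max/0]_(i < n) \big[Num.max/0]_(j < n | j != i) vfun (beta i - beta j).

(* c_n = min_{i != j} vfun(beta_i - beta_j); the neutral start b_n does not affect
   the value when n >= 2 since every term is <= b_n *)
Definition c_n {R : realType} (n : nat) (beta : 'I_n -> R) : R :=
  \big[Num.min/b_n beta]_(i < n) \big[Num.min/b_n beta]_(j < n | j != i)
     vfun (beta i - beta j).

Definition chisq_kernel {R : realType} (m : nat) (t : R) : R :=
  powR t (m%:R / 2 - 1) * expR (- t / 2).

Definition chisq_cdf {R : realType} (m : nat) (x : R) : R :=
  fine (\int[@lebesgue_measure R]_(t in `]0, x]) (chisq_kernel m t)%:E)
  / fine (\int[@lebesgue_measure R]_(t in `]0, +oo[) (chisq_kernel m t)%:E).

(* Main.v *)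
Require Import Defs.
From HB Require Import structures.
From mathcomp Require Import all_boot all_order all_algebra.
From mathcomp Require Import all_classical all_reals all_analysis measurable_realfun.
From mathcomp Require Import ring lra.
Import Order.TTheory GRing.Theory Num.Theory.
Import numFieldNormedType.Exports.
Local Open Scope classical_set_scope.
Local Open Scope ring_scope.

(* Let B be the block of items whose merits agree under the null, and let D_i (i in B) be the
   centred score of item i restricted to its comparisons with items outside B; the D_i are
   independent, with variances v_i. The log-likelihood is concave, so both maximizers are
   characterised by their score equations; on an event of probability 1 - O(1/n) they exist
   within O(b_n (log n / n)^(1/2)) of the truth. A trapezoidal expansion of the likelihood
   between the two maximizers shows that the statistic is
     Q = sum_B D_i^2 / v_i - (sum_B D_i)^2 / sum_B v_i
   up to O(b_n^6 (log n)^(3/2) / n^(1/2)): outside B the two maximizers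
   nearly coincide. Q is the squared length of the projection
   of the standardised D onto a hyperplane of R^(r-1). Replacing the summands of D by Gaussian
   ones, one comparison at a time, gives E exp(-l Q) -> (1 + 2 l)^(-(r-2)/2) for every natural
   number l, and since exp(-Q) lies in [0, 1] these moments determine the limit law. *)

(** The number of parameters grows with $n$, and no inverse of the information matrix is estimated.
    The maximizers are controlled in oscillation, through a maximum principle: at an item with
    extreme deviation all terms of the score increment have one sign, and each is at least the gap
    over a multiple of [b]. So a bound on one score bounds a mean gap, and the mean gaps at both
    extremes bound the oscillation. Applied outside the block to the difference of the two
    maximizers, where both scores vanish, it gains a factor of order $b/n$, since only boundedly
    many block terms remain to balance the increments; this makes the cubic remainders of the $n^2$
    outer pairs negligible. The trapezoidal rule is chosen because it reaches a cubic error from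
    scores at the end points, most of which are zero. Comparisons inside the block are left out of
    $D_i$ so that distinct $D_i$ use disjoint comparisons; the cost is bounded. Laplace transforms
    are used because exponentials of negative quadratics are bounded and stable under Gaussian
    smoothing, so the replacement error is uniform in all the other summands. *)

(** * Exponential inequalities and one replacement step *)

Section Calculus.
Context {R : realType}.

(** Applied to a Taylor remainder, whose derivative is of one order less. The ball around [a] spares
    a case distinction on the sign of the step. *)
Lemma mean_value_bound (f df : R -> R) (a b M : R) :
  (forall x : R, is_derive x 1 f (df x)) ->
  (forall x, `|x - a| <= `|b - a| -> `|df x| <= M) ->
  `|f b - f a| <= M * `|b - a|.
Proof.
move=> fd bd.
have cf : continuous f.
  by move=> x; apply: differentiable_continuous; apply/derivable1_diffP; apply: ex_derive.
have [ab|ba|->] := ltgtP a b; last by rewrite !subrr normr0 mulr0.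
- have [x] := MVT ab (fun x _ => fd x) (continuous_subspaceT cf).
  rewrite in_itv /= => /andP[ax xb] ->; rewrite normrM.
  apply: ler_wpM2r => //; apply: bd.
  by rewrite !gtr0_norm ?subr_gt0//; lra.
- have [x] := MVT ba (fun x _ => fd x) (continuous_subspaceT cf).
  rewrite in_itv /= => /andP[ax xb]; rewrite distrC => ->.
  rewrite normrM [`|a - b|]distrC.
  apply: ler_wpM2r => //; apply: bd.
  by rewrite !ltr0_norm ?subr_lt0//; lra.
Qed.

Lemma expR_taylor1 (w : R) : `|expR w - 1 - w| <= w ^+ 2 * expR `|w|.
Proof.
have [w0|w0] := leP 0 w.
  have h1 := expR_ge1Dx w; have h2 := expR_ge1Dx (- w).
  have e0 := expR_gt0 w.
  have e1 : expR w * expR (- w) = 1 by rewrite -expRD subrr expR0.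
  have h3 : expR w - 1 <= w * expR w by nra.
  rewrite ger0_norm ?(ger0_norm w0); last lra.
  by rewrite expr2; nra.
have h1 := expR_ge1Dx w; have h2 := expR_ge1Dx (- w).
have e0 := expR_gt0 w.
have e1 : expR w * expR (- w) = 1 by rewrite -expRD subrr expR0.
have e2 : 1 <= expR `|w| by rewrite -expR0 ler_expR.
rewrite ger0_norm; last lra.
have : expR w - 1 - w <= w ^+ 2.
  rewrite expr2.
  have : expR w * (1 - w) <= 1 by nra.
  nra.
by rewrite expr2; nra.
Qed.

Lemma expR_taylor2 (w : R) :
  `|expR w - 1 - w - w ^+ 2 / 2| <= `|w| ^+ 3 * expR `|w|.
Proof.
have := @mean_value_bound (fun x => expR x - 1 - x - x ^+ 2 / 2)
  (fun x => expR x - 1 - x) 0 w (w ^+ 2 * expR `|w|).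
rewrite expR0 !subr0 expr0n /= mul0r subrr !subr0 => H.
have -> : `|w| ^+ 3 * expR `|w| = w ^+ 2 * expR `|w| * `|w|.
  by rewrite exprSr -normrX (ger0_norm (sqr_ge0 w)); ring.
apply: H => x.
  apply: is_derive_eq.
  by rewrite /GRing.scale /=; lra.
rewrite subr0 => xw.
apply: (le_trans (expR_taylor1 x)); apply: ler_pM; rewrite ?sqr_ge0 ?expR_ge0//.
- by rewrite -(ger0_norm (sqr_ge0 x)) -(ger0_norm (sqr_ge0 w)) !normrX lerXn2r ?nnegrE.
- by rewrite ler_expR.
Qed.

Lemma expR1_le4 : expR 1 <= 4 :> R.
Proof.
have h := expR_ge1Dx (- (1 / 2) : R).
have e : expR (1 / 2) * expR (- (1 / 2)) = 1 :> R by rewrite -expRD subrr expR0.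
have e0 : 0 < expR (1 / 2) :> R := expR_gt0 _.
have e2 : expR (1 / 2) <= 2 :> R by nra.
have -> : 1 = 1 / 2 + 1 / 2 :> R by field.
by rewrite expRD; nra.
Qed.

(** Meant for a bounded centred variable: the linear term vanishes in expectation and a sub-Gaussian
    bound is left. *)
Lemma expR_le_add_expR_sqr (x : R) : expR x <= x + expR (4 * x ^+ 2).
Proof.
have h := expR_ge1Dx (4 * x ^+ 2).
have x2 : 0 <= x ^+ 2 by exact: sqr_ge0.
have [x1|x1] := leP `|x| 1.
  have := expR_taylor1 x; rewrite ler_norml => /andP[_].
  have : expR `|x| <= 4 by apply: le_trans expR1_le4; rewrite ler_expR.
  nra.
have [x0|x0] := leP 0 x.
  rewrite (ger0_norm x0) in x1.
  apply: (@le_trans _ _ (expR (4 * x ^+ 2))); last lra.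
  by rewrite ler_expR expr2; nra.
rewrite (ltr0_norm x0) in x1.
have : expR x <= 1 by rewrite -expR0 ler_expR ltW.
rewrite expr2 in h *; nra.
Qed.

(** The condition on [g] makes the quadratic in [h] nonnegative everywhere, and it makes the error
    uniform in [q] and [g]: as $q\ge g^2/(4A)$, the factor $e^{-q}$ absorbs all growth in $g$. *)
Lemma expR_quad_expand (A q g alpha h : R) : 1 <= A -> 0 <= alpha <= A -> 0 <= q ->
  g ^+ 2 <= 4 * alpha * q -> `|h| <= 1 ->
  `|expR (- (q + g * h + alpha * h ^+ 2))
     - expR (- q) * (1 - g * h - alpha * h ^+ 2 + g ^+ 2 * h ^+ 2 / 2)|
  <= 2 * expR (20 * A) * `|h| ^+ 3.
Proof.
move=> A1 /andP[a0 aA] q0 gq h1.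
pose U := `|g| + A.
have g0 : 0 <= `|g| by [].
have hh0 : 0 <= `|h| by [].
have U1 : 1 <= U by rewrite /U; lra.
have h2E : h ^+ 2 = `|h| ^+ 2 by rewrite -normrX ger0_norm // sqr_ge0.
have g2E : g ^+ 2 = `|g| ^+ 2 by rewrite -normrX ger0_norm // sqr_ge0.
pose w := - (g * h + alpha * h ^+ 2).
have -> : - (q + g * h + alpha * h ^+ 2) = - q + w by rewrite /w; ring.
rewrite expRD -mulrBr normrM (gtr0_norm (expR_gt0 _)).
have wU : `|w| <= U * `|h|.
  rewrite /w normrN; apply: (le_trans (ler_normD _ _)).
  rewrite normrM normrM (ger0_norm a0) normrX /U mulrDl expr2 mulrA.
  rewrite lerD2l; apply: ler_wpM2r => //; nra.
have wU1 : `|w| <= U by nra.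
have T := expR_taylor2 w.
have step : `|expR w - (1 - g * h - alpha * h ^+ 2 + g ^+ 2 * h ^+ 2 / 2)|
   <= 2 * U ^+ 3 * expR U * `|h| ^+ 3.
  have -> : expR w - (1 - g * h - alpha * h ^+ 2 + g ^+ 2 * h ^+ 2 / 2) =
    (expR w - 1 - w - w ^+ 2 / 2) + (g * alpha * h + alpha ^+ 2 * h ^+ 2 / 2) * h ^+ 2.
    by rewrite /w; field.
  apply: (le_trans (ler_normD _ _)).
  have b1 : `|w| ^+ 3 * expR `|w| <= U ^+ 3 * expR U * `|h| ^+ 3.
    rewrite -mulrA [expR U * _]mulrC mulrA -exprMn; apply: ler_pM.
    - exact: exprn_ge0.
    - exact: expR_ge0.
    - by apply: lerXn2r; rewrite ?nnegrE //; nra.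
    - by rewrite ler_expR.
  have b2 : `|(g * alpha * h + alpha ^+ 2 * h ^+ 2 / 2) * h ^+ 2| <= U ^+ 2 * `|h| ^+ 3.
    rewrite normrM (ger0_norm (sqr_ge0 h)) h2E.
    have -> : U ^+ 2 * `|h| ^+ 3 = U ^+ 2 * `|h| * `|h| ^+ 2 by ring.
    apply: ler_wpM2r; first exact: exprn_ge0.
    apply: (le_trans (ler_normD _ _)).
    have -> : `|g * alpha * h| = `|g| * alpha * `|h| by rewrite !normrM (ger0_norm a0).
    have -> : `|alpha ^+ 2 * `|h| ^+ 2 / 2| = alpha ^+ 2 * `|h| ^+ 2 / 2.
      by rewrite ger0_norm// divr_ge0// mulr_ge0// sqr_ge0.
    have e1 : `|g| * alpha * `|h| <= `|g| * A * `|h|.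
      by apply: ler_wpM2r => //; apply: ler_wpM2l.
    have e2 : alpha ^+ 2 * `|h| ^+ 2 <= A ^+ 2 * `|h|.
      apply: ler_pM; rewrite ?sqr_ge0//.
        by apply: lerXn2r; rewrite ?nnegrE //; lra.
      by rewrite expr2; nra.
    have e3 : `|g| * A * `|h| + A ^+ 2 * `|h| / 2 <= U ^+ 2 * `|h|.
      rewrite /U.
      have -> : (`|g| + A) ^+ 2 * `|h| = `|g| ^+ 2 * `|h| + 2 * (`|g| * A * `|h|) + A ^+ 2 * `|h|.
        by ring.
      have := mulr_ge0 (sqr_ge0 `|g|) hh0.
      have := mulr_ge0 (sqr_ge0 A) hh0.
      have : 0 <= `|g| * A * `|h| by rewrite !mulr_ge0 //; lra.
      lra.
    lra.
  have b3 : U ^+ 2 * `|h| ^+ 3 <= U ^+ 3 * expR U * `|h| ^+ 3.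
    apply: ler_wpM2r; first exact: exprn_ge0.
    rewrite [U ^+ 3]exprSr -mulrA; apply: ler_peMr; first exact: sqr_ge0.
    have : 1 <= expR U by rewrite -expR0 ler_expR; lra.
    nra.
  lra.
apply: (@le_trans _ _ (expR (- q) * (2 * U ^+ 3 * expR U * `|h| ^+ 3))).
  by apply: ler_wpM2l => //; exact: expR_ge0.
have -> : expR (- q) * (2 * U ^+ 3 * expR U * `|h| ^+ 3) =
   2 * (expR (- q) * U ^+ 3 * expR U) * `|h| ^+ 3 by ring.
apply: ler_wpM2r; first exact: exprn_ge0.
apply: ler_wpM2l => //.
have U3 : U ^+ 3 <= expR (3 * U).
  have -> : expR (3 * U) = expR U ^+ 3 by rewrite -expRM_natl mulr_natl.
  apply: lerXn2r; rewrite ?nnegrE ?expR_ge0//; first lra.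
  have := expR_ge1Dx U; lra.
apply: (@le_trans _ _ (expR (- q) * expR (3 * U) * expR U)).
  by apply: ler_wpM2r; [exact: expR_ge0|apply: ler_wpM2l => //; exact: expR_ge0].
rewrite -!expRD ler_expR /U.
rewrite g2E in gq.
have gq' : `|g| ^+ 2 <= 4 * A * q by apply: (le_trans gq); apply: ler_wpM2r => //; lra.
(* Completing the square: $-g^2/(4A)+4|g|+4A$ is largest at $|g|=8A$, where it equals $20A$. *)
have : 0 <= (`|g| - 8 * A) ^+ 2 by exact: sqr_ge0.
have -> : (`|g| - 8 * A) ^+ 2 = `|g| ^+ 2 - 16 * A * `|g| + 64 * A ^+ 2 by ring.
move=> S.
suff : A * (- q + 3 * (`|g| + A) + (`|g| + A)) <= A * (20 * A) by rewrite ler_pM2l //; lra.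
have -> : A * (- q + 3 * (`|g| + A) + (`|g| + A)) = - (A * q) + 4 * (A * `|g|) + 4 * A ^+ 2 by ring.
have -> : A * (20 * A) = 20 * A ^+ 2 by ring.
lra.
Qed.

Lemma ln1D_bounds (p : R) : 0 <= p -> p - p ^+ 2 <= ln (1 + p) <= p.
Proof.
move=> p0; apply/andP; split; last by have := le_ln1Dx; apply; lra.
have p1 : 0 < 1 + p by lra.
have := @le_ln1Dx R ((1 + p)^-1 - 1).
rewrite subrKC lnV ?posrE// => H.
have : - ln (1 + p) <= (1 + p)^-1 - 1.
  by apply: H; rewrite ltrBrDl subrr invr_gt0.
have e : (1 + p) * (1 + p)^-1 = 1 by rewrite divff// gt_eqF.
have : 0 < (1 + p)^-1 by rewrite invr_gt0.
rewrite expr2; nra.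
Qed.

(** The first exponential is the expectation of $e^{-(q+gZ+\alpha Z^2)}$ for $Z$ centred normal with
    variance [s]. This is the Gaussian counterpart of [expR_quad_expand] after taking
    expectations. *)
Lemma expR_heat_expand (A q g alpha s : R) : 1 <= A -> 0 <= alpha <= A -> 0 <= q ->
  g ^+ 2 <= 4 * alpha * q -> 0 <= s -> 4 * A * s <= 1 ->
  `|expR (- q + s * g ^+ 2 / (2 * (1 + 2 * alpha * s)) - ln (1 + 2 * alpha * s) / 2)
     - expR (- q) * (1 - alpha * s + s * g ^+ 2 / 2)|
  <= 384 * A ^+ 2 * s ^+ 2.
Proof.
move=> A1 /andP[a0 aA] q0 gq s0 sA.
have A0 : 0 <= A by lra.
set p := 2 * alpha * s.
have p0 : 0 <= p by rewrite /p !mulr_ge0.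
have as_le : alpha * s <= A * s by apply: ler_wpM2r.
have ph : p <= 1 / 2 by rewrite /p; lra.
have p1 : 0 < 1 + p by lra.
have gg : 0 <= g ^+ 2 by exact: sqr_ge0.
pose G := s * g ^+ 2 / 2.
have G0 : 0 <= G by rewrite /G divr_ge0// mulr_ge0.
pose I := (1 + p)^-1.
have I0 : 0 < I by rewrite invr_gt0.
have eI : (1 + p) * I = 1 by rewrite /I divff// gt_eqF.
have eI' : I = 1 - p * I by lra.
have pI0 : 0 <= p * I by rewrite mulr_ge0 // ltW.
have pI : p * I <= p by nra.
have -> : s * g ^+ 2 / (2 * (1 + p)) = G * I by rewrite /G /I; field; rewrite gt_eqF.
pose w := G * I - ln (1 + p) / 2.
have -> : - q + G * I - ln (1 + p) / 2 = - q + w by rewrite /w; ring.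
rewrite expRD -mulrBr normrM (gtr0_norm (expR_gt0 _)).
have /andP[l1 l2] := ln1D_bounds _ p0.
have Aq : 0 <= A * q by rewrite mulr_ge0//; lra.
have aq : alpha * q <= A * q by apply: ler_wpM2r.
have V0 : 0 <= 1 + 2 * q by lra.
have wq : `|w| <= q / 2 + 1.
  have GI : G * I <= q / 2.
    have : G <= p * q.
      rewrite /G /p; have := ler_wpM2l s0 gq.
      have -> : s * (4 * alpha * q) = 4 * (alpha * s * q) by ring.
      have -> : 2 * alpha * s * q = 2 * (alpha * s * q) by ring.
      lra.
    have := ler_wpM2r q0 pI.
    nra.
  have GI0 : 0 <= G * I by rewrite mulr_ge0// ltW.
  have ln0' : 0 <= ln (1 + p) by apply: le_trans l1; rewrite expr2; nra.
  by rewrite ler_norml /w; apply/andP; split; lra.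
have Gs : G <= s * (2 * A * q).
  rewrite /G -mulrA; apply: ler_wpM2l => //; lra.
have ps : p <= 2 * (A * s) by rewrite /p; lra.
have sAq : 0 <= s * (2 * A * q) by rewrite mulr_ge0//; lra.
have ws : `|w| <= s * (A * (1 + 2 * q)).
  have -> : s * (A * (1 + 2 * q)) = s * (2 * A * q) + A * s by ring.
  have GI : G * I <= G by nra.
  have GI0 : 0 <= G * I by rewrite mulr_ge0// ltW.
  have ln0' : 0 <= ln (1 + p) by apply: le_trans l1; rewrite expr2; nra.
  by rewrite ler_norml /w; apply/andP; split; lra.
have V1 : 1 + 2 * q <= (1 + 2 * q) ^+ 2 by rewrite expr2; nra.
have lin : `|w - (G - p / 2)| <= 2 * s ^+ 2 * A ^+ 2 * (1 + 2 * q) ^+ 2.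
  have -> : w - (G - p / 2) = - (G * (p * I)) + (p - ln (1 + p)) / 2.
    by rewrite /w [in LHS]eI'; ring.
  apply: (@le_trans _ _ (2 * s ^+ 2 * A ^+ 2 * (1 + 2 * q))); last first.
    by apply: ler_wpM2l => //; rewrite !mulr_ge0 ?sqr_ge0.
  have e1 : G * (p * I) <= 4 * s ^+ 2 * A ^+ 2 * q.
    have -> : 4 * s ^+ 2 * A ^+ 2 * q = (s * (2 * A * q)) * (2 * (A * s)) by ring.
    by apply: ler_pM => //; lra.
  have e2 : p ^+ 2 <= 4 * s ^+ 2 * A ^+ 2.
    have -> : 4 * s ^+ 2 * A ^+ 2 = (2 * (A * s)) ^+ 2 by ring.
    by apply: lerXn2r; rewrite ?nnegrE //; lra.
  have e3 : 0 <= G * (p * I) by rewrite mulr_ge0.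
  have -> : 2 * s ^+ 2 * A ^+ 2 * (1 + 2 * q) = 2 * s ^+ 2 * A ^+ 2 + 4 * s ^+ 2 * A ^+ 2 * q by ring.
  have e4 : 0 <= s ^+ 2 * A ^+ 2 by rewrite mulr_ge0 ?sqr_ge0.
  rewrite ler_norml; apply/andP; split; lra.
have T := expR_taylor1 w.
have T2 : `|expR w - 1 - w| <= s ^+ 2 * A ^+ 2 * (1 + 2 * q) ^+ 2 * (4 * expR (q / 2)).
  apply: (le_trans T); apply: ler_pM; rewrite ?sqr_ge0 ?expR_ge0//.
    rewrite -(ger0_norm (sqr_ge0 w)) normrX -mulrA -!exprMn.
    apply: lerXn2r => //; rewrite nnegrE; exact: le_trans ws.
  apply: (@le_trans _ _ (expR (q / 2 + 1))); first by rewrite ler_expR.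
  rewrite expRD mulrC; apply: ler_wpM2r; [exact: expR_ge0|exact: expR1_le4].
have T3 : `|expR w - (1 - alpha * s + s * g ^+ 2 / 2)| <=
    6 * (s ^+ 2 * A ^+ 2 * (1 + 2 * q) ^+ 2 * expR (q / 2)).
  have -> : expR w - (1 - alpha * s + s * g ^+ 2 / 2) = (expR w - 1 - w) + (w - (G - p / 2)).
    by rewrite /G /p; field.
  apply: (le_trans (ler_normD _ _)).
  have E1 : 1 <= expR (q / 2) by have := expR_ge1Dx (q / 2); lra.
  have S0 : 0 <= s ^+ 2 * A ^+ 2 * (1 + 2 * q) ^+ 2 by rewrite !mulr_ge0 ?sqr_ge0.
  nra.
apply: (@le_trans _ _ (expR (- q) * (6 * (s ^+ 2 * A ^+ 2 * (1 + 2 * q) ^+ 2 * expR (q / 2))))).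
  by apply: ler_wpM2l => //; exact: expR_ge0.
have -> : expR (- q) * (6 * (s ^+ 2 * A ^+ 2 * (1 + 2 * q) ^+ 2 * expR (q / 2)))
  = 6 * A ^+ 2 * s ^+ 2 * ((1 + 2 * q) ^+ 2 * (expR (- q) * expR (q / 2))) by ring.
have -> : 384 * A ^+ 2 * s ^+ 2 = 6 * A ^+ 2 * s ^+ 2 * 64 by ring.
apply: ler_wpM2l; first by rewrite !mulr_ge0 ?sqr_ge0.
rewrite -expRD.
have -> : - q + q / 2 = - (q / 4) + - (q / 4) by field.
rewrite expRD -expr2 -exprMn.
(* $(1+2q)e^{-q/4}\le 8$ because $1+2q\le 8(1+q/4)$. The square of 8, times the 6 of [T3], is
   384. *)
have -> : 64 = 8 ^+ 2 :> R by ring.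
apply: lerXn2r; rewrite ?nnegrE ?mulr_ge0 ?expR_ge0//.
have e := expR_ge1Dx (q / 4).
have e' : expR (q / 4) * expR (- (q / 4)) = 1 by rewrite -expRD subrr expR0.
have := expR_gt0 (- (q / 4)).
nra.
Qed.

Definition lindeberg_cst (A : R) : R := 2 * expR (20 * A) + 384 * A ^+ 2.

Lemma lindeberg_cst_ge0 A : 0 <= lindeberg_cst A.
Proof. by rewrite addr_ge0// mulr_ge0 ?expR_ge0 ?sqr_ge0 ?ler0n. Qed.

(** The two expansions agree up to the second moment, so exchanging [h] for a normal variable costs
    only the remainders. By $|h|^3\le Mh^2$ and $s^2\le Ms$ these are proportional to the variance,
    hence summable over many replacements. *)
Lemma lindeberg_step (J : finType) (p h : J -> R) (A q g alpha s M : R) :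
  1 <= A -> 0 <= alpha <= A -> 0 <= q -> g ^+ 2 <= 4 * alpha * q ->
  (forall x, 0 <= p x) -> \sum_x p x = 1 -> \sum_x p x * h x = 0 ->
  \sum_x p x * h x ^+ 2 = s -> (forall x, p x != 0 -> `|h x| <= M) -> M <= 1 -> 4 * A * M ^+ 2 <= 1 ->
  `|\sum_x p x * expR (- (q + g * h x + alpha * h x ^+ 2))
    - expR (- q + s * g ^+ 2 / (2 * (1 + 2 * alpha * s)) - ln (1 + 2 * alpha * s) / 2)|
  <= lindeberg_cst A * M * s.
Proof.
move=> A1 aA q0 gq p0 p1 ph0 phs hM M1 AM.
have M0 : 0 <= M.
  have [x _ px] : exists2 x, true & p x != 0.
    apply/exists_inP; apply: contraT => /exists_inPn H.
    move: p1; rewrite big1 => [/eqP|x _]; first by rewrite eq_sym oner_eq0.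
    by apply/eqP; rewrite -[_ == _]negbK H.
  exact: le_trans (normr_ge0 _) (hM x px).
have s0 : 0 <= s by rewrite -phs sumr_ge0// => x _; rewrite mulr_ge0// sqr_ge0.
have sM : s <= M ^+ 2.
  rewrite -phs -[M ^+ 2]mul1r -p1 mulr_suml; apply: ler_sum => x _.
  have [->|px] := eqVneq (p x) 0; first by rewrite !mul0r.
  apply: ler_wpM2l => //; rewrite -(ger0_norm (sqr_ge0 (h x))) normrX.
  by apply: lerXn2r => //; rewrite ?nnegrE//; exact: hM.
have B1 : `|\sum_x p x * expR (- (q + g * h x + alpha * h x ^+ 2)) -
   expR (- q) * (1 - alpha * s + s * g ^+ 2 / 2)| <= 2 * expR (20 * A) * M * s.
  have -> : expR (- q) * (1 - alpha * s + s * g ^+ 2 / 2) =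
    \sum_x p x * (expR (- q) * (1 - g * h x - alpha * h x ^+ 2 + g ^+ 2 * h x ^+ 2 / 2)).
    transitivity (expR (- q) * (\sum_x p x) - expR (- q) * g * (\sum_x p x * h x)
       + expR (- q) * (g ^+ 2 / 2 - alpha) * (\sum_x p x * h x ^+ 2)).
      by rewrite p1 ph0 phs; field.
    rewrite !mulr_sumr -sumrB -big_split /=; by apply: eq_bigr => x _; field.
  rewrite -sumrB -phs mulr_sumr; apply: (le_trans (ler_norm_sum _ _ _)).
  apply: ler_sum => x _.
  have [->|px] := eqVneq (p x) 0; first by rewrite !mul0r subrr normr0 mulr0.
  rewrite -mulrBr normrM (ger0_norm (p0 x)).
  rewrite [leRHS]mulrCA; apply: ler_wpM2l => //.
  apply: (le_trans (expR_quad_expand _ _ _ _ _ A1 aA q0 gq (le_trans (hM x px) M1))).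
  rewrite -!mulrA; apply: ler_wpM2l => //; apply: ler_wpM2l; first exact: expR_ge0.
  rewrite exprS -normrX (ger0_norm (sqr_ge0 (h x))).
  by apply: ler_wpM2r; [exact: sqr_ge0|exact: hM].
have AsM : 4 * A * s <= 1 by apply: le_trans AM; apply: ler_wpM2l => //; lra.
have B2 := expR_heat_expand _ _ _ _ _ A1 aA q0 gq s0 AsM.
have B3 : 384 * A ^+ 2 * s ^+ 2 <= 384 * A ^+ 2 * M * s.
  have -> : 384 * A ^+ 2 * M * s = (384 * A ^+ 2) * (M * s) by ring.
  apply: ler_wpM2l; first by rewrite mulr_ge0 ?ler0n ?sqr_ge0.
  rewrite expr2; apply: ler_wpM2r => //; apply: (le_trans sM).
  by rewrite expr2; nra.
move: B1 B2; rewrite !ler_norml => /andP[a1 a2] /andP[a3 a4].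
by rewrite /lindeberg_cst mulrDl mulrDl; apply/andP; split; lra.
Qed.

End Calculus.

(** * The logistic function and its log-partition function *)

Section Logistic.
Context {R : realType}.

Definition sig (x : R) : R := expR x / (1 + expR x).
Definition wt (x : R) : R := sig x * (1 - sig x).
(* Removing [x / 2] makes [Hl] even, so that the likelihood becomes a sum over ordered pairs. *)
Definition Hl (x : R) : R := ln (1 + expR x) - x / 2.

Lemma expR1D_gt0 (x : R) : 0 < 1 + expR x.
Proof. by have := expR_gt0 x; lra. Qed.

Lemma sig_gt0 x : 0 < sig x.
Proof. by rewrite divr_gt0 ?expR_gt0 ?expR1D_gt0. Qed.

Lemma onem_sig x : 1 - sig x = (1 + expR x)^-1.
Proof. by rewrite /sig; field; rewrite gt_eqF ?expR1D_gt0. Qed.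

Lemma sig_lt1 x : sig x < 1.
Proof. by rewrite -subr_gt0 onem_sig invr_gt0 expR1D_gt0. Qed.

Lemma sigN x : sig (- x) = 1 - sig x.
Proof.
rewrite onem_sig /sig expRN; field.
by have := expR_gt0 x => h; rewrite !gt_eqF//; lra.
Qed.

Lemma wtN x : wt (- x) = wt x.
Proof. by rewrite /wt sigN; ring. Qed.

Lemma wt_gt0 x : 0 < wt x.
Proof. by rewrite /wt mulr_gt0 ?sig_gt0// subr_gt0 sig_lt1. Qed.

Lemma wt_le x : wt x <= 1 / 4.
Proof. by rewrite /wt; have := sqr_ge0 (sig x - 1 / 2); rewrite expr2; lra. Qed.

Lemma wt_vfun x : wt x = (vfun x)^-1.
Proof.
rewrite /wt onem_sig /sig /vfun; field.
by rewrite !gt_eqF ?expR_gt0 ?expR1D_gt0.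
Qed.

Lemma is_derive_sig (x : R) : is_derive x 1 sig (wt x).
Proof.
have e0 : 1 + expR x != 0 by rewrite gt_eqF ?expR1D_gt0.
have d1 : is_derive x 1 (fun y : R => 1 + expR y) (expR x).
  by apply: is_derive_eq; rewrite ?/GRing.scale /=; lra.
have -> : wt x = expR x *: (- (1 + expR x) ^- 2 *: expR x) + (1 + expR x)^-1 *: expR x.
  by rewrite /GRing.scale /= /wt /sig; field.
exact: is_deriveM (is_derive_expR x) (is_deriveV (f := fun y => 1 + expR y) e0 d1).
Qed.

Lemma is_derive_wt (x : R) : is_derive x 1 wt (wt x * (1 - 2 * sig x)).
Proof.
have h := is_derive_sig x.
rewrite /wt; apply: is_derive_eq.
by rewrite /GRing.scale /= /wt; ring.
Qed.

Lemma is_derive_Hl (x : R) : is_derive x 1 Hl (sig x - 1 / 2).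
Proof.
have e0 : 0 < 1 + expR x by exact: expR1D_gt0.
have d1 : is_derive x 1 (fun y : R => 1 + expR y) (expR x).
  by apply: is_derive_eq; rewrite ?/GRing.scale /=; lra.
have d2 := is_derive1_comp (g := fun y => 1 + expR y) (is_derive1_ln e0) d1.
have d3 : is_derive x 1 (fun y : R => y / 2) (1 / 2).
  by apply: is_derive_eq; rewrite /GRing.scale /=; lra.
by rewrite /sig [_ / (1 + _)]mulrC; exact: is_deriveB d2 d3.
Qed.

Lemma is_derive_shift (f df : R -> R) (x t : R) :
  (forall y : R, is_derive y 1 f (df y)) ->
  is_derive t 1 (fun s => f (x + s)) (df (x + t)).
Proof.
move=> h; have d1 : is_derive t 1 (fun s : R => x + s) 1.
  by apply: is_derive_eq; rewrite ?/GRing.scale /=; lra.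
by have := is_derive1_comp (g := fun s => x + s) (h (x + t)) d1; rewrite mulr1.
Qed.

Lemma sig_lipschitz x t : `|sig (x + t) - sig x| <= `|t|.
Proof.
have := @mean_value_bound R sig wt x (x + t) 1 is_derive_sig.
rewrite [x + t - x]addrC addKr mul1r; apply=> y _.
by rewrite gtr0_norm ?wt_gt0//; have := wt_le y; lra.
Qed.

Lemma wt_lipschitz x t : `|wt (x + t) - wt x| <= `|t|.
Proof.
have := @mean_value_bound R wt _ x (x + t) 1 is_derive_wt.
rewrite [x + t - x]addrC addKr mul1r; apply=> y _.
have := wt_le y; have := wt_gt0 y; have := sig_gt0 y; have := sig_lt1 y.
by move=> *; rewrite ler_norml; apply/andP; split; nra.
Qed.

Lemma sig_taylor1 x t : `|sig (x + t) - sig x - wt x * t| <= t ^+ 2.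
Proof.
have := @mean_value_bound R (fun s => sig (x + s) - wt x * s)
  (fun s => wt (x + s) - wt x) 0 t `|t|.
rewrite addr0 mulr0 !subr0 -normrM -expr2 (ger0_norm (sqr_ge0 t)).
have -> : sig (x + t) - wt x * t - sig x = sig (x + t) - sig x - wt x * t by ring.
apply=> s.
  have d1 := is_derive_shift _ _ x s is_derive_sig.
  by apply: is_derive_eq; rewrite /GRing.scale /= mulr1.
by rewrite subr0 => h; apply: le_trans h; exact: wt_lipschitz.
Qed.

(** Error of the trapezoidal rule for the derivative of [Hl]. Its derivative in the step is a
    first-order Taylor remainder of [sig] based at the moving end, hence quadratic. *)
Lemma Hl_trapezoid x t :
  `|2 * (Hl (x + t) - Hl x) - t * (sig x + sig (x + t) - 1)| <= `|t| ^+ 3.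
Proof.
have := @mean_value_bound R (fun s => 2 * Hl (x + s) - s * (sig x + sig (x + s) - 1))
  (fun s => sig (x + s) - sig x - s * wt (x + s)) 0 t (t ^+ 2).
rewrite addr0 mul0r !subr0 -(ger0_norm (sqr_ge0 t)) normrX -exprSr.
have -> : 2 * Hl (x + t) - t * (sig x + sig (x + t) - 1) - 2 * Hl x =
  2 * (Hl (x + t) - Hl x) - t * (sig x + sig (x + t) - 1) by ring.
apply=> s.
  have d1 := is_derive_shift _ _ x s is_derive_sig.
  have d2 := is_derive_shift _ _ x s is_derive_Hl.
  by apply: is_derive_eq; rewrite /GRing.scale /=; lra.
rewrite subr0 => h.
have := sig_taylor1 (x + s) (- s); rewrite addrK => h1.
apply: (@le_trans _ _ (s ^+ 2)); last first.
  by rewrite -(ger0_norm (sqr_ge0 s)) normrX; apply: lerXn2r.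
have -> : sig (x + s) - sig x - s * wt (x + s) = - (sig x - sig (x + s) - wt (x + s) * - s) by ring.
by rewrite normrN; rewrite sqrrN in h1.
Qed.

(** A lower bound relative to [wt x] is what combines with the lower bound on [kap] times [wt]. The
    factor 4 bounds $e^t$ for $t\le 1$. *)
Lemma sig_incr x t : 0 <= t <= 1 -> wt x * t / 4 <= sig (x + t) - sig x.
Proof.
move=> /andP[t0 t1].
have e0 := expR_gt0 x; have f0 := expR_gt0 t.
have et := expR_ge1Dx t.
have e4 : expR t <= 4 by apply: le_trans expR1_le4; rewrite ler_expR.
rewrite /wt onem_sig /sig expRD.
have d1 : 0 < 1 + expR x by exact: expR1D_gt0.
have d2 : 0 < 1 + expR x * expR t by nra.
have -> : expR x * expR t / (1 + expR x * expR t) - expR x / (1 + expR x) =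
  expR x * (expR t - 1) / ((1 + expR x) * (1 + expR x * expR t)).
  by field; rewrite !gt_eqF.
have -> : expR x / (1 + expR x) * (1 + expR x)^-1 * t / 4 = expR x * t / ((1 + expR x) * (4 * (1 + expR x))).
  by field; rewrite gt_eqF.
apply: ler_pM.
- by rewrite mulr_ge0// ltW.
- by rewrite invr_ge0 !mulr_ge0// ltW.
- by apply: ler_wpM2l; [exact: ltW|lra].
- rewrite lef_pV2 ?posrE ?mulr_gt0//.
  by apply: ler_wpM2l; [exact: ltW|nra].
Qed.

Lemma sig_homo x t : 0 <= t -> sig x <= sig (x + t).
Proof.
move=> t0; rewrite -subr_ge0 /sig expRD.
have e0 := expR_gt0 x; have et := expR_ge1Dx t.
have d1 : 0 < 1 + expR x by exact: expR1D_gt0.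
have d2 : 0 < 1 + expR x * expR t by nra.
have -> : expR x * expR t / (1 + expR x * expR t) - expR x / (1 + expR x) =
  expR x * (expR t - 1) / ((1 + expR x) * (1 + expR x * expR t)).
  by field; rewrite !gt_eqF.
by rewrite divr_ge0 ?mulr_ge0 ?(ltW d1) ?(ltW d2) ?(ltW e0)//; lra.
Qed.

Lemma sig_decr x t : 0 <= t <= 1 -> wt x * t / 4 <= sig x - sig (x - t).
Proof.
move=> t01; have := sig_incr (- x) t t01; rewrite wtN.
have -> : - x + t = - (x - t) by ring.
by rewrite !sigN; lra.
Qed.

(** [vfun x] is $e^x+2+e^{-x}$, and a shift of size at most 1 multiplies each term by at most $e\le
    4$. *)
Lemma wt_ge_shift x t : `|t| <= 1 -> wt x / 4 <= wt (x + t).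
Proof.
move=> t1; rewrite !wt_vfun.
have v0 y : 0 < vfun y :> R by rewrite divr_gt0 ?expR_gt0// exprn_gt0// expR1D_gt0.
suff : vfun (x + t) <= 4 * vfun x.
  have -> : (vfun x)^-1 / 4 = (4 * vfun x)^-1 by rewrite [RHS]invfM mulrC.
  by move=> h; rewrite lef_pV2 ?posrE// mulr_gt0.
have vE y : vfun y = expR y + 2 + expR (- y) :> R.
  by rewrite /vfun expRN; field; rewrite gt_eqF ?expR_gt0.
rewrite !vE opprD !expRD.
have h1 : expR t <= 4.
  by apply: le_trans expR1_le4; rewrite ler_expR (le_trans (ler_norm _)).
have h2 : expR (- t) <= 4.
  by apply: le_trans expR1_le4; rewrite ler_expR (le_trans (ler_norm _))// normrN.
have := expR_gt0 x; have := expR_gt0 (- x); nra.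
Qed.

(** Convexity of [Hl] as nonnegativity of a Bregman divergence; summed over pairs it becomes
    concavity of the likelihood. *)
Lemma Hl_bregman_ge0 x t : 0 <= Hl (x + t) - Hl x - (sig x - 1 / 2) * t.
Proof.
pose f s := Hl (x + s) - (sig x - 1 / 2) * s.
pose df s := sig (x + s) - sig x.
have fd (s : R) : is_derive s 1 f (df s).
  have d2 := is_derive_shift _ _ x s is_derive_Hl.
  by rewrite /f /df; apply: is_derive_eq; rewrite /GRing.scale /=; lra.
have cf : continuous f.
  by move=> y; apply: differentiable_continuous; apply/derivable1_diffP; apply: ex_derive.
suff : f 0 <= f t by rewrite /f addr0; lra.
have [t0|t0|<-//] := ltgtP 0 t.
  have [c] := MVT t0 (fun x _ => fd x) (continuous_subspaceT cf).
  rewrite in_itv /= subr0 => /andP[c0 ct] e; rewrite -subr_ge0 e /df.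
  by rewrite mulr_ge0 ?(ltW t0)// subr_ge0 sig_homo// ltW.
have [c] := MVT t0 (fun x _ => fd x) (continuous_subspaceT cf).
rewrite in_itv /= sub0r => /andP[c0 ct] e; rewrite -subr_le0 e /df.
rewrite mulr_le0_ge0 ?oppr_ge0 ?(ltW t0)// subr_le0.
by have := sig_homo (x + c) (- c); rewrite addrK; apply; rewrite oppr_ge0 ltW.
Qed.

Lemma Hl_bregman_le x t : Hl (x + t) - Hl x - (sig x - 1 / 2) * t <= t ^+ 2.
Proof.
have := @mean_value_bound R (fun s => Hl (x + s) - (sig x - 1 / 2) * s)
  (fun s => sig (x + s) - sig x) 0 t `|t|.
rewrite addr0 mulr0 !subr0 -normrM -expr2 (ger0_norm (sqr_ge0 t)) => H.
have -> : Hl (x + t) - Hl x - (sig x - 1 / 2) * t = Hl (x + t) - (sig x - 1 / 2) * t - Hl x by ring.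
apply: (le_trans (ler_norm _)); apply: H => s.
  have d2 := is_derive_shift _ _ x s is_derive_Hl.
  by apply: is_derive_eq; rewrite /GRing.scale /=; lra.
by rewrite subr0 => h; apply: le_trans h; exact: sig_lipschitz.
Qed.

Lemma continuous_Hl : continuous Hl.
Proof.
move=> x; apply: differentiable_continuous; apply/derivable1_diffP.
have h := is_derive_Hl x; exact: ex_derive.
Qed.

End Logistic.

(** * Finite product measures: resampling and Hoeffding's inequality *)

Section ProductExpectation.
Context {R : realType} {I J : finType} (q : I -> J -> R).
Hypothesis q_ge0 : forall i x, 0 <= q i x.
Hypothesis q_sum1 : forall i, \sum_x q i x = 1.

Definition pweight (a : {ffun I -> J}) : R := \prod_i q i (a i).
Definition pexp (f : {ffun I -> J} -> R) : R := \sum_a pweight a * f a.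
Definition fupd (a : {ffun I -> J}) (i : I) (x : J) : {ffun I -> J} :=
  [ffun j => if j == i then x else a j].

Lemma pweight_ge0 a : 0 <= pweight a.
Proof. exact: prodr_ge0. Qed.

Lemma pexp_prod (F : I -> J -> R) :
  pexp (fun a => \prod_i F i (a i)) = \prod_i \sum_x q i x * F i x.
Proof.
rewrite bigA_distr_bigA /=; apply: eq_bigr => a _.
by rewrite /pweight -big_split.
Qed.

Lemma pweight_sum1 : \sum_a pweight a = 1.
Proof.
have := bigA_distr_bigA (fun i x => q i x); rewrite /= /pweight => <-.
exact: big1.
Qed.

Lemma eq_pexp f g : f =1 g -> pexp f = pexp g.
Proof. by move=> fg; apply: eq_bigr => a _; rewrite fg. Qed.

Lemma pexp_cst c : pexp (fun _ => c) = c.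
Proof. by rewrite /pexp -mulr_suml pweight_sum1 mul1r. Qed.

Lemma pexpB f g : pexp (fun a => f a - g a) = pexp f - pexp g.
Proof. by rewrite /pexp -sumrB; apply: eq_bigr => a _; rewrite mulrBr. Qed.

Lemma pexp_norm_le f c : (forall a, `|f a| <= c) -> `|pexp f| <= c.
Proof.
move=> h; apply: (le_trans (ler_norm_sum _ _ _)).
rewrite -[leRHS]pexp_cst; apply: ler_sum => a _.
by rewrite normrM (ger0_norm (pweight_ge0 a)) ler_wpM2l ?pweight_ge0.
Qed.

(** Exchanging coordinate [i] with an independent copy is an involution that preserves the product
    weight; reindexing by it gives [pexp_resample]. *)
Lemma fupd_swap (i : I) : involutive
  (fun u : {ffun I -> J} * J => (fupd u.1 i u.2, u.1 i)).
Proof.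
move=> [a x] /=; congr (_, _); last by rewrite ffunE eqxx.
by apply/ffunP => j; rewrite !ffunE; case: eqP => [->|].
Qed.

Lemma pweight_fupd a i x :
  pweight (fupd a i x) * q i (a i) = pweight a * q i x.
Proof.
rewrite /pweight (bigD1 i)//= [in RHS](bigD1 i)//= ffunE eqxx.
rewrite (eq_bigr (fun j => q j (a j))); first by ring.
by move=> j ji; rewrite ffunE (negbTE ji).
Qed.

(* Independence: one coordinate may be resampled from its own law. *)
Lemma pexp_resample i f :
  pexp f = pexp (fun a => \sum_x q i x * f (fupd a i x)).
Proof.
transitivity (\sum_(u : {ffun I -> J} * J) pweight u.1 * q i u.2 * f u.1).
  rewrite -(pair_bigA _ (fun a x => pweight a * q i x * f a)) /=.
  apply: eq_bigr => a _.
  rewrite -{1}[pweight a]mulr1 -(q_sum1 i) mulr_sumr mulr_suml.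
  by apply: eq_bigr => x _.
rewrite (reindex_inj (inv_inj (fupd_swap i))) /=.
rewrite -(pair_bigA _ (fun a x => pweight (fupd a i x) * q i (a i) * f (fupd a i x))) /=.
apply: eq_bigr => a _; rewrite mulr_sumr; apply: eq_bigr => x _.
by rewrite pweight_fupd mulrA.
Qed.

Lemma pexp_exp_sum_le (xi : I -> J -> R) (c : I -> R) (lam : R) :
  (forall i, \sum_x q i x * xi i x = 0) ->
  (forall i x, q i x != 0 -> `|xi i x| <= c i) ->
  pexp (fun a => expR (lam * \sum_i xi i (a i))) <= expR (4 * lam ^+ 2 * \sum_i c i ^+ 2).
Proof.
move=> xi0 xic.
under eq_pexp do rewrite mulr_sumr expR_sum.
rewrite (pexp_prod (fun i x => expR (lam * xi i x))) mulr_sumr expR_sum.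
apply: ler_prod => i _; apply/andP; split.
  by apply: sumr_ge0 => x _; rewrite mulr_ge0 ?expR_ge0.
apply: (@le_trans _ _ (\sum_x (lam * (q i x * xi i x) + q i x * expR (4 * lam ^+ 2 * c i ^+ 2)))).
  apply: ler_sum => x _.
  have [->|qx] := eqVneq (q i x) 0; first by rewrite !mul0r mulr0 addr0.
  have -> : lam * (q i x * xi i x) = q i x * (lam * xi i x) by ring.
  rewrite -mulrDr; apply: ler_wpM2l => //.
  apply: (le_trans (expR_le_add_expR_sqr _)); rewrite lerD2l ler_expR exprMn mulrA.
  apply: ler_wpM2l; first by rewrite mulr_ge0 ?sqr_ge0.
  rewrite -(ger0_norm (sqr_ge0 (xi i x))) normrX lerXn2r ?nnegrE ?xic//.
  exact: le_trans (xic _ _ qx).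
by rewrite big_split /= -mulr_sumr xi0 mulr0 add0r -mulr_suml q_sum1 mul1r.
Qed.

Definition pprob (A : pred {ffun I -> J}) : R := \sum_(a | A a) pweight a.

Lemma pprobE A : pprob A = pexp (fun a => (A a)%:R).
Proof.
rewrite /pprob big_mkcond; apply: eq_bigr => a _.
by case: (A a); rewrite ?mulr1 ?mulr0.
Qed.

Lemma pprob_le (A B : pred {ffun I -> J}) : (forall a, pweight a != 0 -> A a -> B a) -> pprob A <= pprob B.
Proof.
move=> AB; rewrite /pprob big_mkcond [leRHS]big_mkcond /=; apply: ler_sum => a _.
have [w0|/AB] := eqVneq (pweight a) 0; first by rewrite w0 !if_same.
by case: (A a); case: (B a) => //= h; rewrite ?pweight_ge0//; have := h isT.
Qed.

Lemma pprobU (A B : pred {ffun I -> J}) : pprob (fun a => A a || B a) <= pprob A + pprob B.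
Proof.
rewrite !pprobE /pexp -big_split /=; apply: ler_sum => a _.
rewrite -mulrDr; apply: ler_wpM2l; first exact: pweight_ge0.
by case: (A a); case: (B a); rewrite /= ?addr0 ?add0r ?lerDl.
Qed.

Lemma pprob_exists (S : finType) (A : S -> pred {ffun I -> J}) (c : R) :
  (forall s, pprob (A s) <= c) ->
  pprob (fun a => [exists s, A s a]) <= #|S|%:R * c.
Proof.
move=> h; apply: (@le_trans _ _ (\sum_s pprob (A s))); last first.
  by rewrite mulr_natl -sumr_const; apply: ler_sum.
rewrite [leRHS](eq_bigr (fun s => pexp (fun a => (A s a)%:R))) => [|s _]; last exact: pprobE.
rewrite pprobE /pexp exchange_big /=; apply: ler_sum => a _.
rewrite -mulr_sumr; apply: ler_wpM2l; first exact: pweight_ge0.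
have [/existsP[s As]|_] := boolP [exists s, A s a]; last exact: sumr_ge0.
by rewrite (bigD1 s)//= As lerDl sumr_ge0.
Qed.

Lemma pprob_hoeffding (xi : I -> J -> R) (c : I -> R) (V t : R) :
  (forall i, \sum_x q i x * xi i x = 0) ->
  (forall i x, q i x != 0 -> `|xi i x| <= c i) ->
  \sum_i c i ^+ 2 <= V -> 0 < V -> 0 < t ->
  pprob (fun a => t < `|\sum_i xi i (a i)|) <= 2 * expR (- (t ^+ 2 / (16 * V))).
Proof.
move=> xi0 xic cV V0 t0.
(* Minimizer of the Chernoff exponent $4\lambda^2V-\lambda t$. *)
pose lam := t / (8 * V).
have lam0 : 0 < lam by rewrite divr_gt0// mulr_gt0.
have one_side (eps : R) : eps ^+ 2 = 1 ->
    pprob (fun a => t < eps * \sum_i xi i (a i)) <= expR (- (t ^+ 2 / (16 * V))).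
  move=> eps1.
  have -> : - (t ^+ 2 / (16 * V)) = 4 * (lam * eps) ^+ 2 * V - lam * t.
    by rewrite exprMn eps1 /lam; field; rewrite gt_eqF.
  rewrite expRD; apply: (@le_trans _ _
    (pexp (fun a => expR (lam * eps * \sum_i xi i (a i))) * expR (- (lam * t)))); last first.
    apply: ler_wpM2r; first exact: expR_ge0.
    apply: (le_trans (pexp_exp_sum_le xi c _ xi0 xic)).
    by rewrite ler_expR; apply: ler_wpM2l => //; rewrite mulr_ge0 ?sqr_ge0.
  rewrite pprobE /pexp mulr_suml; apply: ler_sum => a _.
  rewrite -mulrA; apply: ler_wpM2l; first exact: pweight_ge0.
  rewrite -expRD; case: ltP => h; last exact: expR_ge0.
  apply: le_trans (expR_ge1Dx _); rewrite lerDl -mulrA subr_ge0.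
  by apply: ler_wpM2l; rewrite ltW.
apply: (@le_trans _ _ (pprob (fun a => (t < 1 * \sum_i xi i (a i)) || (t < -1 * \sum_i xi i (a i))))).
  apply: pprob_le => a _; rewrite mul1r mulN1r.
  by case: (ger0P (\sum_i xi i (a i))) => _ ->; rewrite ?orbT.
apply: (le_trans (pprobU _ _)).
have e1 : (-1) ^+ 2 = 1 :> R by rewrite sqrrN expr1n.
by have := one_side 1 (expr1n _ _); have := one_side (-1) e1; lra.
Qed.

End ProductExpectation.

(** * Gaussian replacement for a projected sum of squares *)

Section Lindeberg.
Context {R : realType} {I J : finType} (q : I -> J -> R).
Hypothesis q_ge0 : forall i x, 0 <= q i x.
Hypothesis q_sum1 : forall i, \sum_x q i x = 1.
Variables (xi : I -> J -> R) (M A : R).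
Hypothesis xi_mean0 : forall i, \sum_x q i x * xi i x = 0.
Hypothesis xi_le : forall i x, q i x != 0 -> `|xi i x| <= M.
Hypotheses (M_ge0 : 0 <= M) (M_le1 : M <= 1) (A_ge1 : 1 <= A) (AM : 4 * A * M ^+ 2 <= 1).

Let C := lindeberg_cst A.
Let var i := \sum_x q i x * xi i x ^+ 2.
Let lsum (ps : seq I) (a : {ffun I -> J}) := \sum_(i <- ps) xi i (a i).

Let var_ge0 i : 0 <= var i.
Proof. by apply: sumr_ge0 => x _; rewrite mulr_ge0 ?sqr_ge0. Qed.

Let C_ge0 : 0 <= C.
Proof. exact: lindeberg_cst_ge0. Qed.

(* [heat al t y be ga] is the expectation of exp(-(al Y^2 + 2 be Y + ga)) for
   Y normal with mean y and variance t. *)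
Definition heat (al t y be ga : R) : R :=
  expR (- (al * y ^+ 2 + 2 * be * y + ga)
        + t * (2 * al * y + 2 * be) ^+ 2 / (2 * (1 + 2 * al * t)) - ln (1 + 2 * al * t) / 2).

(** Once the normal part of variance [t] is integrated out, what remains is $s^{-1/2}$ times the
    exponential of minus a quadratic in the next summand, with coefficients [Q], [G], [al']. One
    replacement applies to it, and variances of normal summands add. *)
Lemma heat_step (al t y be ga : R) i : 0 <= al <= A -> 0 <= t -> 0 <= ga ->
  be ^+ 2 <= al * ga ->
  `|\sum_x q i x * heat al t (xi i x + y) be ga - heat al (t + var i) y be ga|
  <= C * M * var i.
Proof.
move=> /andP[al0 alA] t0 ga0 bega.
set Q0 := al * y ^+ 2 + 2 * be * y + ga.
set g := 2 * al * y + 2 * be.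
have gQ : g ^+ 2 <= 4 * al * Q0.
  have -> : g ^+ 2 = 4 * al * Q0 + 4 * (be ^+ 2 - al * ga) by rewrite /g /Q0; ring.
  by rewrite gerDl; lra.
have Q00 : 0 <= Q0.
  have [al1|] := ltP 0 al.
    have : 0 <= 4 * al * Q0 by apply: le_trans gQ; exact: sqr_ge0.
    by rewrite pmulr_rge0// mulr_gt0.
  move=> al1; have e : al = 0 by lra.
  have be0 : be = 0.
    by apply/eqP; rewrite -sqrf_eq0 eq_le sqr_ge0 andbT; rewrite e mul0r in bega.
  by rewrite /Q0 e be0; lra.
set s := 1 + 2 * al * t.
have at0 : 0 <= 2 * al * t by rewrite !mulr_ge0.
have s1 : 1 <= s by rewrite /s; lra.
have s0 : 0 < s by lra.
have sn : s != 0 by rewrite gt_eqF.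
pose Q := Q0 - t * g ^+ 2 / (2 * s).
pose G := g / s.
pose al' := al / s.
have al'0 : 0 <= al' by rewrite divr_ge0// ltW.
have al'A : 0 <= al' <= A.
  rewrite al'0 /= (le_trans _ alA)// /al' ler_pdivrMr//.
  by rewrite ler_peMr.
have QE : Q = Q0 / s + t * (4 * al * Q0 - g ^+ 2) / (2 * s) by rewrite /Q /s; field.
have Q0' : 0 <= Q.
  rewrite QE addr_ge0 ?divr_ge0 ?(ltW s0) ?mulr_ge0 ?subr_ge0//.
  by rewrite (ltW s0).
(* The discriminant condition survives the smoothing, so the error of the step depends on [A], [M]
   and the variance only. *)
have GQ : G ^+ 2 <= 4 * al' * Q.
  have -> : 4 * al' * Q = G ^+ 2 + (4 * al * Q0 - g ^+ 2) / s.
    by rewrite /G /al' /Q /s; field.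
  by rewrite lerDl divr_ge0 ?subr_ge0 ?(ltW s0).
have step := @lindeberg_step R J (q i) (xi i) A Q G al' (var i) M A_ge1 al'A Q0' GQ
  (q_ge0 i) (q_sum1 i) (xi_mean0 i) erefl (xi_le i) M_le1 AM.
have E1 : \sum_x q i x * heat al t (xi i x + y) be ga =
  expR (- ln s / 2) * \sum_x q i x * expR (- (Q + G * xi i x + al' * xi i x ^+ 2)).
  rewrite mulr_sumr; apply: eq_bigr => x _; rewrite mulrCA; congr (_ * _).
  rewrite -expRD /heat; congr expR; rewrite -/s /Q /G /al' /Q0 /g.
  by move: (ln s) sn; rewrite /s => l sn; field.
have E2 : heat al (t + var i) y be ga =
  expR (- ln s / 2) * expR (- Q + var i * G ^+ 2 / (2 * (1 + 2 * al' * var i)) - ln (1 + 2 * al' * var i) / 2).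
  have v0 := var_ge0 i.
  have av : 0 <= al * var i by rewrite mulr_ge0.
  have sv : 0 < s + 2 * al * var i by lra.
  have e1 : 1 + 2 * al * (t + var i) = s * (1 + 2 * al' * var i).
    by rewrite /al' /s; field.
  have p1 : 0 < 1 + 2 * al' * var i by rewrite ltr_pwDl// mulr_ge0// mulr_ge0.
  rewrite -expRD /heat -/Q0 -/g e1 lnM ?posrE//; congr expR.
  rewrite /Q /G.
  have -> : 1 + 2 * al' * var i = (s + 2 * al * var i) / s by rewrite /al'; field.
  move: sv; rewrite /s => sv; field.
  by rewrite -/s sn gt_eqF.
rewrite E1 E2 -mulrBr normrM (gtr0_norm (expR_gt0 _)).
rewrite -[leRHS]mul1r; apply: ler_pM; rewrite ?expR_ge0//.
rewrite expR_le1 mulNr oppr_le0 divr_ge0//.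
by rewrite ln_ge0.
Qed.

Lemma lsum_fupd ps i x a : i \notin ps -> lsum ps (fupd a i x) = lsum ps a.
Proof.
move=> ips; rewrite /lsum; apply: eq_big_seq => j jps.
by rewrite ffunE; case: eqP => // e; rewrite -e jps in ips.
Qed.

(* Lindeberg replacement: each summand of [lsum ps] is traded for its variance in the heat flow. *)
Lemma heat_flow (ps : seq I) (al t : R) (be ga : {ffun I -> J} -> R) :
  uniq ps -> 0 <= al <= A -> 0 <= t -> (forall a, 0 <= ga a) ->
  (forall a, be a ^+ 2 <= al * ga a) ->
  (forall i x a, i \in ps -> be (fupd a i x) = be a) ->
  (forall i x a, i \in ps -> ga (fupd a i x) = ga a) ->
  `|pexp q (fun a => heat al t (lsum ps a) (be a) (ga a))
    - pexp q (fun a => heat al (t + \sum_(i <- ps) var i) 0 (be a) (ga a))|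
  <= C * M * \sum_(i <- ps) var i.
Proof.
move=> + al0A + ga0 bega; elim: ps t => [|i ps IH] t.
  move=> _ _ _ _; rewrite big_nil addr0 mulr0 (eq_pexp q _ (fun a => heat al t 0 (be a) (ga a))).
    by rewrite subrr normr0.
  by move=> a; rewrite /lsum big_nil.
move=> /= /andP[ips ups] t0 bei gai.
have v0 := var_ge0 i.
have := IH (t + var i) ups (addr_ge0 t0 v0)
  (fun j x a jps => bei j x a (mem_behead (s := i :: ps) jps))
  (fun j x a jps => gai j x a (mem_behead (s := i :: ps) jps)).
rewrite !big_cons addrA => IH'.
have -> : pexp q (fun a => heat al t (lsum (i :: ps) a) (be a) (ga a)) =
   pexp q (fun a => \sum_x q i x * heat al t (xi i x + lsum ps a) (be a) (ga a)).
  rewrite (pexp_resample q q_sum1 i); apply: eq_pexp => a; apply: eq_bigr => x _.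
  rewrite bei ?mem_head// gai ?mem_head// {1}/lsum big_cons -/(lsum ps _).
  by rewrite ffunE eqxx lsum_fupd.
have st : `|pexp q (fun a => \sum_x q i x * heat al t (xi i x + lsum ps a) (be a) (ga a))
   - pexp q (fun a => heat al (t + var i) (lsum ps a) (be a) (ga a))| <= C * M * var i.
  rewrite -pexpB; apply: pexp_norm_le => // a.
  exact: heat_step.
rewrite mulrDr; move: st IH'; rewrite !ler_norml => /andP[? ?] /andP[? ?].
by apply/andP; split; lra.
Qed.

Lemma cauchy_schwarz_seq (S : Type) (bs : seq S) (u x : S -> R) :
  (\sum_(b <- bs) u b * x b) ^+ 2 <= (\sum_(b <- bs) u b ^+ 2) * \sum_(b <- bs) x b ^+ 2.
Proof.
elim: bs => [|b bs IH]; first by rewrite !big_nil expr2 mulr0.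
rewrite !big_cons.
set L := \sum_(j <- bs) _ in IH *; set U := \sum_(j <- bs) _ in IH *.
set X := \sum_(j <- bs) _ in IH *.
have U0 : 0 <= U by apply: sumr_ge0 => ? _; exact: sqr_ge0.
have X0 : 0 <= X by apply: sumr_ge0 => ? _; exact: sqr_ge0.
suff h : 2 * (u b * x b) * L <= u b ^+ 2 * X + x b ^+ 2 * U.
  have -> : (u b * x b + L) ^+ 2 = (u b * x b) ^+ 2 + 2 * (u b * x b) * L + L ^+ 2 by ring.
  have -> : (u b ^+ 2 + U) * (x b ^+ 2 + X) = (u b * x b) ^+ 2 + (u b ^+ 2 * X + x b ^+ 2 * U) + U * X by ring.
  by lra.
set p := u b ^+ 2 * X; set r := x b ^+ 2 * U.
have p0 : 0 <= p by rewrite mulr_ge0 ?sqr_ge0.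
have r0 : 0 <= r by rewrite mulr_ge0 ?sqr_ge0.
apply: (le_trans (ler_norm _)).
rewrite -(@ler_pXn2r _ 2) ?nnegrE ?addr_ge0// -normrX ger0_norm ?sqr_ge0//.
apply: (@le_trans _ _ (4 * p * r)).
  have -> : (2 * (u b * x b) * L) ^+ 2 = 4 * (u b * x b) ^+ 2 * L ^+ 2 by ring.
  have -> : 4 * p * r = 4 * (u b * x b) ^+ 2 * (U * X) by rewrite /p /r; ring.
  by apply: ler_wpM2l => //; rewrite mulr_ge0 ?sqr_ge0.
have -> : (p + r) ^+ 2 = (p - r) ^+ 2 + 4 * p * r by ring.
by rewrite lerDr sqr_ge0.
Qed.

(* Integrating out one block of the Gaussian approximation only changes the coefficient [c] of the
   rank-one term, which makes an induction on the blocks possible. *)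
Lemma laplace_projection (S : eqType) (P : S -> seq I) (u : S -> R) (k : R) (bs : seq S) (c : R) :
  0 <= k <= A -> uniq bs -> (forall b, b \in bs -> uniq (P b)) ->
  (forall b b' i, b \in bs -> b' \in bs -> i \in P b -> i \in P b' -> b = b') ->
  (forall b, b \in bs -> \sum_(i <- P b) var i = 1) ->
  0 <= c -> c * \sum_(b <- bs) u b ^+ 2 <= k ->
  `|pexp q (fun a => expR (- (k * \sum_(b <- bs) lsum (P b) a ^+ 2)
                           + c * (\sum_(b <- bs) u b * lsum (P b) a) ^+ 2))
    - expR (- ((size bs)%:R * ln (1 + 2 * k)
               + ln (1 - 2 * c * (\sum_(b <- bs) u b ^+ 2) / (1 + 2 * k))) / 2)|
  <= (size bs)%:R * (C * M).
Proof.
move=> /andP[k0 kA].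
have CM0 : 0 <= C * M by rewrite mulr_ge0.
elim: bs c => [|b bs IH] c.
  move=> *; rewrite !big_nil !mul0r mulr0 mul0r subr0 ln1 addr0 oppr0 mul0r expR0.
  rewrite (eq_pexp q _ (fun=> 1)); first by rewrite pexp_cst// subrr normr0.
  by move=> a; rewrite !big_nil expr2 !mulr0 oppr0 addr0 expR0.
move=> /= /andP[bbs ubs] uP disj var1 c0 cUk.
set U := \sum_(j <- bs) u j ^+ 2.
have U0 : 0 <= U by apply: sumr_ge0 => ? _; exact: sqr_ge0.
have u20 : 0 <= u b ^+ 2 by exact: sqr_ge0.
rewrite big_cons -/U in cUk.
have cub : 0 <= c * u b ^+ 2 by rewrite mulr_ge0.
have cU0 : 0 <= c * U by rewrite mulr_ge0.
rewrite mulrDr in cUk.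
(* As a function of the sum over block [b], the exponent is minus a quadratic with leading
   coefficient [al], linear coefficient [2 * be] and constant term [ga]; [be] and [ga] see only the
   other blocks. *)
pose al := k - c * u b ^+ 2.
have al0 : 0 <= al by rewrite /al; lra.
have alA : 0 <= al <= A by rewrite al0 /al; lra.
pose S1 a := \sum_(j <- bs) lsum (P j) a ^+ 2.
pose L a := \sum_(j <- bs) u j * lsum (P j) a.
have LS a : L a ^+ 2 <= U * S1 a by exact: cauchy_schwarz_seq.
have S10 a : 0 <= S1 a by apply: sumr_ge0 => ? _; exact: sqr_ge0.
pose be a := - (c * u b * L a).
pose ga a := k * S1 a - c * L a ^+ 2.
have cLS a : c * L a ^+ 2 <= c * U * S1 a by rewrite -mulrA ler_wpM2l.
have ga0 a : 0 <= ga a.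
  rewrite /ga subr_ge0 (le_trans (cLS a))// ler_wpM2r//; lra.
have bega a : be a ^+ 2 <= al * ga a.
  rewrite -subr_ge0.
  have -> : al * ga a - be a ^+ 2 = k * ((k - c * u b ^+ 2) * S1 a - c * L a ^+ 2).
    by rewrite /al /ga /be; ring.
  rewrite mulr_ge0// subr_ge0 (le_trans (cLS a))// ler_wpM2r//; lra.
have inP j i x a : j \in bs -> i \in P b -> lsum (P j) (fupd a i x) = lsum (P j) a.
  move=> jbs iPb; apply: lsum_fupd; apply: contra bbs => iPj.
  by rewrite (disj b j i)// ?mem_head// in_cons jbs orbT.
have Linv i x a : i \in P b -> L (fupd a i x) = L a.
  by move=> iPb; apply: eq_big_seq => j jbs; rewrite inP.
have Sinv i x a : i \in P b -> S1 (fupd a i x) = S1 a.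
  by move=> iPb; apply: eq_big_seq => j jbs; rewrite inP.
have := @heat_flow (P b) al 0 be ga (uP b (mem_head _ _)) alA (lexx _) ga0 bega
  (fun i x a h => congr1 (fun z => - (c * u b * z)) (Linv i x a h))
  (fun i x a h => congr2 (fun z z' => k * z - c * z' ^+ 2) (Sinv i x a h) (Linv i x a h)).
rewrite var1 ?mem_head// add0r mulr1.
rewrite (eq_pexp q _ (fun a => expR (- (k * \sum_(b <- b :: bs) lsum (P b) a ^+ 2)
                           + c * (\sum_(b <- b :: bs) u b * lsum (P b) a) ^+ 2))); last first.
  move=> a; rewrite !big_cons -/(S1 a) -/(L a) /heat; congr expR.
  rewrite !mul0r addr0 mulr0 addr0 ln1 mul0r subr0 /al /be /ga; ring.
pose D := 1 + 2 * k - 2 * c * u b ^+ 2.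
have D1 : 1 <= D by rewrite /D; lra.
have D0 : D != 0 by rewrite gt_eqF//; lra.
(* The Gaussian integral over the block adds $2be^2/D$ to the exponent, and this merges with $cL^2$
   into $c'L^2$. *)
pose c' := c * (1 + 2 * k) / D.
have -> : pexp q (fun a => heat al 1 0 (be a) (ga a)) = expR (- ln D / 2) *
  pexp q (fun a => expR (- (k * S1 a) + c' * L a ^+ 2)).
  rewrite /pexp mulr_sumr; apply: eq_bigr => a _; rewrite mulrCA; congr (_ * _).
  rewrite -expRD /heat; congr expR.
  have -> : 1 + 2 * al * 1 = D by rewrite /al /D; ring.
  rewrite /be /ga /c' /D; field.
  by [].
have c'0 : 0 <= c' by rewrite divr_ge0 ?mulr_ge0//; lra.
have c'U : c' * U <= k.
  rewrite /c' mulrAC ler_pdivrMr; last lra.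
  rewrite /D.
  have : 0 <= k - (c * u b ^+ 2 + c * U) by lra.
  move=> h; have := mulr_ge0 k0 h; lra.
have := IH c' ubs (fun j jbs => uP j (mem_behead (s := b :: bs) jbs))
  (fun j j' i jbs jbs' => disj j j' i (mem_behead (s := b :: bs) jbs) (mem_behead (s := b :: bs) jbs'))
  (fun j jbs => var1 j (mem_behead (s := b :: bs) jbs)) c'0 c'U.
rewrite -/U -/(S1) => IHc step.
(* The closed form is $\det(I+2(kI-c\,uu^\top))^{-1/2}$; removing one block takes the factor [D] out
   of the determinant. *)
have F : expR (- ((size bs).+1%:R * ln (1 + 2 * k)
               + ln (1 - 2 * c * (\sum_(b <- b :: bs) u b ^+ 2) / (1 + 2 * k))) / 2)
  = expR (- ln D / 2) * expR (- ((size bs)%:R * ln (1 + 2 * k)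
               + ln (1 - 2 * c' * U / (1 + 2 * k))) / 2).
  rewrite -expRD big_cons -/U; congr expR.
  have k1 : 0 < 1 + 2 * k by lra.
  have e1 : 0 < 1 - 2 * c' * U / (1 + 2 * k).
    by rewrite subr_gt0 ltr_pdivrMr//; lra.
  have e2 : 0 < 1 - 2 * c * (u b ^+ 2 + U) / (1 + 2 * k).
    by rewrite subr_gt0 ltr_pdivrMr//; lra.
  have : ln (1 + 2 * k) + ln (1 - 2 * c * (u b ^+ 2 + U) / (1 + 2 * k)) =
         ln D + ln (1 - 2 * c' * U / (1 + 2 * k)).
    rewrite -!lnM ?posrE//; last lra.
    congr ln; rewrite /c'; move: D0; rewrite /D => D0; field.
    by rewrite D0 gt_eqF.
  by rewrite -[(size bs).+1%:R]natr1; lra.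
rewrite F -[(size bs).+1%:R]natr1 [(_ + 1) * (C * M)]mulrDl [1 * (C * M)]mul1r.
have Dle : expR (- ln D / 2) <= 1.
  by rewrite expR_le1 mulNr oppr_le0 divr_ge0// ln_ge0.
have N0 : 0 <= (size bs)%:R * (C * M) by rewrite mulr_ge0.
apply: (le_trans (ler_distD (expR (- ln D / 2) * pexp q (fun a => expR (- (k * S1 a) + c' * L a ^+ 2))) _ _)).
rewrite [leRHS]addrC; apply: lerD => //.
rewrite -mulrBr normrM (gtr0_norm (expR_gt0 _)).
by rewrite -[leRHS]mul1r; apply: ler_pM => //; exact: expR_ge0.
Qed.

End Lindeberg.

(** * Sums, oscillation and one-sided optimality *)

Section FiniteSums.
Context {R : realType}.

Lemma sum_le_card (I : finType) (P : pred I) (f : I -> R) (M : R) :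
  (forall i, P i -> f i <= M) -> \sum_(i | P i) f i <= #|P|%:R * M.
Proof. by move=> h; rewrite mulr_natl -sumr_const; apply: ler_sum. Qed.

Lemma norm_sum_le_card (I : finType) (P : pred I) (f : I -> R) (M c : R) :
  (forall i, P i -> `|f i| <= M) -> 0 <= M -> #|P|%:R <= c -> `|\sum_(i | P i) f i| <= c * M.
Proof.
move=> h M0 Pc; apply: (le_trans (ler_norm_sum _ _ _)); apply: (le_trans (sum_le_card _ _ _ _ h)).
exact: ler_wpM2r.
Qed.

Lemma sum_antisym (I : finType) (F : I -> I -> R) (h : I -> R) :
  (forall i j, F j i = - F i j) ->
  \sum_i \sum_j F i j * h i = 1 / 2 * \sum_i \sum_j F i j * (h i - h j).
Proof.
move=> Fa; suff : \sum_i \sum_j F i j * h j = - \sum_i \sum_j F i j * h i.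
  move=> e; have -> : \sum_i \sum_j F i j * (h i - h j) =
    \sum_i \sum_j F i j * h i - \sum_i \sum_j F i j * h j.
    rewrite -sumrB; apply: eq_bigr => i _; rewrite -sumrB; apply: eq_bigr => j _; exact: mulrBr.
  by rewrite e; lra.
rewrite exchange_big /= -sumrN; apply: eq_bigr => i _; rewrite -sumrN; apply: eq_bigr => j _.
by rewrite Fa mulNr.
Qed.

(* Everything below on oscillations rests on this: an upper bound for the mean gap to
   the maximum and for the mean gap to the minimum bounds their distance. *)
Lemma osc_le_mean_gap (I : finType) (P : pred I) (f : I -> R) (X : R) :
  (forall i, P i -> (forall j, P j -> f j <= f i) -> \sum_(j | P j) (f i - f j) <= X) ->
  (forall i, P i -> (forall j, P j -> f i <= f j) -> \sum_(j | P j) (f j - f i) <= X) ->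
  forall i j, P i -> P j -> #|P|%:R * (f i - f j) <= 2 * X.
Proof.
move=> hmax hmin i j Pi Pj.
case: (arg_maxP f Pi) => p Pp pmax.
case: (arg_minP f Pi) => m Pm mmin.
have h1 := hmax p Pp pmax; have h2 := hmin m Pm mmin.
apply: (@le_trans _ _ (#|P|%:R * (f p - f m))).
  by apply: ler_wpM2l => //; apply: lerB; [exact: pmax|exact: mmin].
rewrite mulr_natl -sumr_const.
rewrite (eq_bigr (fun l => (f p - f l) + (f l - f m))); last by move=> l _; ring.
by rewrite big_split /=; lra.
Qed.

Lemma continuous_sumr (T : topologicalType) (I : Type) (r : seq I) (F : I -> T -> R) :
  (forall i, continuous (F i)) -> continuous (fun x => \sum_(i <- r) F i x).
Proof.
move=> cF; elim: r => [|i r IH] x.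
  have -> : (fun x => \sum_(i <- [::]) F i x) = cst 0.
    by apply/funext => y; rewrite big_nil.
  exact: cvg_cst.
have -> : (fun x => \sum_(i <- i :: r) F i x) = (fun x => F i x + \sum_(i <- r) F i x).
  by apply/funext => y; rewrite big_cons.
by apply: cvgD; [exact: cF|exact: IH].
Qed.

(** A one-sided first-order condition: divide by [t] and let [t] tend to 0. *)
Lemma le0_of_quadratic_bound (s c t0 : R) : 0 < t0 ->
  (forall t : R, 0 < t <= t0 -> t * s <= c * t ^+ 2) -> s <= 0.
Proof.
move=> t00 h; rewrite leNgt; apply/negP => s0.
pose t := Num.min t0 (s / (2 * (`|c| + 1))).
have c1 : 0 < `|c| + 1 by rewrite ltr_wpDl.
have tpos : 0 < t by rewrite /t lt_min t00 divr_gt0// mulr_gt0.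
have tt0 : t <= t0 by rewrite /t ge_min lexx.
have ts : t <= s / (2 * (`|c| + 1)) by rewrite /t ge_min lexx orbT.
have := h t; rewrite tpos tt0 => /(_ isT).
have -> : c * t ^+ 2 = t * (c * t) by ring.
rewrite ler_pM2l// leNgt => /negP; apply.
rewrite ler_pdivlMr ?mulr_gt0// in ts.
have := ler_norm c; nra.
Qed.

End FiniteSums.

(** * The log-likelihood: increments, concavity and existence of maximizers *)

Section Likelihood.
Context {R : realType} {n : nat}.
Variables (kap : 'I_n -> 'I_n -> R) (e : 'I_n -> R).
Hypothesis kap_sym : forall i j, kap i j = kap j i.
Hypothesis kap_ge0 : forall i j, 0 <= kap i j.
Hypothesis e_sum0 : \sum_i e i = 0.

Definition lik (g : 'I_n -> R) : R :=
  \sum_i e i * g i - 1 / 2 * \sum_i \sum_j kap i j * Hl (g i - g j).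

Definition score (g : 'I_n -> R) (i : 'I_n) : R :=
  e i - \sum_j kap i j * (sig (g i - g j) - 1 / 2).

Lemma sum_score_diff (g f : 'I_n -> R) :
  \sum_i score g i * f i =
  \sum_i e i * f i - 1 / 2 * \sum_i \sum_j kap i j * (sig (g i - g j) - 1 / 2) * (f i - f j).
Proof.
rewrite -sum_antisym => [|i j]; last first.
  by rewrite kap_sym -[g j - g i]opprB sigN; field.
rewrite -sumrB; apply: eq_bigr => i _.
by rewrite /score mulrBl; congr (_ - _); rewrite mulr_suml.
Qed.

(** Exact: a first-order term minus Bregman divergences of [Hl] over pairs. Bounds on the divergence
    from below and above give [lik_concave] and [lik_lower]. *)
Lemma lik_increment (g h : 'I_n -> R) :
  lik h - lik g = \sum_i score g i * (h i - g i)
   - 1 / 2 * \sum_i \sum_j kap i j * (Hl ((g i - g j) + ((h i - g i) - (h j - g j)))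
      - Hl (g i - g j) - (sig (g i - g j) - 1 / 2) * ((h i - g i) - (h j - g j))).
Proof.
rewrite sum_score_diff /lik.
have -> : \sum_i e i * (h i - g i) = \sum_i e i * h i - \sum_i e i * g i.
  by rewrite -sumrB; apply: eq_bigr => i _; rewrite mulrBr.
have -> : \sum_i \sum_j kap i j * (Hl ((g i - g j) + ((h i - g i) - (h j - g j)))
      - Hl (g i - g j) - (sig (g i - g j) - 1 / 2) * ((h i - g i) - (h j - g j))) =
  \sum_i \sum_j kap i j * Hl (h i - h j) - \sum_i \sum_j kap i j * Hl (g i - g j)
  - \sum_i \sum_j kap i j * (sig (g i - g j) - 1 / 2) * ((h i - g i) - (h j - g j)).
  rewrite -!sumrB; apply: eq_bigr => i _; rewrite -!sumrB; apply: eq_bigr => j _.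
  have -> : g i - g j + (h i - g i - (h j - g j)) = h i - h j by ring.
  by ring.
by ring.
Qed.

Lemma lik_concave (g h : 'I_n -> R) : lik h <= lik g + \sum_i score g i * (h i - g i).
Proof.
rewrite -lerBlDl lik_increment gerBl mulr_ge0// sumr_ge0// => i _.
by rewrite sumr_ge0// => j _; rewrite mulr_ge0// Hl_bregman_ge0.
Qed.

Lemma lik_lower (g h : 'I_n -> R) : lik g + \sum_i score g i * (h i - g i)
   - 1 / 2 * \sum_i \sum_j kap i j * ((h i - g i) - (h j - g j)) ^+ 2 <= lik h.
Proof.
rewrite -addrA -lerBrDl lik_increment lerD2l lerN2; apply: ler_wpM2l => //.
apply: ler_sum => i _; apply: ler_sum => j _; apply: ler_wpM2l => //.
exact: Hl_bregman_le.
Qed.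

(** The trapezoidal rule applied pair by pair. Only scores at the two ends appear, so stationarity
    at an end removes its share. *)
Lemma lik_trapezoid (g h : 'I_n -> R) :
  `|2 * (lik h - lik g) - \sum_i (score g i + score h i) * (h i - g i)|
  <= 1 / 2 * \sum_i \sum_j kap i j * `|(h i - g i) - (h j - g j)| ^+ 3.
Proof.
have -> : \sum_i (score g i + score h i) * (h i - g i) =
  \sum_i score g i * (h i - g i) + \sum_i score h i * (h i - g i).
  by rewrite -big_split; apply: eq_bigr => i _; exact: mulrDl.
rewrite !sum_score_diff.
have -> : 2 * (lik h - lik g) = 2 * (\sum_i e i * (h i - g i)) -
   \sum_i \sum_j kap i j * (Hl (h i - h j) - Hl (g i - g j)).
  have -> : \sum_i e i * (h i - g i) = \sum_i e i * h i - \sum_i e i * g i.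
    by rewrite -sumrB; apply: eq_bigr => i _; rewrite mulrBr.
  have -> : \sum_i \sum_j kap i j * (Hl (h i - h j) - Hl (g i - g j)) =
    \sum_i \sum_j kap i j * Hl (h i - h j) - \sum_i \sum_j kap i j * Hl (g i - g j).
    rewrite -!sumrB; apply: eq_bigr => i _; rewrite -!sumrB; apply: eq_bigr => j _; exact: mulrBr.
  by rewrite /lik; field.
set Z := \sum_i e i * _.
set S0 := \sum_i \sum_j kap i j * (_ - _); set S1 := \sum_i \sum_j _; set S2 := \sum_i \sum_j _.
have -> : 2 * Z - S0 - (Z - 1 / 2 * S1 + (Z - 1 / 2 * S2)) = - (1 / 2 * (2 * S0 - S1 - S2)) by field.
rewrite normrN normrM ger0_norm//; apply: ler_wpM2l => //.
have -> : 2 * S0 - S1 - S2 = \sum_i \sum_j kap i j * (2 * (Hl (h i - h j) - Hl (g i - g j))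
   - ((h i - g i) - (h j - g j)) * (sig (g i - g j) + sig (h i - h j) - 1)).
  rewrite /S0 /S1 /S2 mulr_sumr -!sumrB; apply: eq_bigr => i _.
  rewrite mulr_sumr -!sumrB; apply: eq_bigr => j _; by field.
apply: (le_trans (ler_norm_sum _ _ _)); apply: ler_sum => i _.
apply: (le_trans (ler_norm_sum _ _ _)); apply: ler_sum => j _.
rewrite normrM (ger0_norm (kap_ge0 _ _)); apply: ler_wpM2l => //.
have -> : h i - h j = (g i - g j) + ((h i - g i) - (h j - g j)) by ring.
exact: Hl_trapezoid.
Qed.

(** Pair terms see differences only, and the linear term is unchanged because the [e i] sum to 0.
    This allows a maximizer to be renormalized to deviation 0 at [o]. *)
Lemma lik_shift (g : 'I_n -> R) c : lik (fun j => g j + c) = lik g.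
Proof.
rewrite /lik; congr (_ - 1 / 2 * _).
  under eq_bigr do rewrite mulrDr.
  by rewrite big_split /= -mulr_suml e_sum0 mul0r addr0.
apply: eq_bigr => i _; apply: eq_bigr => j _; congr (_ * Hl _); ring.
Qed.

Lemma continuous_lik_comp (bet : 'I_n -> R) (pi : 'I_n -> 'I_n) :
  continuous (fun th : 'rV[R]_n => lik (fun i => bet i + th ord0 (pi i))).
Proof.
have cc i : continuous (fun th : 'rV[R]_n => bet i + th ord0 (pi i)).
  move=> th; apply: (@continuousD _ _ _ (cst (bet i)) (fun th : 'rV[R]_n => th ord0 (pi i))).
    exact: cst_continuous.
  exact: coord_continuous.
have cM (c : R) (f : 'rV[R]_n -> R) : continuous f -> continuous (fun th => c * f th).
  by move=> cf th; apply: (@continuousM _ _ (cst c) f); [exact: cst_continuous|exact: cf].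
have c1 : continuous (fun th : 'rV[R]_n => \sum_i e i * (bet i + th ord0 (pi i))).
  by apply: continuous_sumr => i; exact: cM.
have c2 : continuous (fun th : 'rV[R]_n => 1 / 2 * \sum_i \sum_j kap i j *
    Hl (bet i + th ord0 (pi i) - (bet j + th ord0 (pi j)))).
  apply: (cM _ _); apply: continuous_sumr => i; apply: continuous_sumr => j; apply: (cM _ _) => th.
  apply: (@continuous_comp _ _ _
    (fun th : 'rV[R]_n => bet i + th ord0 (pi i) - (bet j + th ord0 (pi j))) Hl).
    exact: (@continuousB _ _ _ (fun th : 'rV[R]_n => bet i + th ord0 (pi i)) _ th (cc i th) (cc j th)).
  exact: continuous_Hl.
by move=> th; exact: (@continuousB _ _ _ _ _ th (c1 th) (c2 th)).
Qed.

Section MaximizerExists.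
Variables (bet : 'I_n -> R) (pi : 'I_n -> 'I_n) (b A : R) (o : 'I_n).
Hypothesis b_gt0 : 0 < b.
Hypothesis kap_wt : forall i j, i != j -> 1 <= b * (kap i j * wt (bet i - bet j)).
Hypothesis fibre_score : forall j, `|\sum_(i | pi i == j) score bet i| <= A.
Hypothesis A_small : 8 * b * A / n%:R < 1 / 2.

(** [pi] encodes equality constraints on the displacement: items with the same image move together.
    The identity gives the full model, and collapsing the block to one item gives the null model. *)
Let shifted (th : 'I_n -> R) i := bet i + th (pi i).

Let box_max (th : 'I_n -> R) := (forall i, `|th (pi i)| <= 1 / 2) /\
  forall th' : 'I_n -> R, (forall i, `|th' (pi i)| <= 1 / 2) -> lik (shifted th') <= lik (shifted th).

Let box_max_exists : exists th, box_max th.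
Proof.
pose Bx := [set v : 'rV[R]_n | forall i, `[- (1 / 2), 1 / 2]%classic (v ord0 i)].
have cB : compact Bx.
  by apply: (@rV_compact R n (fun=> `[- (1 / 2), 1 / 2]%classic)) => i; exact: segment_compact.
have B0 : Bx !=set0.
  by exists (0 : 'rV[R]_n) => i /=; rewrite mxE in_itv /=; apply/andP; split; lra.
have [v vB vmax] := @EVT_max_rV R n (fun th => lik (fun i => bet i + th ord0 (pi i)))
  Bx B0 cB (continuous_subspaceT (continuous_lik_comp bet pi)).
exists (fun i => v ord0 i); split => [i|th' h].
  by move: vB; rewrite inE => /(_ (pi i)); rewrite /= in_itv /= ler_norml.
(* [box_max] leaves the coordinates outside the image of [pi] free; they are set to 0 to stay in the
   compact box. *)
pose w : 'rV[R]_n := \row_j (if j \in codom pi then th' j else 0).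
have wE i : w ord0 (pi i) = th' (pi i) by rewrite mxE codom_f.
have := vmax w.
rewrite (_ : (fun i => bet i + w ord0 (pi i)) = shifted th'); last first.
  by apply/funext => i; rewrite wE.
apply; rewrite inE => j /=; rewrite mxE in_itv /=; case: ifP => [/codomP[i ->]|_].
  by rewrite -ler_norml.
by apply/andP; split; lra.
Qed.

Let fibre th j := \sum_(i | pi i == j) score (shifted th) i.

(** [eps] is the sign of a feasible direction, so a coordinate on the boundary of the box still
    yields one inequality; [lik_lower] bounds the second-order loss. *)
Let first_order th j (eps t0 : R) : box_max th -> eps ^+ 2 = 1 -> 0 < t0 ->
  (forall i, pi i = j -> forall t : R, 0 < t <= t0 -> `|th j + eps * t| <= 1 / 2) ->
  eps * fibre th j <= 0.
Proof.
move=> [thb thmax] eps1 t00 feas.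
apply: (@le0_of_quadratic_bound R _ (1 / 2 * \sum_i \sum_j kap i j * 4) t0 t00) => t t01.
pose th' l := if l == j then th j + eps * t else th l.
have dE i : shifted th' i - shifted th i = if pi i == j then eps * t else 0.
  by rewrite /shifted /th'; case: eqP => [->|_]; ring.
have := thmax th'; have := lik_lower (shifted th) (shifted th').
have -> : \sum_i score (shifted th) i * (shifted th' i - shifted th i) = t * (eps * fibre th j).
  rewrite /fibre [in RHS]big_mkcond !mulr_sumr; apply: eq_bigr => i _; rewrite dE.
  by case: ifP => _; ring.
have le1 : \sum_i \sum_l kap i l * (shifted th' i - shifted th i - (shifted th' l - shifted th l)) ^+ 2
   <= \sum_i \sum_l kap i l * 4 * t ^+ 2.
  apply: ler_sum => i _; apply: ler_sum => l _; rewrite -mulrA; apply: ler_wpM2l => //.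
  have t20 : 0 <= t ^+ 2 by exact: sqr_ge0.
  rewrite !dE; case: ifP => _; case: ifP => _; rewrite ?subrr ?subr0 ?sub0r ?sqrrN ?exprMn ?eps1; lra.
have {}le1 : \sum_i \sum_l kap i l * (shifted th' i - shifted th i - (shifted th' l - shifted th l)) ^+ 2
   <= (\sum_i \sum_l kap i l * 4) * t ^+ 2.
  apply: (le_trans le1); rewrite mulr_suml; apply: ler_sum => i _.
  by rewrite mulr_suml.
move=> h1 h2.
have := h2 _; suff f : forall i, `|th' (pi i)| <= 1 / 2 by move=> /(_ f); lra.
move=> i; rewrite /th'; case: eqP => [pij|_]; last exact: thb.
exact: (feas i).
Qed.

(* A maximizer over the box [|th| <= 1/2] satisfies one-sided first-order conditions at its extreme
   coordinates; these force its oscillation below 1/2, so that after a shift it is interior. *)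
Lemma maximizer_exists : exists del : 'I_n -> R,
  [/\ forall i j, pi i = pi j -> del i = del j, del o = 0,
      forall i j, `|del i - del j| <= 8 * b * A / n%:R
    & forall j, \sum_(i | pi i == j) score (fun i => bet i + del i) i = 0].
Proof.
have n0 : 0 < n%:R :> R by rewrite ltr0n; case: (n) o => [[]|].
have [th bm] := box_max_exists.
have [thb thmax] := bm.
have gap t : `|th (pi t)| <= 1 / 2 by [].
have scoreE i : score (shifted th) i = score bet i - \sum_j kap i j *
    (sig (bet i - bet j + (th (pi i) - th (pi j))) - sig (bet i - bet j)).
  rewrite /score -addrA; congr (_ + _); rewrite -opprD; congr (- _).
  rewrite -big_split /=; apply: eq_bigr => j _; rewrite -mulrDr; congr (_ * _).
  rewrite /shifted.
  have -> : bet i + th (pi i) - (bet j + th (pi j)) = bet i - bet j + (th (pi i) - th (pi j)) by ring.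
  by ring.
have bnd i : - (1 / 2) <= th (pi i) <= 1 / 2 by rewrite -ler_norml.
have osc i j : th (pi i) - th (pi j) <= 8 * b * A / n%:R.
  have := @osc_le_mean_gap R _ predT (fun i => th (pi i)) (4 * b * A).
  rewrite cardT size_enum_ord => H.
  have : n%:R * (th (pi i) - th (pi j)) <= 2 * (4 * b * A).
    apply: H => // {i j} i _ ext.
    (* If the largest coordinate sits at the lower end of the box, all coordinates agree and the
       gaps vanish; otherwise it can be decreased. *)
    - have [le|lt] := leP (th (pi i)) (- (1 / 2)).
        rewrite big1 => [|j _]; last by have := bnd j; have := ext j isT; lra.
        rewrite !mulr_ge0// ?(ltW b_gt0)//.
        exact: le_trans (fibre_score i).
      have := @first_order th (pi i) (-1) (th (pi i) + 1 / 2) bm.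
      rewrite sqrrN expr1n => /(_ erefl) fo.
      have {fo} : -1 * fibre th (pi i) <= 0.
        apply: fo; first lra.
        move=> l _ t t0; have := bnd i; rewrite ler_norml => ?; apply/andP; split; lra.
      rewrite mulN1r oppr_le0 => F0.
      (* Every item of the fibre carries the extreme value, so all increments have one sign and the
         fibre sum bounds the increment of item [i] alone. *)
      have T0 l : th (pi l) = th (pi i) -> forall j, 0 <= kap l j *
        (sig (bet l - bet j + (th (pi l) - th (pi j))) - sig (bet l - bet j)).
        by move=> -> j; rewrite mulr_ge0// subr_ge0 sig_homo// subr_ge0 ext.
      have key : \sum_j kap i j *
         (sig (bet i - bet j + (th (pi i) - th (pi j))) - sig (bet i - bet j)) <= A.
        apply: (@le_trans _ _ (\sum_(l | pi l == pi i) \sum_j kap l j *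
         (sig (bet l - bet j + (th (pi l) - th (pi j))) - sig (bet l - bet j)))).
          rewrite [leRHS](bigD1 i)//= lerDl sumr_ge0// => l /andP[/eqP pl _].
          by rewrite sumr_ge0// => j _; apply: T0; rewrite pl.
        move: F0; rewrite /fibre (eq_bigr _ (fun i _ => scoreE i)) sumrB subr_ge0 => /le_trans; apply.
        by apply: (le_trans (ler_norm _)).
      apply: (@le_trans _ _ (4 * b * \sum_j kap i j *
         (sig (bet i - bet j + (th (pi i) - th (pi j))) - sig (bet i - bet j)))); last first.
        by apply: ler_wpM2l => //; rewrite mulr_ge0// ltW.
      rewrite mulr_sumr; apply: ler_sum => j _.
      have [->|ij] := eqVneq i j; first by rewrite !subrr addr0 subrr !mulr0.
      have t01 : 0 <= th (pi i) - th (pi j) <= 1.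
        by have := bnd i; have := bnd j; have := ext j isT; lra.
      have := sig_incr (bet i - bet j) _ t01 => inc.
      have k0 := kap_ge0 i j; have kw := kap_wt _ _ ij.
      have /andP[t0 _] := t01.
      have h1 := ler_wpM2r t0 kw; rewrite mul1r in h1.
      have kb : 0 <= 4 * b * kap i j by rewrite !mulr_ge0// ltW.
      have := ler_wpM2l kb inc.
      by lra.
    - have [ge|lt] := leP (1 / 2) (th (pi i)).
        rewrite big1 => [|j _]; last by have := bnd j; have := ext j isT; lra.
        rewrite !mulr_ge0// ?(ltW b_gt0)//.
        exact: le_trans (fibre_score i).
      have := @first_order th (pi i) 1 (1 / 2 - th (pi i)) bm.
      rewrite expr1n => /(_ erefl) fo.
      have {fo} : 1 * fibre th (pi i) <= 0.
        apply: fo; first lra.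
        move=> l _ t t0; have := bnd i; rewrite ler_norml => ?; apply/andP; split; lra.
      rewrite mul1r => F0.
      have T0 l : th (pi l) = th (pi i) -> forall j, kap l j *
        (sig (bet l - bet j + (th (pi l) - th (pi j))) - sig (bet l - bet j)) <= 0.
        move=> -> j; rewrite mulr_ge0_le0// subr_le0.
        have := sig_homo (bet l - bet j + (th (pi i) - th (pi j))) (th (pi j) - th (pi i)).
        have -> : bet l - bet j + (th (pi i) - th (pi j)) + (th (pi j) - th (pi i)) = bet l - bet j by ring.
        by apply; rewrite subr_ge0 ext.
      have key : - A <= \sum_j kap i j *
         (sig (bet i - bet j + (th (pi i) - th (pi j))) - sig (bet i - bet j)).
        apply: (@le_trans _ _ (\sum_(l | pi l == pi i) \sum_j kap l j *
         (sig (bet l - bet j + (th (pi l) - th (pi j))) - sig (bet l - bet j)))); last first.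
          rewrite [leLHS](bigD1 i)//= gerDl sumr_le0// => l /andP[/eqP pl _].
          by rewrite sumr_le0// => j _; apply: T0; rewrite pl.
        move: F0; rewrite /fibre (eq_bigr _ (fun i _ => scoreE i)) sumrB subr_le0; apply: le_trans.
        by have := fibre_score (pi i); rewrite ler_norml => /andP[].
      apply: (@le_trans _ _ (- (4 * b * \sum_j kap i j *
         (sig (bet i - bet j + (th (pi i) - th (pi j))) - sig (bet i - bet j))))); last first.
        have b4 : 0 <= 4 * b by rewrite mulr_ge0// ltW.
        by have := ler_wpM2l b4 key; lra.
      rewrite mulr_sumr -sumrN; apply: ler_sum => j _.
      have [->|ij] := eqVneq i j; first by rewrite !subrr addr0 subrr !mulr0 oppr0.
      have t01 : 0 <= th (pi j) - th (pi i) <= 1.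
        by have := bnd i; have := bnd j; have := ext j isT; lra.
      have := sig_decr (bet i - bet j) _ t01; rewrite opprB => inc.
      have k0 := kap_ge0 i j; have kw := kap_wt _ _ ij.
      have /andP[t0 _] := t01.
      have h1 := ler_wpM2r t0 kw; rewrite mul1r in h1.
      have kb : 0 <= 4 * b * kap i j by rewrite !mulr_ge0// ltW.
      have := ler_wpM2l kb inc.
      by lra.
  by rewrite ler_pdivlMr// mulrC; lra.
(* With value 0 at [o] and oscillation below 1/2, the shifted maximizer is interior on the image of
   [pi]: both directions are feasible and the fibre scores vanish. *)
pose th1 j := th j - th (pi o).
have th1E : shifted th1 = fun i => shifted th i + - th (pi o).
  by apply/funext => i; rewrite /shifted /th1; ring.
have in1 i : `|th1 (pi i)| < 1 / 2.
  by rewrite /th1 ltr_norml; have h1 := le_lt_trans (osc i o) A_small; have h2 := le_lt_trans (osc o i) A_small; apply/andP; split; lra.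
have bm1 : box_max th1.
  split=> [i|th' h]; first exact: ltW.
  by rewrite th1E lik_shift; exact: thmax.
exists (fun i => th1 (pi i)); split.
- by move=> i j ->.
- by rewrite /th1 subrr.
- by move=> i j; rewrite /th1 ler_norml; move: (osc i j) (osc j i); set X := 8 * b * A / _ => h1 h2; apply/andP; split; lra.
- move=> j; have [/existsP[i /eqP pij]|no] := boolP [exists i, pi i == j]; last first.
    by apply: big_pred0 => i; apply/negbTE; move: no; rewrite negb_exists => /forallP/(_ i).
  have h1 := in1 i; rewrite pij in h1.
  have fo eps : eps ^+ 2 = 1 -> `|eps| = 1 -> eps * fibre th1 j <= 0.
    move=> e1 e2; apply: (@first_order th1 j eps (1 / 2 - `|th1 j|) bm1 e1); first lra.
    move=> _ _ t /andP[t0 t1]; apply: (le_trans (ler_normD _ _)).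
    by rewrite normrM e2 mul1r (gtr0_norm t0); lra.
  have f1 := fo 1 (expr1n _ _) (normr1 _).
  have f2 : -1 * fibre th1 j <= 0 by apply: fo; rewrite ?sqrrN ?expr1n ?normrN ?normr1.
  by rewrite -/(fibre th1 j); lra.
Qed.

End MaximizerExists.

End Likelihood.

(** * Collecting the error terms of the expansion *)

Section RateArithmetic.
Context {R : realType}.
Variables (C b n y eps L W G Ee Ss E2 tau Ff : R).

(** Powers of [b] and [y] are tracked, while [C] carries all numerical factors: as $8\le C$, adding
    a few terms costs one more power of [C] ([up]). The order $b^6ny^3$ is that of $Ss\cdot Ff\cdot
    b/n$, with $Ss$ of order $bny$ and $Ff$ of order $b^4ny^2$. *)
Lemma expansion_rate_arith :
  8 <= C -> 1 <= b -> 1 <= n -> 0 <= y <= 1 -> 1 <= n * y ^+ 2 -> b ^+ 3 * y <= 1 ->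
  0 <= eps <= C ^+ 2 * b * y -> 0 <= L -> n * L = 4 * (16 * b * (2 * C ^+ 2 * eps)) ->
  0 <= W <= b * n * y ^+ 2 -> 0 <= G <= C ^+ 2 ->
  Ee = n * (C * (6 * eps ^+ 2)) + n * (C * L) + C * (C * (2 * eps)) ->
  Ss = n * y + n * (C * eps) ->
  E2 = n * (C * eps ^+ 2) + C * (C * eps) ->
  tau = 4 * b * (W + E2) / n ->
  Ff = G + E2 + C * n * (tau + 4 * (b * C * tau)) ->
  1 / 2 * (C * (n ^+ 2 * L ^+ 3 + 2 * (n * C * (2 * eps) ^+ 3)))
  + C * (Ss * Ee * (4 * b / n))
  + C * ((2 * (Ss * Ff) + Ff ^+ 2) * (4 * b / n)) + (C * Ff) ^+ 2 * (4 * b / n)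
  <= C ^+ 24 * (b ^+ 6 * (n * y ^+ 3)).
Proof.
move=> C8 b1 n1 /andP[y0 y1] m1 b3y /andP[e0 ee] L0 nL /andP[W0 Wy] /andP[G0 GC] EeE SsE E2E tauE FfE.
have C0 : 0 <= C by lra.
have b0 : 0 <= b by lra.
have n0 : 0 <= n by lra.
have np : 0 < n by lra.
have nn : n != 0 by rewrite gt_eqF.
set m := n * y ^+ 2 in m1 *.
have m0 : 0 <= m by lra.
have ym : y <= m by lra.
have up k (M : R) : 0 <= M -> 8 * (C ^+ k * M) <= C ^+ k.+1 * M.
  by move=> M0; rewrite exprS -mulrA; apply: ler_wpM2r => //; rewrite mulr_ge0// exprn_ge0.
have ups k l (M : R) : 0 <= M -> (k <= l)%N -> C ^+ k * M <= C ^+ l * M.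
  by move=> M0 kl; apply: ler_wpM2r => //; apply: ler_weXn2l => //; lra.
have pos k (M : R) : 0 <= M -> 0 <= C ^+ k * M by move=> M0; rewrite mulr_ge0// exprn_ge0.
have bX k : 1 <= b ^+ k by exact: exprn_ege1.
have bXle k l : (k <= l)%N -> b ^+ k <= b ^+ l by move=> kl; apply: ler_weXn2l => //; lra.
set Z := b ^+ 6 * (n * y ^+ 3).
have y3 : 0 <= n * y ^+ 3 by rewrite mulr_ge0// exprn_ge0.
have Z0 : 0 <= Z by rewrite /Z mulr_ge0// exprn_ge0.
have e2 : eps ^+ 2 <= C ^+ 4 * (b ^+ 2 * y ^+ 2).
  have -> : C ^+ 4 * (b ^+ 2 * y ^+ 2) = (C ^+ 2 * b * y) ^+ 2 by ring.
  by apply: lerXn2r; rewrite ?nnegrE// mulr_ge0// mulr_ge0// sqr_ge0.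
have e3 : eps ^+ 3 <= C ^+ 6 * (b ^+ 3 * y ^+ 3).
  have -> : C ^+ 6 * (b ^+ 3 * y ^+ 3) = (C ^+ 2 * b * y) ^+ 3 by ring.
  by apply: lerXn2r; rewrite ?nnegrE// mulr_ge0// mulr_ge0// sqr_ge0.
have by0 : 0 <= b * y by rewrite mulr_ge0.
have b2m : 0 <= b ^+ 2 * m by rewrite mulr_ge0// sqr_ge0.
have bym : b * y <= b ^+ 2 * m.
  by apply: ler_pM => //; have := bXle 1%N 2%N isT; rewrite expr1.
have b2ym : b ^+ 2 * y <= b ^+ 2 * m by apply: ler_wpM2l => //; exact: sqr_ge0.
have ee' : eps <= C ^+ 2 * (b * y) by rewrite mulrA.
have nL_le : n * L <= C ^+ 7 * (b ^+ 2 * y).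
  rewrite nL.
  have h1 : 16 * b * (2 * C ^+ 2 * eps) <= 32 * (C ^+ 4 * (b ^+ 2 * y)).
    have -> : 32 * (C ^+ 4 * (b ^+ 2 * y)) = 16 * b * (2 * C ^+ 2 * (C ^+ 2 * (b * y))) by ring.
    by apply: ler_wpM2l; rewrite ?mulr_ge0//; apply: ler_wpM2l; rewrite ?mulr_ge0 ?sqr_ge0.
  have b2y0 : 0 <= b ^+ 2 * y by rewrite mulr_ge0// sqr_ge0.
  have := pos 4%N _ b2y0; have := up 4%N _ b2y0; have := up 5%N _ b2y0; have := up 6%N _ b2y0; lra.
have L_le : L <= C ^+ 7 * (b ^+ 2 * y) by apply: le_trans nL_le; nra.
have T1 : n ^+ 2 * L ^+ 3 <= C ^+ 21 * Z.
  have -> : n ^+ 2 * L ^+ 3 = (n * L) * (n * L) * L by ring.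
  have P0 : 0 <= C ^+ 7 * (b ^+ 2 * y) by apply: pos; rewrite mulr_ge0// sqr_ge0.
  have nL0 : 0 <= n * L by rewrite mulr_ge0.
  apply: (@le_trans _ _ (C ^+ 7 * (b ^+ 2 * y) * (C ^+ 7 * (b ^+ 2 * y)) * (C ^+ 7 * (b ^+ 2 * y)))).
    by apply: ler_pM => //; [exact: mulr_ge0|exact: ler_pM].
  have -> : C ^+ 7 * (b ^+ 2 * y) * (C ^+ 7 * (b ^+ 2 * y)) * (C ^+ 7 * (b ^+ 2 * y)) =
    C ^+ 21 * (b ^+ 6 * y ^+ 3) by ring.
  apply: ler_wpM2l; first exact: exprn_ge0.
  apply: ler_wpM2l; first exact: exprn_ge0.
  by apply: ler_peMl => //; exact: exprn_ge0.
have T2 : n * C * (2 * eps) ^+ 3 <= C ^+ 8 * Z.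
  have h1 : n * C * (2 * eps) ^+ 3 <= 8 * (C ^+ 7 * (b ^+ 3 * (n * y ^+ 3))).
    have -> : n * C * (2 * eps) ^+ 3 = 8 * (n * C * eps ^+ 3) by ring.
    apply: ler_wpM2l => //.
    have -> : C ^+ 7 * (b ^+ 3 * (n * y ^+ 3)) = n * C * (C ^+ 6 * (b ^+ 3 * y ^+ 3)) by ring.
    by apply: ler_wpM2l => //; rewrite mulr_ge0.
  apply: (le_trans h1).
  have h2 : 0 <= b ^+ 3 * (n * y ^+ 3) by rewrite mulr_ge0// exprn_ge0.
  apply: (le_trans (up _ _ h2)); apply: ler_wpM2l; first exact: exprn_ge0.
  by apply: ler_wpM2r => //; exact: bXle.
have ny0 : 0 <= n * y by rewrite mulr_ge0.
have Ss0 : 0 <= Ss by rewrite SsE addr_ge0// !mulr_ge0.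
have Ss_le : Ss <= C ^+ 4 * (b * (n * y)).
  have bny : 0 <= b * (n * y) by rewrite mulr_ge0.
  have h1 : n * (C * eps) <= C ^+ 3 * (b * (n * y)).
    have -> : C ^+ 3 * (b * (n * y)) = n * (C * (C ^+ 2 * (b * y))) by ring.
    by do 2 apply: ler_wpM2l => //.
  have h2 : n * y <= C ^+ 3 * (b * (n * y)).
    apply: (@le_trans _ _ (b * (n * y))); first by apply: ler_peMl.
    by apply: ler_peMl => //; apply: exprn_ege1; lra.
  have := up 3%N _ bny; rewrite SsE; lra.
have nCe2 : n * (C * eps ^+ 2) <= C ^+ 5 * (b ^+ 2 * m).
  have -> : C ^+ 5 * (b ^+ 2 * m) = n * (C * (C ^+ 4 * (b ^+ 2 * y ^+ 2))) by rewrite /m; ring.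
  by do 2 apply: ler_wpM2l => //.
have CCe : C * (C * eps) <= C ^+ 4 * (b ^+ 2 * m).
  apply: (@le_trans _ _ (C * (C * (C ^+ 2 * (b ^+ 2 * m))))); last by rewrite le_eqVlt; apply/orP; left; apply/eqP; ring.
  do 2 apply: ler_wpM2l => //; apply: (le_trans ee'); apply: ler_wpM2l => //; exact: sqr_ge0.
have Ee0 : 0 <= Ee by rewrite EeE !addr_ge0// !mulr_ge0 ?sqr_ge0.
have Ee_le : Ee <= C ^+ 9 * (b ^+ 2 * m).
  have h1 : n * (C * L) <= C ^+ 8 * (b ^+ 2 * m).
    have -> : n * (C * L) = C * (n * L) by ring.
    rewrite exprS -mulrA; apply: ler_wpM2l => //; apply: (le_trans nL_le).
    by apply: ler_wpM2l => //; exact: exprn_ge0.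
  have := up 8%N _ b2m; have := ups 5%N 8%N _ b2m isT; have := up 5%N _ b2m.
  have := ups 6%N 8%N _ b2m isT; have := up 4%N _ b2m.
  have -> : Ee = 6 * (n * (C * eps ^+ 2)) + n * (C * L) + 2 * (C * (C * eps)) by rewrite EeE; ring.
  have := pos 8%N _ b2m.
  lra.
have E20 : 0 <= E2 by rewrite E2E !addr_ge0// !mulr_ge0 ?sqr_ge0.
have E2_le : E2 <= C ^+ 6 * (b ^+ 2 * m).
  have := up 5%N _ b2m; have := up 4%N _ b2m; have := pos 4%N _ b2m; rewrite E2E; lra.
have b3m : 0 <= b ^+ 3 * m by rewrite mulr_ge0// exprn_ge0.
have b4m : 0 <= b ^+ 4 * m by rewrite mulr_ge0// exprn_ge0.
have ntau : n * tau <= C ^+ 7 * (b ^+ 3 * m).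
  have -> : n * tau = 4 * (b * W + b * E2) by rewrite tauE; field.
  have h1 : b * W <= C ^+ 6 * (b ^+ 3 * m).
    apply: (@le_trans _ _ (b * (b * m))); first by apply: ler_wpM2l => //; rewrite mulrA.
    apply: (@le_trans _ _ (b ^+ 3 * m)).
      by rewrite mulrA -expr2; apply: ler_wpM2r => //; exact: bXle.
    by apply: ler_peMl => //; apply: exprn_ege1; lra.
  have h2 : b * E2 <= C ^+ 6 * (b ^+ 3 * m).
    have -> : C ^+ 6 * (b ^+ 3 * m) = b * (C ^+ 6 * (b ^+ 2 * m)) by ring.
    exact: ler_wpM2l.
  have := up 6%N _ b3m; lra.
have tau0 : 0 <= tau by rewrite tauE divr_ge0// mulr_ge0 ?addr_ge0// mulr_ge0.
have ntau0 : 0 <= n * tau by rewrite mulr_ge0.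
have Ff0 : 0 <= Ff.
  rewrite FfE; apply: addr_ge0; first exact: addr_ge0.
  by apply: mulr_ge0; [exact: mulr_ge0|apply: addr_ge0 => //; rewrite !mulr_ge0].
have Ff_le : Ff <= C ^+ 10 * (b ^+ 4 * m).
  have -> : Ff = G + E2 + C * (n * tau) + 4 * (C ^+ 2 * (b * (n * tau))) by rewrite FfE; ring.
  have h1 : G <= C ^+ 2 * (b ^+ 4 * m).
    apply: (le_trans GC); apply: ler_peMr; first exact: sqr_ge0.
    by rewrite -[1]mulr1; apply: ler_pM.
  have h2 : E2 <= C ^+ 6 * (b ^+ 4 * m).
    apply: (le_trans E2_le); apply: ler_wpM2l; first exact: exprn_ge0.
    by apply: ler_wpM2r => //; exact: bXle.
  have h3 : C * (n * tau) <= C ^+ 8 * (b ^+ 4 * m).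
    rewrite exprS -mulrA; apply: ler_wpM2l => //; apply: (le_trans ntau).
    apply: ler_wpM2l; first exact: exprn_ge0.
    by apply: ler_wpM2r => //; exact: bXle.
  have h4 : C ^+ 2 * (b * (n * tau)) <= C ^+ 9 * (b ^+ 4 * m).
    have -> : C ^+ 9 * (b ^+ 4 * m) = C ^+ 2 * (b * (C ^+ 7 * (b ^+ 3 * m))) by ring.
    by apply: ler_wpM2l; [exact: sqr_ge0|exact: ler_wpM2l].
  have := ups 2%N 8%N _ b4m isT; have := ups 6%N 8%N _ b4m isT.
  have := up 8%N _ b4m; have := up 9%N _ b4m; have := pos 8%N _ b4m; lra.
have bn0 : 0 <= 4 * b / n by rewrite divr_ge0// mulr_ge0.
have ymE : y * m = n * y ^+ 3 by rewrite /m; ring.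
have T3 : Ss * Ee * (4 * b / n) <= C ^+ 14 * Z.
  apply: (@le_trans _ _ (C ^+ 4 * (b * (n * y)) * (C ^+ 9 * (b ^+ 2 * m)) * (4 * b / n))).
    by apply: ler_wpM2r => //; exact: ler_pM.
  have -> : C ^+ 4 * (b * (n * y)) * (C ^+ 9 * (b ^+ 2 * m)) * (4 * b / n) =
    4 * (C ^+ 13 * (b ^+ 4 * (y * m))) by field.
  rewrite ymE.
  have h1 : b ^+ 4 * (n * y ^+ 3) <= Z by apply: ler_wpM2r => //; exact: bXle.
  have h2 := ler_wpM2l (exprn_ge0 13 C0) h1.
  have := up 13%N _ Z0; have := pos 13%N _ Z0; lra.
have T4 : Ss * Ff * (4 * b / n) <= C ^+ 15 * Z.
  apply: (@le_trans _ _ (C ^+ 4 * (b * (n * y)) * (C ^+ 10 * (b ^+ 4 * m)) * (4 * b / n))).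
    by apply: ler_wpM2r => //; exact: ler_pM.
  have -> : C ^+ 4 * (b * (n * y)) * (C ^+ 10 * (b ^+ 4 * m)) * (4 * b / n) =
    4 * (C ^+ 14 * (b ^+ 6 * (y * m))) by field.
  rewrite ymE -/Z.
  have := up 14%N _ Z0; have := pos 14%N _ Z0; lra.
(* Here the order is $b^9ny^4$; the smallness of $b^3y$ brings it back to the common one. *)
have T5 : Ff ^+ 2 * (4 * b / n) <= C ^+ 21 * Z.
  apply: (@le_trans _ _ ((C ^+ 10 * (b ^+ 4 * m)) ^+ 2 * (4 * b / n))).
    apply: ler_wpM2r => //; apply: lerXn2r; rewrite ?nnegrE//; exact: pos.
  have -> : (C ^+ 10 * (b ^+ 4 * m)) ^+ 2 * (4 * b / n) = 4 * (C ^+ 20 * ((b ^+ 3 * y) * Z)).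
    by rewrite /Z /m; field.
  have h1 : b ^+ 3 * y * Z <= Z by apply: ler_piMl.
  have h2 := ler_wpM2l (exprn_ge0 20 C0) h1.
  have := up 20%N _ Z0; have := pos 20%N _ Z0; lra.
have K1 : 1 / 2 * (C * (n ^+ 2 * L ^+ 3 + 2 * (n * C * (2 * eps) ^+ 3))) <= C ^+ 22 * Z + C ^+ 9 * Z.
  have h1 := ler_wpM2l C0 T1; have h2 := ler_wpM2l C0 T2.
  rewrite [C * (C ^+ 21 * _)]mulrA -exprS in h1; rewrite [C * (C ^+ 8 * _)]mulrA -exprS in h2.
  have := pos 22%N _ Z0; lra.
have K2 : C * (Ss * Ee * (4 * b / n)) <= C ^+ 15 * Z.
  by have := ler_wpM2l C0 T3; rewrite [C * (C ^+ 14 * _)]mulrA -exprS.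
have K3 : C * ((2 * (Ss * Ff) + Ff ^+ 2) * (4 * b / n)) <= 2 * (C ^+ 16 * Z) + C ^+ 22 * Z.
  have h1 := ler_wpM2l C0 T4; have h2 := ler_wpM2l C0 T5.
  rewrite [C * (C ^+ 15 * _)]mulrA -exprS in h1; rewrite [C * (C ^+ 21 * _)]mulrA -exprS in h2.
  have -> : C * ((2 * (Ss * Ff) + Ff ^+ 2) * (4 * b / n)) =
    2 * (C * (Ss * Ff * (4 * b / n))) + C * (Ff ^+ 2 * (4 * b / n)) by ring.
  lra.
have K4 : (C * Ff) ^+ 2 * (4 * b / n) <= C ^+ 23 * Z.
  have -> : (C * Ff) ^+ 2 * (4 * b / n) = C ^+ 2 * (Ff ^+ 2 * (4 * b / n)) by ring.
  have -> : C ^+ 23 * Z = C ^+ 2 * (C ^+ 21 * Z) by ring.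
  by apply: ler_wpM2l => //; exact: sqr_ge0.
have := ups 9%N 22%N _ Z0 isT; have := ups 15%N 22%N _ Z0 isT; have := ups 16%N 22%N _ Z0 isT.
have := up 22%N _ Z0; have := up 23%N _ Z0; have := pos 22%N _ Z0; lra.
Qed.

End RateArithmetic.

(** * Deterministic expansion of the likelihood ratio *)

Section Expansion.
Context {R : realType} {n : nat}.
Variables (kap : 'I_n -> 'I_n -> R) (e : 'I_n -> R) (C : R).
Hypothesis kap_sym : forall i j, kap i j = kap j i.
Hypothesis kap_ge0 : forall i j, 0 <= kap i j.
Hypothesis kap_le : forall i j, kap i j <= C.
Variables (bet : 'I_n -> R) (B : pred 'I_n) (b : R) (o : 'I_n).
Hypothesis b_ge1 : 1 <= b.
Hypothesis kap_wt : forall i j, i != j -> 1 <= b * (kap i j * wt (bet i - bet j)).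
Hypothesis C_ge1 : 1 <= C.
Hypothesis card_B : #|B|%:R <= C.
Hypothesis card_nB : n%:R <= 2 * #|predC B|%:R :> R.
Hypothesis n_ge4 : 4 <= n%:R :> R.
Hypothesis o_nB : ~~ B o.

(** For distinct items, the variance of the number of wins of [i] over [j], which is minus the
    off-diagonal entry of the Fisher information. For [i] in the block, [vdeg i] is the variance of
    its score against the items outside. *)
Definition vmat i j : R := kap i j * wt (bet i - bet j).
Definition vdeg i : R := \sum_(j | ~~ B j) vmat i j.

Let b_ge0 : 0 <= b. Proof. exact: le_trans ler01 b_ge1. Qed.
Let b_gt0 : 0 < b. Proof. exact: lt_le_trans ltr01 b_ge1. Qed.
Let n_gt0 : 0 < n%:R :> R. Proof. by apply: lt_le_trans n_ge4. Qed.
Let C_ge0 : 0 <= C. Proof. exact: le_trans ler01 C_ge1. Qed.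

Lemma vmat_ge0 i j : 0 <= vmat i j.
Proof. by rewrite mulr_ge0// ltW// wt_gt0. Qed.

Lemma vmat_le i j : vmat i j <= C.
Proof.
rewrite -[C]mulr1; apply: ler_pM => //; first by rewrite ltW// wt_gt0.
by have := wt_le (bet i - bet j); lra.
Qed.

(** At least half of the items lie outside the block. Without [i] itself at least $n/4$ remain, as
    $n\ge 4$, and each contributes at least $1/b$. *)
Lemma vdeg_ge i : n%:R <= 4 * b * vdeg i.
Proof.
have h : #|predC B|%:R - 1 <= b * vdeg i.
  apply: (@le_trans _ _ (\sum_(j | ~~ B j) (1 - (j == i)%:R))).
    rewrite sumrB sumr_const -mulr_natl mulr1 lerD2l lerN2.
    apply: (@le_trans _ _ (\sum_j (j == i)%:R)).
      by rewrite [leRHS](bigID B)/= lerDr sumr_ge0.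
    by rewrite (bigD1 i)//= eqxx big1 ?addr0// => j /negbTE ->.
  rewrite mulr_sumr; apply: ler_sum => j _.
  have [->|ji] := eqVneq j i; first by rewrite subrr mulr_ge0 ?vmat_ge0// ltW.
  by rewrite subr0 kap_wt// eq_sym.
have -> : 4 * b * vdeg i = 4 * (b * vdeg i) by ring.
have := card_nB; have := n_ge4; lra.
Qed.

Lemma vdeg_gt0 i : 0 < vdeg i.
Proof.
have h := vdeg_ge i; have : 0 < 4 * b * vdeg i by exact: lt_le_trans n_gt0 h.
by rewrite pmulr_rgt0// mulr_gt0.
Qed.

Lemma vdegV_le i : (vdeg i)^-1 <= 4 * b / n%:R.
Proof.
by rewrite ler_pdivlMr// mulrC ler_pdivrMr ?vdeg_gt0// vdeg_ge.
Qed.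

Lemma norm_vdegV i : `|(vdeg i)^-1| = (vdeg i)^-1.
Proof. by rewrite ger0_norm// invr_ge0 ltW// vdeg_gt0. Qed.

Lemma card_le (P : pred 'I_n) : #|P|%:R <= n%:R :> R.
Proof. by rewrite ler_nat (leq_trans (max_card _))// card_ord. Qed.

Lemma vdeg_le i : vdeg i <= C * n%:R.
Proof.
apply: (le_trans (sum_le_card _ _ _ _ (fun j _ => vmat_le i j))).
by rewrite mulrC; apply: ler_wpM2l => //; exact: card_le.
Qed.

Variables (del0 del1 : 'I_n -> R) (eps : R).
Hypothesis eps_ge0 : 0 <= eps.
Hypothesis eps_le : 2 * eps <= 1.
Hypothesis osc0 : forall i j, `|del0 i - del0 j| <= eps.
Hypothesis osc1 : forall i j, `|del1 i - del1 j| <= eps.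
Hypothesis del0o : del0 o = 0.
Hypothesis del1o : del1 o = 0.

Let g0 i := bet i + del0 i.
Let g1 i := bet i + del1 i.
Let s i := score kap e g0 i.
Let dt i := score kap e bet i.
Let eta i := del1 i - del0 i.

Hypothesis s_nB : forall i, ~~ B i -> s i = 0.
Hypothesis s_sum0 : \sum_(i | B i) s i = 0.
Hypothesis score1 : forall i, score kap e g1 i = 0.

Let eta_le i j : `|eta i - eta j| <= 2 * eps.
Proof.
have -> : eta i - eta j = (del1 i - del1 j) - (del0 i - del0 j) by rewrite /eta; ring.
apply: (le_trans (ler_normB _ _)); have := osc0 i j; have := osc1 i j; lra.
Qed.

Let scoreB (g h : 'I_n -> R) i : score kap e g i - score kap e h i =
  \sum_j kap i j * (sig (h i - h j) - sig (g i - g j)).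
Proof.
have -> : score kap e g i - score kap e h i =
  \sum_j kap i j * (sig (h i - h j) - 1 / 2) - \sum_j kap i j * (sig (g i - g j) - 1 / 2).
  by rewrite /score; ring.
by rewrite -sumrB; apply: eq_bigr => j _; ring.
Qed.

Let sE i : s i = \sum_j kap i j * (sig (g0 i - g0 j + (eta i - eta j)) - sig (g0 i - g0 j)).
Proof.
transitivity (score kap e g0 i - score kap e g1 i); first by rewrite score1 subr0.
rewrite scoreB; apply: eq_bigr => j _; congr (_ * (sig _ - _)).
by rewrite /g0 /g1 /eta; ring.
Qed.

Let wt_g0 i j : wt (bet i - bet j) <= 4 * wt (g0 i - g0 j).
Proof.
have -> : g0 i - g0 j = bet i - bet j + (del0 i - del0 j) by rewrite /g0; ring.
have := @wt_ge_shift R (bet i - bet j) (del0 i - del0 j).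
have e1 := eps_le; have h1 := osc0 i j.
have h0 : `|del0 i - del0 j| <= 1 by have := eps_ge0; lra.
by move=> /(_ h0); lra.
Qed.

(** Outside the block both scores vanish, so at an extreme item the one-signed increments over outer
    items are balanced by at most [C] block terms, each at most [C * (2 * eps)]. The factor 16 is 4
    from [sig_incr] times 4 from [wt_g0]. *)
Lemma eta_osc i j : ~~ B i -> ~~ B j ->
  n%:R * (eta i - eta j) <= 4 * (16 * b * (2 * C ^+ 2 * eps)).
Proof.
move=> nBi nBj.
have termB l : `|\sum_(j | B j) kap l j *
    (sig (g0 l - g0 j + (eta l - eta j)) - sig (g0 l - g0 j))| <= 2 * C ^+ 2 * eps.
  have -> : 2 * C ^+ 2 * eps = C * (C * (2 * eps)) by ring.
  apply: norm_sum_le_card => //; last by rewrite mulr_ge0// mulr_ge0.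
  move=> p _; rewrite normrM (ger0_norm (kap_ge0 _ _)); apply: ler_pM => //.
  by apply: (le_trans (sig_lipschitz _ _)).
have C2 : 0 <= 2 * C ^+ 2 * eps by rewrite mulr_ge0// mulr_ge0 ?sqr_ge0.
(* The positive part permits replacing $n$ by twice the number of outer items whatever the sign of
   the difference. *)
have nn : n%:R * (eta i - eta j) <= 2 * (#|[pred j | ~~ B j]|%:R * Num.max 0 (eta i - eta j)).
  apply: (@le_trans _ _ (n%:R * Num.max 0 (eta i - eta j))).
    by apply: ler_wpM2l => //; rewrite le_max lexx orbT.
  by rewrite mulrA; apply: ler_wpM2r => //; rewrite le_max lexx.
apply: (le_trans nn); rewrite -[4]/(2 * 2)%:R natrM -mulrA; apply: ler_wpM2l => //.
rewrite maxr_pMr// mulr0 ge_max; apply/andP; split.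
  by rewrite !mulr_ge0// ltW.
have split0 l : ~~ B l -> \sum_(j | ~~ B j) kap l j *
    (sig (g0 l - g0 j + (eta l - eta j)) - sig (g0 l - g0 j)) =
  - \sum_(j | B j) kap l j * (sig (g0 l - g0 j + (eta l - eta j)) - sig (g0 l - g0 j)).
  by move=> nBl; have := sE l; rewrite s_nB// (bigID B) /= => h; lra.
have b16 : 0 <= 16 * b by rewrite mulr_ge0// ltW.
apply: (@osc_le_mean_gap R _ [pred j | ~~ B j] eta) => // l nBl ext.
- apply: (@le_trans _ _ (16 * b * \sum_(j | ~~ B j) kap l j *
    (sig (g0 l - g0 j + (eta l - eta j)) - sig (g0 l - g0 j)))); last first.
    rewrite split0//; apply: ler_wpM2l => //.
    by apply: (le_trans (ler_norm _)); rewrite normrN.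
  rewrite mulr_sumr; apply: ler_sum => p nBp.
  have [->|lp] := eqVneq l p; first by rewrite !subrr addr0 subrr !mulr0.
  have t01 : 0 <= eta l - eta p <= 1.
    by rewrite subr_ge0 ext//= (le_trans (ler_norm _))// (le_trans (eta_le _ _)).
  have inc := sig_incr (g0 l - g0 p) _ t01.
  have /andP[t0 _] := t01.
  have kw := kap_wt _ _ lp.
  have h1 := ler_wpM2r t0 kw; rewrite mul1r in h1.
  have h2 : b * (kap l p * wt (bet l - bet p)) * (eta l - eta p) <=
    b * (kap l p * (4 * wt (g0 l - g0 p))) * (eta l - eta p).
    apply: ler_wpM2r => //; apply: ler_wpM2l; first exact: ltW.
    by apply: ler_wpM2l => //; exact: wt_g0.
  have kb : 0 <= 16 * b * kap l p by rewrite mulr_ge0.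
  by have := ler_wpM2l kb inc; lra.
- apply: (@le_trans _ _ (- (16 * b * \sum_(j | ~~ B j) kap l j *
    (sig (g0 l - g0 j + (eta l - eta j)) - sig (g0 l - g0 j))))); last first.
    rewrite split0// mulrN opprK; apply: ler_wpM2l => //.
    by apply: (le_trans (ler_norm _)).
  rewrite mulr_sumr -sumrN; apply: ler_sum => p nBp.
  have [->|lp] := eqVneq l p; first by rewrite !subrr addr0 subrr !mulr0 oppr0.
  have t01 : 0 <= eta p - eta l <= 1.
    by rewrite subr_ge0 ext//= (le_trans (ler_norm _))// (le_trans (eta_le _ _)).
  have inc := sig_decr (g0 l - g0 p) _ t01; rewrite [- (eta p - eta l)]opprB in inc.
  have /andP[t0 _] := t01.
  have kw := kap_wt _ _ lp.
  have h1 := ler_wpM2r t0 kw; rewrite mul1r in h1.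
  have h2 : b * (kap l p * wt (bet l - bet p)) * (eta p - eta l) <=
    b * (kap l p * (4 * wt (g0 l - g0 p))) * (eta p - eta l).
    apply: ler_wpM2r => //; apply: ler_wpM2l; first exact: ltW.
    by apply: ler_wpM2l => //; exact: wt_g0.
  have kb : 0 <= 16 * b * kap l p by rewrite mulr_ge0.
  by have := ler_wpM2l kb inc; lra.
Qed.

Variable L : R.
Hypothesis L_def : n%:R * L = 4 * (16 * b * (2 * C ^+ 2 * eps)).

Let eta_nB i j : ~~ B i -> ~~ B j -> `|eta i - eta j| <= L.
Proof.
move=> nBi nBj; rewrite ler_norml.
have h1 := eta_osc _ _ nBi nBj; have h2 := eta_osc _ _ nBj nBi.
rewrite -L_def ler_pM2l// in h1; rewrite -L_def ler_pM2l// in h2.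
by apply/andP; split; lra.
Qed.

Let L_ge0 : 0 <= L.
Proof. exact: le_trans (eta_nB _ _ o_nB o_nB). Qed.

Let etao : eta o = 0. Proof. by rewrite /eta del0o del1o subrr. Qed.

Let eta_nB0 i : ~~ B i -> `|eta i| <= L.
Proof. by move=> h; have := eta_nB _ _ h o_nB; rewrite etao subr0. Qed.


(** The first-order sum shrinks to the block, the only place where a score at either maximizer is
    nonzero. In the cubic remainder only the $O(n)$ pairs meeting the block can differ by [2 * eps];
    all others differ by at most [L]. *)
Lemma lr_score_approx :
  `|2 * (lik kap e g1 - lik kap e g0) - \sum_(i | B i) s i * eta i|
  <= 1 / 2 * (C * (n%:R ^+ 2 * L ^+ 3 + 2 * (n%:R * C * (2 * eps) ^+ 3))).
Proof.
have := lik_trapezoid kap e kap_sym kap_ge0 g0 g1.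
have -> : \sum_i (score kap e g0 i + score kap e g1 i) * (g1 i - g0 i) = \sum_(i | B i) s i * eta i.
  rewrite [RHS]big_mkcond; apply: eq_bigr => i _; rewrite score1 addr0.
  have -> : g1 i - g0 i = eta i by rewrite /g1 /g0 /eta; ring.
  by rewrite -/(s i); case: ifP => // /negbT nBi; rewrite s_nB// mul0r.
move=> h; apply: (le_trans h); apply: ler_wpM2l => //.
have e3 : 0 <= (2 * eps) ^+ 3 by rewrite exprn_ge0// mulr_ge0.
have L3 : 0 <= L ^+ 3 by rewrite exprn_ge0.
apply: (@le_trans _ _ (\sum_i \sum_j C * (L ^+ 3 + ((B i)%:R + (B j)%:R) * (2 * eps) ^+ 3))).
  apply: ler_sum => i _; apply: ler_sum => j _; apply: ler_pM; rewrite ?exprn_ge0 ?kap_ge0 ?kap_le//.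
  have -> : g1 i - g0 i - (g1 j - g0 j) = eta i - eta j by rewrite /g1 /g0 /eta; ring.
  have big : `|eta i - eta j| ^+ 3 <= (2 * eps) ^+ 3.
    by apply: lerXn2r; rewrite ?nnegrE ?mulr_ge0.
  have [Bi|nBi] := boolP (B i); have [Bj|nBj] := boolP (B j); rewrite /= ?addr0 ?add0r ?mul1r ?mul0r ?addr0; [lra|lra|lra|].
  by apply: lerXn2r; rewrite ?nnegrE//; exact: eta_nB.
have -> : \sum_i \sum_j C * (L ^+ 3 + ((B i)%:R + (B j)%:R) * (2 * eps) ^+ 3) =
   C * (n%:R ^+ 2 * L ^+ 3 + 2 * (n%:R * #|B|%:R * (2 * eps) ^+ 3)).
  have cst (c : R) : \sum_(j < n) c = n%:R * c by rewrite sumr_const card_ord mulr_natl.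
  have sB : \sum_i (B i)%:R = #|B|%:R :> R.
    by rewrite -sum1_card natr_sum [RHS]big_mkcond; apply: eq_bigr => i _; rewrite unfold_in; case: (B i).
  have -> : \sum_i \sum_j C * (L ^+ 3 + ((B i)%:R + (B j)%:R) * (2 * eps) ^+ 3) =
     \sum_(i < n) (n%:R * (C * L ^+ 3 + C * (B i)%:R * (2 * eps) ^+ 3) + C * #|B|%:R * (2 * eps) ^+ 3).
    apply: eq_bigr => i _; rewrite -sB mulr_sumr mulr_suml.
    by rewrite -cst -big_split /=; apply: eq_bigr => j _; ring.
  rewrite big_split /= cst -mulr_sumr big_split /= cst.
  by rewrite -mulr_suml -mulr_sumr sB; ring.
apply: ler_wpM2l => //; rewrite lerD2l; apply: ler_wpM2l => //; apply: ler_wpM2r => //.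
exact: ler_wpM2l.
Qed.

Let Ee := n%:R * (C * (6 * eps ^+ 2)) + n%:R * (C * L) + C * (C * (2 * eps)).

(** The score at the null maximizer is the increment towards the full one. In its linear part only
    the displacement of [i] matters: outer displacements are at most [L], and block items are
    boundedly many. *)
Lemma score_eta i : B i -> `|s i - vdeg i * eta i| <= Ee.
Proof.
move=> Bi.
have -> : s i - vdeg i * eta i =
  \sum_(j | ~~ B j) (kap i j * (sig (g0 i - g0 j + (eta i - eta j)) - sig (g0 i - g0 j)
      - wt (bet i - bet j) * (eta i - eta j)))
  + \sum_(j | ~~ B j) (- (vmat i j * eta j))
  + \sum_(j | B j) kap i j * (sig (g0 i - g0 j + (eta i - eta j)) - sig (g0 i - g0 j)).
  rewrite sE (bigID B) /= [X in X - _]addrC -[in RHS]big_split /= addrAC; congr (_ + _).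
  rewrite /vdeg mulr_suml -sumrB; apply: eq_bigr => j _; rewrite /vmat; ring.
apply: (le_trans (ler_normD _ _)); apply: lerD.
  apply: (le_trans (ler_normD _ _)); apply: lerD.
    apply: norm_sum_le_card => [j _||]; last exact: card_le.
    - rewrite normrM (ger0_norm (kap_ge0 _ _)); apply: ler_pM => //.
      set t := eta i - eta j; set x := g0 i - g0 j.
      have -> : sig (x + t) - sig x - wt (bet i - bet j) * t =
         (sig (x + t) - sig x - wt x * t) + (wt x - wt (bet i - bet j)) * t by ring.
      apply: (le_trans (ler_normD _ _)).
      have h1 := sig_taylor1 x t.
      have h2 : `|wt x - wt (bet i - bet j)| <= eps.
        have -> : x = bet i - bet j + (del0 i - del0 j) by rewrite /x /g0; ring.
        exact: le_trans (wt_lipschitz _ _) (osc0 _ _).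
      have h3 : `|t| <= 2 * eps by exact: eta_le.
      have h4 : t ^+ 2 <= (2 * eps) ^+ 2.
        rewrite -(ger0_norm (sqr_ge0 t)) normrX; apply: lerXn2r; rewrite ?nnegrE//.
        exact: le_trans h3.
      have h5 : `|(wt x - wt (bet i - bet j)) * t| <= eps * (2 * eps).
        by rewrite normrM; apply: ler_pM.
      have -> : 6 * eps ^+ 2 = (2 * eps) ^+ 2 + eps * (2 * eps) by ring.
      lra.
    - by rewrite mulr_ge0// mulr_ge0// sqr_ge0.
  apply: norm_sum_le_card => [j nBj||]; last exact: card_le.
  - by rewrite normrN normrM (ger0_norm (vmat_ge0 _ _)); apply: ler_pM; rewrite ?vmat_ge0 ?vmat_le ?eta_nB0.
  - by rewrite mulr_ge0.
apply: norm_sum_le_card => [j _||] //.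
- rewrite normrM (ger0_norm (kap_ge0 _ _)); apply: ler_pM => //.
  by apply: (le_trans (sig_lipschitz _ _)).
- by rewrite mulr_ge0// mulr_ge0.
Qed.

Variable y : R.
Hypothesis y_ge0 : 0 <= y.
Hypothesis dt_le : forall i, `|dt i| <= n%:R * y.

Let Ss := n%:R * y + n%:R * (C * eps).

Let dtB i : dt i - s i = \sum_j kap i j *
  (sig (bet i - bet j + (del0 i - del0 j)) - sig (bet i - bet j)).
Proof.
rewrite /dt /s scoreB; apply: eq_bigr => j _; congr (_ * (sig _ - _)).
by rewrite /g0; ring.
Qed.

Lemma score0_le i : `|s i| <= Ss.
Proof.
have -> : s i = dt i - (dt i - s i) by ring.
apply: (le_trans (ler_normB _ _)); apply: lerD => //.
rewrite dtB; apply: norm_sum_le_card => [j _||]; last exact: card_le.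
- rewrite normrM (ger0_norm (kap_ge0 _ _)); apply: ler_pM => //.
  exact: le_trans (sig_lipschitz _ _) (osc0 _ _).
- by rewrite mulr_ge0.
Qed.

Let E2 := n%:R * (C * eps ^+ 2) + C * (C * eps).
(* For [i] in the block, [dt i - s i] is nearly [vdeg i * (del0 i - wavg i)], and [wavg] is nearly
   constant: that constant is what the second term of [block_quad] projects out. *)
Let wavg i := (\sum_(j | ~~ B j) vmat i j * del0 j) / vdeg i.

Lemma score0_linear i : `|dt i - s i - vdeg i * (del0 i - wavg i)| <= E2.
Proof.
have vn : vdeg i != 0 by rewrite gt_eqF// vdeg_gt0.
have -> : dt i - s i - vdeg i * (del0 i - wavg i) =
  \sum_(j | ~~ B j) kap i j * (sig (bet i - bet j + (del0 i - del0 j)) - sig (bet i - bet j)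
     - wt (bet i - bet j) * (del0 i - del0 j))
  + \sum_(j | B j) kap i j * (sig (bet i - bet j + (del0 i - del0 j)) - sig (bet i - bet j)).
  rewrite dtB (bigID B) /= [X in X - _]addrC addrAC; congr (_ + _).
  have -> : vdeg i * (del0 i - wavg i) = vdeg i * del0 i - \sum_(j | ~~ B j) vmat i j * del0 j.
    by rewrite /wavg mulrBr [vdeg i * (_ / _)]mulrC divfK.
  by rewrite /vdeg mulr_suml -!sumrB; apply: eq_bigr => j _; rewrite /vmat; ring.
apply: (le_trans (ler_normD _ _)); apply: lerD.
  apply: norm_sum_le_card => [j _||]; last exact: card_le.
  - rewrite normrM (ger0_norm (kap_ge0 _ _)); apply: ler_pM => //.
    apply: (le_trans (sig_taylor1 _ _)).
    by rewrite -(ger0_norm (sqr_ge0 _)) normrX; apply: lerXn2r; rewrite ?nnegrE.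
  - by rewrite mulr_ge0// sqr_ge0.
apply: norm_sum_le_card => [j _||] //.
- rewrite normrM (ger0_norm (kap_ge0 _ _)); apply: ler_pM => //.
  exact: le_trans (sig_lipschitz _ _) (osc0 _ _).
- by rewrite mulr_ge0.
Qed.

Variable W : R.
Hypothesis W_le : forall i, `|\sum_(j | ~~ B j) vmat i j * (dt j / vdeg j)| <= W.

Let tau := 4 * b * (W + E2) / n%:R.

Let W_ge0 : 0 <= W. Proof. exact: le_trans (W_le o). Qed.
Let E2_ge0 : 0 <= E2.
Proof. by rewrite addr_ge0 ?mulr_ge0 ?sqr_ge0// ltW. Qed.
Let tau_ge0 : 0 <= tau.
Proof.
apply: divr_ge0 => //; apply: mulr_ge0; last exact: addr_ge0.
by apply: mulr_ge0 => //; exact: ltW.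
Qed.

(** Outside the block [s] is 0, so by [score0_linear] the value [del0 j] is close to
    [wavg j + dt j / vdeg j]. Averaging with weights [vmat i j] makes [wavg i] nearly the weighted
    mean of the outer [wavg j]; [W] controls the averaged noise, where bounding each [dt j]
    separately would lose an order. *)
Lemma wavg_gap i : `|\sum_(j | ~~ B j) vmat i j * (wavg i - wavg j)| <= vdeg i * tau.
Proof.
have vn l : vdeg l != 0 by rewrite gt_eqF// vdeg_gt0.
have -> : \sum_(j | ~~ B j) vmat i j * (wavg i - wavg j) =
   \sum_(j | ~~ B j) vmat i j * (dt j / vdeg j)
   + \sum_(j | ~~ B j) vmat i j * ((del0 j - wavg j) - dt j / vdeg j).
  have -> : \sum_(j | ~~ B j) vmat i j * (wavg i - wavg j) =
     vdeg i * wavg i - \sum_(j | ~~ B j) vmat i j * wavg j.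
    by rewrite /vdeg mulr_suml -sumrB; apply: eq_bigr => j _; rewrite mulrBr.
  have -> : vdeg i * wavg i = \sum_(j | ~~ B j) vmat i j * del0 j.
    by rewrite /wavg mulrC divfK.
  by rewrite -sumrB -big_split /=; apply: eq_bigr => j _; ring.
have bn : 0 <= 4 * b / n%:R by rewrite divr_ge0 ?mulr_ge0// ltW.
have -> : vdeg i * tau = 4 * b * vdeg i / n%:R * W + vdeg i * (4 * b / n%:R * E2).
  by rewrite /tau; field; rewrite gt_eqF.
apply: (le_trans (ler_normD _ _)); apply: lerD.
  apply: (le_trans (W_le i)); apply: ler_peMl => //.
  by rewrite ler_pdivlMr// mul1r vdeg_ge.
apply: (le_trans (ler_norm_sum _ _ _)); rewrite /vdeg mulr_suml; apply: ler_sum => j nBj.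
rewrite normrM (ger0_norm (vmat_ge0 _ _)); apply: ler_wpM2l; first exact: vmat_ge0.
have -> : del0 j - wavg j - dt j / vdeg j = - (vdeg j)^-1 * (dt j - s j - vdeg j * (del0 j - wavg j)).
  by rewrite s_nB//; field.
rewrite normrM [ `|- _^-1|]normrN norm_vdegV; apply: ler_pM => //.
- by rewrite invr_ge0 ltW// vdeg_gt0.
- exact: vdegV_le.
- exact: score0_linear.
Qed.

(** The maximum principle again, now for a function that is almost equal to its weighted means. *)
Lemma wavg_osc i j : ~~ B i -> ~~ B j -> `|wavg i - wavg j| <= 4 * (b * C * tau).
Proof.
suff H : forall i j, ~~ B i -> ~~ B j -> wavg i - wavg j <= 4 * (b * C * tau).
  by move=> nBi nBj; rewrite ler_norml; have := H _ _ nBi nBj; have := H _ _ nBj nBi => h1 h2; apply/andP; split; lra.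
move=> {i j} i j nBi nBj.
set X := b * (C * n%:R * tau).
have : #|[pred j | ~~ B j]|%:R * (wavg i - wavg j) <= 2 * X.
  apply: (@osc_le_mean_gap R _ [pred j | ~~ B j] wavg) => // l nBl ext.
  - apply: (@le_trans _ _ (b * \sum_(j | ~~ B j) vmat l j * (wavg l - wavg j))); last first.
      apply: ler_wpM2l; first exact: ltW.
      apply: (le_trans (ler_norm _)); apply: (le_trans (wavg_gap l)).
      by apply: ler_wpM2r => //; exact: vdeg_le.
    rewrite mulr_sumr; apply: ler_sum => p nBp.
    have [->|lp] := eqVneq l p; first by rewrite !subrr !mulr0.
    rewrite mulrA -[leLHS]mul1r; apply: ler_wpM2r; last exact: kap_wt.
    by rewrite subr_ge0 ext.
  - apply: (@le_trans _ _ (- (b * \sum_(j | ~~ B j) vmat l j * (wavg l - wavg j)))); last first.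
      rewrite -mulrN; apply: ler_wpM2l; first exact: ltW.
      apply: (le_trans (ler_norm _)); rewrite normrN; apply: (le_trans (wavg_gap l)).
      by apply: ler_wpM2r => //; exact: vdeg_le.
    rewrite mulr_sumr -sumrN; apply: ler_sum => p nBp.
    have [->|lp] := eqVneq l p; first by rewrite !subrr !mulr0 oppr0.
    have -> : - (b * (vmat l p * (wavg l - wavg p))) = b * vmat l p * (wavg p - wavg l) by ring.
    rewrite -[leLHS]mul1r; apply: ler_wpM2r; last exact: kap_wt.
    by rewrite subr_ge0 ext.
move=> h.
have [w0|w0] := leP (wavg i - wavg j) 0.
  by apply: (le_trans w0); apply: mulr_ge0 => //; apply: mulr_ge0 => //; exact: mulr_ge0.
rewrite -(ler_pM2l n_gt0).
apply: (@le_trans _ _ (2 * (#|[pred j | ~~ B j]|%:R * (wavg i - wavg j)))).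
  by rewrite mulrA; apply: ler_wpM2r => //; exact: ltW.
have -> : n%:R * (4 * (b * C * tau)) = 2 * (2 * X) by rewrite /X; ring.
exact: ler_wpM2l.
Qed.

(** Extends the near constancy to block items: such a value is close to a weighted mean of outer
    ones. *)
Lemma wavg_near i : `|wavg i - wavg o| <= tau + 4 * (b * C * tau).
Proof.
have vn : vdeg i != 0 by rewrite gt_eqF// vdeg_gt0.
have v0 := vdeg_gt0 i.
suff h : vdeg i * `|wavg i - wavg o| <= vdeg i * (tau + 4 * (b * C * tau)) by rewrite ler_pM2l in h.
rewrite -{1}(gtr0_norm v0) -normrM.
have -> : vdeg i * (wavg i - wavg o) = \sum_(j | ~~ B j) vmat i j * (wavg i - wavg j)
   + \sum_(j | ~~ B j) vmat i j * (wavg j - wavg o).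
  by rewrite -big_split /= /vdeg mulr_suml; apply: eq_bigr => j _; ring.
rewrite mulrDr; apply: (le_trans (ler_normD _ _)); apply: lerD; first exact: wavg_gap.
apply: (le_trans (ler_norm_sum _ _ _)); rewrite /vdeg mulr_suml; apply: ler_sum => j nBj.
rewrite normrM (ger0_norm (vmat_ge0 _ _)); apply: ler_wpM2l; first exact: vmat_ge0.
exact: wavg_osc.
Qed.

Variables (D : 'I_n -> R) (G dB : R).
Hypothesis D_dt : forall i, B i -> `|D i - dt i| <= G.
Hypothesis del0_B : forall i, B i -> del0 i = dB.
Variable ib : 'I_n.
Hypothesis B_ib : B ib.

Let Ff := G + E2 + C * n%:R * (tau + 4 * (b * C * tau)).

(** The null maximizer has the single displacement [dB] on the block and [wavg] is nearly [wavg o],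
    so [D] is the score plus a multiple of [vdeg] with one coefficient for the whole block. *)
Lemma block_repr i : B i -> `|D i - s i - vdeg i * (dB - wavg o)| <= Ff.
Proof.
move=> Bi.
have -> : D i - s i - vdeg i * (dB - wavg o) = (D i - dt i)
  + (dt i - s i - vdeg i * (del0 i - wavg i)) - vdeg i * (wavg i - wavg o).
  by rewrite del0_B//; ring.
apply: (le_trans (ler_normB _ _)); apply: lerD.
  by apply: (le_trans (ler_normD _ _)); apply: lerD; [exact: D_dt|exact: score0_linear].
rewrite normrM (gtr0_norm (vdeg_gt0 _)); apply: ler_pM => //.
- by rewrite ltW// vdeg_gt0.
- exact: vdeg_le.
- exact: wavg_near.
Qed.

(** The minimum over $X$ of $\sum_B(D_i-v_iX)^2/v_i$, hence unchanged when a multiple of [vdeg] is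
    added to [D]. *)
Definition block_quad (D : 'I_n -> R) : R :=
  \sum_(i | B i) D i ^+ 2 / vdeg i - (\sum_(i | B i) D i) ^+ 2 / \sum_(i | B i) vdeg i.

Lemma lr_block_quad : `|2 * (lik kap e g1 - lik kap e g0) - block_quad D| <=
  1 / 2 * (C * (n%:R ^+ 2 * L ^+ 3 + 2 * (n%:R * C * (2 * eps) ^+ 3)))
  + C * (Ss * Ee * (4 * b / n%:R))
  + C * ((2 * (Ss * Ff) + Ff ^+ 2) * (4 * b / n%:R)) + (C * Ff) ^+ 2 * (4 * b / n%:R).
Proof.
pose F i := D i - s i - vdeg i * (dB - wavg o).
pose X := dB - wavg o.
have FE i : D i = s i + F i + vdeg i * X by rewrite /F /X; ring.
have F_le i : B i -> `|F i| <= Ff by exact: block_repr.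
have Ff0 : 0 <= Ff by exact: le_trans (F_le _ B_ib).
have Ss0 : 0 <= Ss by exact: le_trans (score0_le ib).
have vn l : vdeg l != 0 by rewrite gt_eqF// vdeg_gt0.
set V := \sum_(i | B i) vdeg i.
have V_ge : vdeg ib <= V.
  by rewrite /V (bigD1 ib)//= lerDl sumr_ge0// => i _; rewrite ltW// vdeg_gt0.
have V0 : 0 < V by apply: lt_le_trans V_ge; exact: vdeg_gt0.
have VV : V^-1 <= 4 * b / n%:R.
  by apply: le_trans (vdegV_le ib); rewrite lef_pV2 ?posrE ?vdeg_gt0.
have bn : 0 <= 4 * b / n%:R by rewrite divr_ge0 ?mulr_ge0// ltW.
(* The common multiple of [vdeg] drops out, and the cross terms with [s] vanish because the scores
   at the null maximizer sum to 0 over the block. *)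
have QE : block_quad D = \sum_(i | B i) s i ^+ 2 / vdeg i
   + \sum_(i | B i) (2 * (s i * F i) + F i ^+ 2) / vdeg i - (\sum_(i | B i) F i) ^+ 2 / V.
  rewrite /block_quad -/V.
  have -> : \sum_(i | B i) D i = \sum_(i | B i) F i + V * X.
    rewrite (eq_bigr _ (fun i _ => FE i)) big_split big_split /= s_sum0 add0r.
    by rewrite /V mulr_suml.
  have -> : \sum_(i | B i) D i ^+ 2 / vdeg i = \sum_(i | B i) s i ^+ 2 / vdeg i
   + \sum_(i | B i) (2 * (s i * F i) + F i ^+ 2) / vdeg i + 2 * X * (\sum_(i | B i) F i) + V * X ^+ 2.
    transitivity (\sum_(i | B i) s i ^+ 2 / vdeg i
     + \sum_(i | B i) (2 * (s i * F i) + F i ^+ 2) / vdeg i + 2 * X * (\sum_(i | B i) F i) + V * X ^+ 2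
     + 2 * X * (\sum_(i | B i) s i)).
      rewrite /V !mulr_sumr mulr_suml -!big_split /=; apply: eq_bigr => i _.
      by rewrite (FE i); field.
    by rewrite s_sum0 mulr0 addr0.
  by field; rewrite gt_eqF.
have Q1 : `|\sum_(i | B i) (2 * (s i * F i) + F i ^+ 2) / vdeg i| <=
   C * ((2 * (Ss * Ff) + Ff ^+ 2) * (4 * b / n%:R)).
  have nn : 0 <= 2 * (Ss * Ff) + Ff ^+ 2 by rewrite addr_ge0 ?sqr_ge0// mulr_ge0// mulr_ge0.
  apply: norm_sum_le_card => [i Bi||] //; last by rewrite mulr_ge0.
  rewrite normrM norm_vdegV; apply: ler_pM => //.
  - by rewrite invr_ge0 ltW// vdeg_gt0.
  - apply: (le_trans (ler_normD _ _)); apply: lerD.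
      rewrite normrM ger0_norm//; apply: ler_wpM2l => //; rewrite normrM; apply: ler_pM => //.
        exact: score0_le.
      exact: F_le.
    by rewrite normrX; apply: lerXn2r; rewrite ?nnegrE// F_le.
  - exact: vdegV_le.
have Q2 : `|(\sum_(i | B i) F i) ^+ 2 / V| <= (C * Ff) ^+ 2 * (4 * b / n%:R).
  rewrite normrM [ `|V^-1|]ger0_norm ?invr_ge0 ?(ltW V0)//; apply: ler_pM => //.
    by rewrite invr_ge0 ltW.
  rewrite normrX; apply: lerXn2r; rewrite ?nnegrE ?mulr_ge0//.
  exact: norm_sum_le_card.
have Q3 : `|\sum_(i | B i) s i * eta i - \sum_(i | B i) s i ^+ 2 / vdeg i| <= C * (Ss * Ee * (4 * b / n%:R)).
  have Ee0 : 0 <= Ee by exact: le_trans (score_eta _ B_ib).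
  rewrite -sumrB; apply: norm_sum_le_card => [i Bi||] //; last by rewrite !mulr_ge0.
  have -> : s i * eta i - s i ^+ 2 / vdeg i = - (s i * (s i - vdeg i * eta i) / vdeg i) by field.
  rewrite normrN normrM norm_vdegV; apply: ler_pM => //.
  - by rewrite invr_ge0 ltW// vdeg_gt0.
  - by rewrite normrM; apply: ler_pM => //; [exact: score0_le|exact: score_eta].
  - exact: vdegV_le.
have Q0 := lr_score_approx.
rewrite QE; move: Q0 Q1 Q2 Q3; rewrite !ler_norml.
move=> /andP[a1 a2] /andP[a3 a4] /andP[a5 a6] /andP[a7 a8].
by apply/andP; split; lra.
Qed.

Hypothesis C_ge8 : 8 <= C.
Hypothesis eps_y : eps <= C ^+ 2 * b * y.
Hypothesis W_y : W <= b * n%:R * y ^+ 2.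
Hypothesis ny2 : 1 <= n%:R * y ^+ 2.
Hypothesis y_le1 : y <= 1.
Hypothesis b3y : b ^+ 3 * y <= 1.
Hypothesis G_le : G <= C ^+ 2.

Lemma lr_block_quad_rate :
  `|2 * (lik kap e g1 - lik kap e g0) - block_quad D| <= C ^+ 24 * (b ^+ 6 * (n%:R * y ^+ 3)).
Proof.
apply: (le_trans lr_block_quad).
apply: (@expansion_rate_arith R C b n%:R y eps L W G Ee Ss E2 tau Ff) => //.
- by apply: le_trans n_ge4; rewrite ler1n.
- by rewrite y_ge0.
- by rewrite eps_ge0.
- by rewrite W_ge0.
- by rewrite G_le andbT; exact: le_trans (D_dt _ B_ib).
Qed.

End Expansion.

(** * Binomial moments and Bernstein approximation *)

Section BinomialMoments.
Context {R : realType}.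

Definition binom_exp (N : nat) (p : R) (f : nat -> R) : R :=
  \sum_(0 <= j < N.+1) ('C(N, j)%:R * p ^+ j * (1 - p) ^+ (N - j)) * f j.

(** Conditioning on one trial, for inductions on the number of trials. *)
Lemma binom_expS N p f : binom_exp N.+1 p f =
  p * binom_exp N p (fun j => f j.+1) + (1 - p) * binom_exp N p f.
Proof.
rewrite /binom_exp big_nat_recl//= bin0 expr0 subn0 mul1r mul1r.
have E : \sum_(0 <= j < N.+1) ('C(N.+1, j.+1)%:R * p ^+ j.+1 * (1 - p) ^+ (N.+1 - j.+1)) * f j.+1 =
  p * (\sum_(0 <= j < N.+1) ('C(N, j)%:R * p ^+ j * (1 - p) ^+ (N - j)) * f j.+1) +
  \sum_(0 <= j < N.+1) ('C(N, j.+1)%:R * p ^+ j.+1 * (1 - p) ^+ (N - j)) * f j.+1.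
  rewrite mulr_sumr -big_split /=; apply: eq_bigr => j _.
  by rewrite binS natrD subSS exprS; ring.
rewrite E [LHS]addrCA; congr (_ + _).
rewrite [in RHS]big_nat_recl//= bin0 expr0 subn0 !mul1r mulrDr mulrA -exprS; congr (_ + _).
rewrite big_nat_recr//= bin_small// !mul0r addr0 mulr_sumr.
apply: eq_big_nat => j /andP[_ jN].
have -> : (1 - p) ^+ (N - j) = (1 - p) * (1 - p) ^+ (N - j.+1) by rewrite -exprS subnSK.
by ring.
Qed.

Lemma binom_exp0 p f : binom_exp 0 p f = f 0%N.
Proof. by rewrite /binom_exp big_nat1 bin0 !expr0 !mul1r. Qed.

Lemma binom_exp_lin N p (a c : R) f g :
  binom_exp N p (fun j => a * f j + c * g j) = a * binom_exp N p f + c * binom_exp N p g.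
Proof.
rewrite /binom_exp !mulr_sumr -big_split /=; apply: eq_bigr => j _; ring.
Qed.

Lemma binom_exp_cst N p c : binom_exp N p (fun=> c) = c.
Proof.
elim: N => [|N IH]; first by rewrite binom_exp0.
by rewrite binom_expS !IH; ring.
Qed.

Lemma eq_binom_exp N p f g : f =1 g -> binom_exp N p f = binom_exp N p g.
Proof. by move=> fg; apply: eq_bigr => j _; rewrite fg. Qed.

Lemma binom_exp_mean N p : binom_exp N p (fun j => j%:R) = N%:R * p.
Proof.
elim: N => [|N IH]; first by rewrite binom_exp0 mul0r.
rewrite binom_expS (eq_binom_exp _ _ _ (fun j => 1 * j%:R + 1 * 1)) => [|j]; last by rewrite !mul1r natr1.
by rewrite (binom_exp_lin _ _ _ _ (fun j => j%:R) (fun=> 1)) binom_exp_cst IH -natr1; ring.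
Qed.

Lemma binom_exp_sqr N p : binom_exp N p (fun j => j%:R ^+ 2) = N%:R * p * (1 - p) + (N%:R * p) ^+ 2.
Proof.
elim: N => [|N IH]; first by rewrite binom_exp0 !mul0r expr2 !mul0r addr0.
rewrite binom_expS (eq_binom_exp _ _ _ (fun j => 1 * j%:R ^+ 2 + 1 * (2 * j%:R + 1 * 1))) => [|j]; last first.
  by rewrite -natr1; ring.
rewrite (binom_exp_lin _ _ _ _ (fun j => j%:R ^+ 2) (fun j => 2 * j%:R + 1 * 1)).
rewrite (binom_exp_lin _ _ _ _ (fun j => j%:R) (fun=> 1)) binom_exp_cst binom_exp_mean IH -natr1.
by ring.
Qed.

Lemma binom_exp_center N p : binom_exp N p (fun j => j%:R - N%:R * p) = 0.
Proof.
rewrite (eq_binom_exp _ _ _ (fun j => 1 * j%:R + (- (N%:R * p)) * 1)) => [|j]; last by ring.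
by rewrite (binom_exp_lin _ _ _ _ (fun j => j%:R) (fun=> 1)) binom_exp_cst binom_exp_mean; ring.
Qed.

Lemma binom_exp_var N p : binom_exp N p (fun j => (j%:R - N%:R * p) ^+ 2) = N%:R * p * (1 - p).
Proof.
rewrite (eq_binom_exp _ _ _ (fun j => 1 * j%:R ^+ 2 + 1 * ((- (2 * N%:R * p)) * j%:R + (N%:R * p) ^+ 2 * 1))) => [|j]; last by ring.
rewrite (binom_exp_lin _ _ _ _ (fun j => j%:R ^+ 2) (fun j => (- (2 * N%:R * p)) * j%:R + (N%:R * p) ^+ 2 * 1)).
rewrite (binom_exp_lin _ _ _ _ (fun j => j%:R) (fun=> 1)) binom_exp_cst binom_exp_mean binom_exp_sqr.
by ring.
Qed.

(** Counts are stored in ['I_K.+1] whatever the number of comparisons; beyond [N] the binomial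
    coefficient is 0. *)
Lemma binom_exp_widen K N (p : R) (f : nat -> R) : (N <= K)%N ->
  \sum_(x < K.+1) ('C(N, x)%:R * p ^+ x * (1 - p) ^+ (N - x)) * f x = binom_exp N p f.
Proof.
move=> NK; rewrite /binom_exp -(big_mkord xpredT (fun x => ('C(N, x)%:R * p ^+ x * (1 - p) ^+ (N - x)) * f x)).
rewrite (@big_cat_nat _ _ _ N.+1)//= [X in _ + X]big_nat_cond [X in _ + X]big1 ?addr0// => j.
by rewrite andbT => /andP[Nj _]; rewrite bin_small// !mul0r.
Qed.

Lemma bernstein_approx (f : R -> R) (c kappa : R) : 0 <= c -> 0 < kappa ->
  (forall u v : R, 0 <= u <= 1 -> 0 <= v <= 1 -> `|f u - f v| <= c * `|u - v|) ->
  exists p : {poly R}, forall u : R, 0 <= u <= 1 -> `|p.[u] - f u| <= kappa.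
Proof.
move=> c0 k0 lip.
pose eta := kappa / (c + 1).
have eta0 : 0 < eta by rewrite divr_gt0// ltr_wpDl.
have [N] := ltr_add_invr (exprn_gt0 2 eta0); rewrite add0r => HN.
have N0 : 0 < N.+1%:R :> R by [].
exists (\sum_(0 <= j < N.+2) ('C(N.+1, j)%:R * f (j%:R / N.+1%:R)) *: ('X ^+ j * (1 - 'X) ^+ (N.+1 - j))).
move=> u u01; have /andP[u0 u1] := u01.
have -> : (\sum_(0 <= j < N.+2) ('C(N.+1, j)%:R * f (j%:R / N.+1%:R)) *: ('X ^+ j * (1 - 'X) ^+ (N.+1 - j))).[u]
   = binom_exp N.+1 u (fun j => f (j%:R / N.+1%:R)).
  rewrite horner_sum; apply: eq_bigr => j _.
  rewrite hornerZ hornerM !horner_exp hornerX.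
  have -> : (1 - 'X : {poly R}).[u] = 1 - u by rewrite !hornerE.
  by rewrite mulrA [RHS]mulrAC; congr (_ * _); rewrite mulrAC.
have -> : f u = binom_exp N.+1 u (fun=> f u) by rewrite binom_exp_cst.
rewrite /binom_exp -sumrB.
(* With $d=j/(N+1)-u$, the bound $|d|\le\eta/2+d^2/(2\eta)$ replaces a split into near and far
   terms, so the variance alone controls the error. *)
apply: (@le_trans _ _ (binom_exp N.+1 u (fun j => c * (eta / 2 * 1 + (2 * eta * N.+1%:R ^+ 2)^-1 * (j%:R - N.+1%:R * u) ^+ 2) + 0 * 1))).
  apply: (le_trans (ler_norm_sum _ _ _)); apply: ler_sum_nat => j /andP[_ jN].
  rewrite -mulrBr normrM ger0_norm; last first.
    by rewrite !mulr_ge0 ?exprn_ge0// subr_ge0.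
  apply: ler_wpM2l; first by rewrite !mulr_ge0 ?exprn_ge0// subr_ge0.
  have j01 : 0 <= (j%:R / N.+1%:R : R) <= 1.
    by rewrite divr_ge0//= ler_pdivrMr// mul1r ler_nat.
  apply: (le_trans (lip _ _ j01 u01)); rewrite mul0r addr0; apply: ler_wpM2l => //.
  have -> : (2 * eta * N.+1%:R ^+ 2)^-1 * (j%:R - N.+1%:R * u) ^+ 2 = (j%:R / N.+1%:R - u) ^+ 2 / (2 * eta).
    by field; rewrite gt_eqF// gt_eqF.
  set d := j%:R / N.+1%:R - u.
  rewrite -(ger0_norm (sqr_ge0 d)) normrX mulr1.
  have := sqr_ge0 (`|d| - eta).
  have -> : (`|d| - eta) ^+ 2 = `|d| ^+ 2 - 2 * eta * `|d| + eta ^+ 2 by ring.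
  move=> h; rewrite -(ler_pM2l (mulr_gt0 (ltr0n R 2) eta0)) mulrDr [X in _ + X]mulrC divfK; last by rewrite gt_eqF// mulr_gt0.
  have -> : 2 * eta * (eta / 2) = eta ^+ 2 by field.
  lra.
rewrite (binom_exp_lin _ _ _ _ (fun j => eta / 2 * 1 + (2 * eta * N.+1%:R ^+ 2)^-1 * (j%:R - N.+1%:R * u) ^+ 2) (fun=> 1)).
rewrite (binom_exp_lin _ _ _ _ (fun=> 1) (fun j => (j%:R - N.+1%:R * u) ^+ 2)) binom_exp_var !binom_exp_cst mul0r addr0 mulr1.
have e1 : (2 * eta * N.+1%:R ^+ 2)^-1 * (N.+1%:R * u * (1 - u)) <= eta / 2.
  have -> : (2 * eta * N.+1%:R ^+ 2)^-1 * (N.+1%:R * u * (1 - u)) = N.+1%:R^-1 * (u * (1 - u)) / (2 * eta).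
    by field; rewrite gt_eqF// gt_eqF.
  have e2 : 0 < 2 * eta by exact: mulr_gt0.
  rewrite ler_pdivrMr//.
  have -> : eta / 2 * (2 * eta) = eta ^+ 2 by field.
  apply: le_trans (ltW HN); apply: ler_piMr; first by rewrite invr_ge0.
  nra.
apply: (@le_trans _ _ (c * eta)); first by apply: ler_wpM2l => //; rewrite [leRHS]splitr lerD2l.
rewrite /eta mulrCA; apply: ler_piMr; first exact: ltW.
by rewrite ler_pdivrMr ?mul1r; lra.
Qed.

End BinomialMoments.

(** * Integrability and scaling of the chi-square kernel *)

Section ChiSquareIntegral.
Context {R : realType}.
Notation mu := (@lebesgue_measure R).
Implicit Types (m : nat).

Lemma is_derive_continuous (f : R -> R) (x d : R) :
  is_derive x 1 f d -> {for x, continuous f}.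
Proof.
by move=> h; apply: differentiable_continuous; apply/derivable1_diffP; exact: ex_derive.
Qed.

Definition posray : set R := `]0, +oo[%classic.

Lemma measurable_posray : measurable posray.
Proof. exact: measurable_itv. Qed.

Lemma posrayE (t : R) : posray t = (0 < t).
Proof. by rewrite /posray /= in_itv /= andbT. Qed.

Lemma chisq_kernel_ge0 m (t : R) : 0 <= chisq_kernel m t.
Proof. by rewrite mulr_ge0 ?powR_ge0 ?expR_ge0. Qed.

Lemma measurable_chisq_kernel m (D : set R) : measurable_fun D (chisq_kernel m : R -> R).
Proof.
apply: measurable_funTS; apply: measurable_funM; first exact: measurable_powR.
by apply: measurableT_comp => //; apply: measurable_funM.
Qed.

Lemma measurable_chisq_exp m (k : R) (D : set R) :
  measurable_fun D (fun t : R => chisq_kernel m t * expR (- (k * t))).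
Proof.
apply: measurable_funM; first exact: measurable_chisq_kernel.
apply: measurable_funTS; by apply: measurableT_comp => //; apply: measurableT_comp.
Qed.

Lemma chisq_kernel_sqrt m (t : R) : 0 < t ->
  chisq_kernel m.+1 t = Num.sqrt t ^+ m / Num.sqrt t * expR (- t / 2).
Proof.
move=> t0; rewrite /chisq_kernel; congr (_ * _).
have -> : m.+1%:R / 2 - 1 = 2^-1 * m%:R + - 2^-1 :> R by rewrite -natr1; field.
rewrite powRD; last by apply/implyP => _; rewrite gt_eqF.
by rewrite powRrM powRN powR12_sqrt ?(ltW t0)// powR_mulrn ?sqrtr_ge0.
Qed.

Lemma exprn_le_fact_expR (u : R) m : 0 <= u -> u ^+ m <= m`!%:R * expR u.
Proof.
move=> u0; case: m => [|m]; first by rewrite expr0 mul1r -expR0 ler_expR.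
have := expR_ge1Dxn m u0; have f0 : 0 < (m.+1)`!%:R :> R by rewrite ltr0n fact_gt0.
move=> h; rewrite mulrC -ler_pdivrMr//; lra.
Qed.

(** The derivative of $-e^{-\sqrt t}$: a majorant with explicit integral and the singularity
    $t^{-1/2}$ at 0 of the kernel with one degree of freedom. *)
Definition sqrt_exp (t : R) : R := expR (- Num.sqrt t) / (2 * Num.sqrt t).

Lemma chisq_kernel_le m (t : R) : 0 < t ->
  chisq_kernel m.+1 t <= 2 * m`!%:R * expR 2 * sqrt_exp t.
Proof.
move=> t0; rewrite chisq_kernel_sqrt// /sqrt_exp.
have s0 : 0 < Num.sqrt t by rewrite sqrtr_gt0.
have tE : t = Num.sqrt t ^+ 2 by rewrite sqr_sqrtr// ltW.
rewrite {3}tE; set u := Num.sqrt t in s0 *.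
have -> : 2 * m`!%:R * expR 2 * (expR (- u) / (2 * u)) = m`!%:R * (expR 2 * expR (- u)) / u.
  by field; rewrite gt_eqF.
rewrite mulrAC ler_pM2r ?invr_gt0//.
apply: (@le_trans _ _ (m`!%:R * expR u * expR (- u ^+ 2 / 2))).
  by apply: ler_wpM2r; [exact: expR_ge0|exact: exprn_le_fact_expR (ltW s0)].
rewrite -mulrA; apply: ler_wpM2l => //; rewrite -!expRD ler_expR.
(* Gives $u-u^2/2\le 2-u$, the source of the factor $e^2$. *)
have := sqr_ge0 (u - 2); have -> : (u - 2) ^+ 2 = u ^+ 2 - 4 * u + 4 by ring.
lra.
Qed.

Lemma is_derive_sqrt_exp (t : R) : 0 < t ->
  is_derive t 1 (fun x : R => - expR (- Num.sqrt x)) (sqrt_exp t).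
Proof.
move=> t0; have d1 := is_derive1_sqrt t0.
have s0 : 0 < Num.sqrt t by rewrite sqrtr_gt0.
have d2 : is_derive t 1 (fun x : R => - Num.sqrt x) (- (2 * Num.sqrt t)^-1).
  exact: is_deriveN.
have d3 := is_derive1_comp (g := fun x : R => - Num.sqrt x) (is_derive_expR (- Num.sqrt t)) d2.
have -> : sqrt_exp t = - (expR (- Num.sqrt t) * - (2 * Num.sqrt t)^-1).
  by rewrite /sqrt_exp mulrN opprK.
exact: is_deriveN.
Qed.

Lemma sqrt_exp_continuous (t : R) : 0 < t -> {for t, continuous sqrt_exp}.
Proof.
move=> t0; have s0 : 0 < Num.sqrt t by rewrite sqrtr_gt0.
rewrite /sqrt_exp.
have cs : {for t, continuous (fun x : R => Num.sqrt x)} by exact: sqrt_continuous.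
apply: (@continuousM _ _ (fun x : R => expR (- Num.sqrt x)) (fun x => (2 * Num.sqrt x)^-1)).
  apply: (@continuous_comp _ _ _ (fun x : R => - Num.sqrt x) expR).
    exact: continuousN.
  exact: continuous_expR.
apply: (@continuousV _ _ (fun x : R => 2 * Num.sqrt x)); first by rewrite gt_eqF// mulr_gt0.
by apply: (@continuousM _ _ (cst 2) (fun x : R => Num.sqrt x)) => //; exact: cst_continuous.
Qed.

Lemma bigcup_rays (c : R) : 0 < c ->
  \bigcup_(i : nat) `[c / i.+1%:R, +oo[%classic = posray.
Proof.
move=> c0; apply/seteqP; split=> [t [i _] /=|t].
  rewrite posrayE in_itv /= andbT; apply: lt_le_trans.
  by rewrite divr_gt0.
rewrite posrayE => t0; have /ltr_add_invr[k] : 0 < t / c by rewrite divr_gt0.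
rewrite add0r => h; exists k => //=; rewrite in_itv /= andbT.
by rewrite -ler_pdivlMl// mulrC ltW.
Qed.

Lemma rays_nondecreasing (c : R) : 0 < c ->
  {homo (fun i : nat => `[c / i.+1%:R, +oo[%classic) : i j / (i <= j)%N >-> (i <= j)%O}.
Proof.
move=> c0 i j ij; rewrite subsetEset => t /=; rewrite !in_itv /= !andbT; apply: le_trans.
by rewrite ler_pM2l// lef_pV2 ?posrE// ler_nat.
Qed.

(** The kernel can be unbounded at 0, so the open ray is exhausted by closed ones. The free [c] lets
    the substitution $t\mapsto ct$ match the rays on both sides. *)
Lemma integral_posray_lim (c : R) (f : R -> R) : 0 < c -> (forall t, 0 <= f t) ->
  (forall D, measurable_fun D f) ->
  (\int[mu]_(t in `[(c / i.+1%:R)%R, +oo[) (f t)%:E)%E @[i --> \oo] -->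
  (\int[mu]_(t in posray) (f t)%:E)%E.
Proof.
move=> c0 f0 mf; rewrite -(bigcup_rays _ c0).
apply: ge0_nondecreasing_set_cvg_integral.
- exact: rays_nondecreasing.
- by move=> i; exact: measurable_itv.
- by move=> i; apply/measurable_EFinP; exact: mf.
- by move=> i x _; rewrite lee_fin.
Qed.

Lemma sqrt_exp_antiderivative_cvg : (fun x : R => - expR (- Num.sqrt x)) x @[x --> +oo] --> (0 : R).
Proof.
apply/cvgrPdist_le => eps eps0; near=> x.
rewrite sub0r opprK ger0_norm ?expR_ge0// expRN.
have x0 : 0 <= x by near: x; exact: nbhs_pinfty_ge.
have xe : eps ^- 2 <= x by near: x; apply: nbhs_pinfty_ge; rewrite num_real.
have se : eps^-1 <= Num.sqrt x.
  rewrite -(@ler_pXn2r _ 2) ?nnegrE ?sqrtr_ge0 ?invr_ge0 ?(ltW eps0)//.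
  by rewrite sqr_sqrtr// exprVn.
rewrite -[eps]invrK lef_pV2 ?posrE ?expR_gt0 ?invr_gt0//.
have := expR_ge1Dx (Num.sqrt x); lra.
Unshelve. all: by end_near. Qed.

Lemma integral_sqrt_exp_ray (a : R) : 0 < a ->
  (\int[mu]_(t in `[a, +oo[) (sqrt_exp t)%:E)%E = (expR (- Num.sqrt a))%:E.
Proof.
move=> a0.
have := @ge0_continuous_FTC2y R sqrt_exp (fun x : R => - expR (- Num.sqrt x)) a 0.
move=> ->.
- by rewrite sub0e -EFinN opprK.
- by move=> x ax; rewrite divr_ge0 ?expR_ge0// mulr_ge0// sqrtr_ge0.
- apply: continuous_in_subspaceT => x; rewrite inE /= in_itv /= andbT => ax.
  exact: sqrt_exp_continuous (lt_le_trans a0 ax).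
- exact: sqrt_exp_antiderivative_cvg.
- move=> x ax; have h := is_derive_sqrt_exp _ (lt_trans a0 ax); exact: ex_derive.
- exact: cvg_at_right_filter (is_derive_continuous _ _ _ (is_derive_sqrt_exp _ a0)).
- move=> x; rewrite in_itv /= andbT => ax.
  have h := is_derive_sqrt_exp _ (lt_trans a0 ax).
  by rewrite derive1E; exact: derive_val.
Qed.

Lemma integral_chisq_kernel_lty m :
  (\int[mu]_(t in posray) (chisq_kernel m.+1 t)%:E < +oo)%E.
Proof.
pose C : R := 2 * m`!%:R * expR 2.
have C0 : 0 <= C by rewrite !mulr_ge0 ?expR_ge0.
apply: (@le_lt_trans _ _ C%:E); last exact: ltry.
apply: cvge_le (integral_posray_lim 1 (chisq_kernel m.+1) ltr01 (chisq_kernel_ge0 _) (measurable_chisq_kernel _)).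
apply: nearW => i.
have a0 : 0 < 1 / i.+1%:R :> R by rewrite divr_gt0.
have ms : measurable_fun `[(1 / i.+1%:R : R), +oo[ sqrt_exp.
  apply: subspace_continuous_measurable_fun; first exact: measurable_itv.
  apply: continuous_in_subspaceT => x; rewrite inE /= in_itv /= andbT => ax.
  exact: sqrt_exp_continuous (lt_le_trans a0 ax).
apply: (@le_trans _ _ (\int[mu]_(t in `[(1 / i.+1%:R)%R, +oo[) (C%:E * (sqrt_exp t)%:E))%E).
  apply: ge0_le_integral.
  - exact: measurable_itv.
  - by move=> x _; rewrite lee_fin chisq_kernel_ge0.
  - by apply/measurable_EFinP; exact: measurable_chisq_kernel.
  - by apply: emeasurable_funM; apply/measurable_EFinP => //; exact: measurable_cst.
  - move=> x; rewrite /= in_itv /= andbT => ax; rewrite -EFinM lee_fin.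
    exact: chisq_kernel_le (lt_le_trans a0 ax).
rewrite ge0_integralZl.
- rewrite integral_sqrt_exp_ray// -EFinM lee_fin.
  by apply: ler_piMr => //; rewrite expR_le1 oppr_le0 sqrtr_ge0.
- exact: measurable_itv.
- by apply/measurable_EFinP.
- by move=> x _; rewrite lee_fin divr_ge0 ?expR_ge0// mulr_ge0// sqrtr_ge0.
- by rewrite lee_fin.
Qed.

Lemma chisq_kernel_continuous m (t : R) : 0 < t -> {for t, continuous (chisq_kernel m : R -> R)}.
Proof.
move=> t0; rewrite /chisq_kernel.
apply: (@continuousM _ _ (fun x : R => x `^ (m%:R / 2 - 1)) (fun x => expR (- x / 2))).
  exact: is_derive_continuous (is_derive1_powR (m%:R / 2 - 1) t0).
apply: (@continuous_comp _ _ _ (fun x : R => - x / 2) expR); last exact: continuous_expR.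
apply: (@continuousM _ _ (fun x : R => - x) (cst 2^-1)); last exact: cst_continuous.
exact: continuousN.
Qed.

Lemma chisq_kernel_scale m (c t : R) : 0 < c -> 0 < t ->
  chisq_kernel m (c * t) * c = c `^ (m%:R / 2) * (chisq_kernel m t * expR (- ((c - 1) / 2 * t))).
Proof.
move=> c0 t0; rewrite /chisq_kernel powRM ?(ltW c0) ?(ltW t0)//.
have -> : - (c * t) / 2 = - t / 2 + - ((c - 1) / 2 * t) by field.
rewrite expRD.
have -> : c `^ (m%:R / 2) = c `^ (m%:R / 2 - 1) * c.
  rewrite -{3}[c]powRr1 ?(ltW c0)// -powRD; last by apply/implyP => _; rewrite gt_eqF.
  by congr (_ `^ _); ring.
by ring.
Qed.

(** Substitution $t\mapsto ct$ with $c=1+2k$. It yields the Laplace transform relative to the total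
    mass, so the mass itself is never evaluated. *)
Lemma integral_chisq_scale m (k : nat) :
  (\int[mu]_(t in posray) (chisq_kernel m t)%:E =
   ((1 + 2 * k%:R) `^ (m%:R / 2))%:E *
     \int[mu]_(t in posray) (chisq_kernel m t * expR (- (k%:R * t)))%:E)%E.
Proof.
set c : R := 1 + 2 * k%:R.
have c0 : 0 < c by rewrite /c ltr_pwDl// mulr_ge0.
have nn t : 0 <= chisq_kernel m t * expR (- (k%:R * t)) :> R.
  by rewrite mulr_ge0 ?chisq_kernel_ge0 ?expR_ge0.
have cE : (c - 1) / 2 = k%:R by rewrite /c; field.
have ms D : measurable_fun D (fun t : R => c `^ (m%:R / 2) * (chisq_kernel m t * expR (- (k%:R * t)))).
  by apply: measurable_funM => //; exact: measurable_chisq_exp.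
rewrite -ge0_integralZl//; last 4 first.
- exact: measurable_posray.
- by apply/measurable_EFinP; exact: measurable_chisq_exp.
- by move=> t _; rewrite lee_fin.
- by rewrite lee_fin powR_ge0.
have l1 := integral_posray_lim c (chisq_kernel m) c0 (chisq_kernel_ge0 m) (measurable_chisq_kernel m).
have l2 := integral_posray_lim 1 (fun t => c `^ (m%:R / 2) * (chisq_kernel m t * expR (- (k%:R * t)))) ltr01
  (fun t => mulr_ge0 (powR_ge0 _ _) (nn t)) ms.
rewrite -(cvg_lim _ l1)// -(cvg_lim _ l2)//.
apply: (congr1 (fun u : nat -> \bar R => limn u)); apply/funext => i.
have a0 : 0 < 1 / i.+1%:R :> R by rewrite divr_gt0.
have dF (x : R) : is_derive x 1 (fun x : R => c * x) c.
  by apply: is_derive_eq; rewrite /GRing.scale /= mulr1 ?mulr0 ?addr0.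
have F' : (fun x : R => c * x)^`()%classic = cst c.
  by apply/funext => x; rewrite derive1E; exact: derive_val.
have -> : c / i.+1%:R = c * (1 / i.+1%:R) by rewrite mul1r.
rewrite (@increasing_ge0_integration_by_substitutiony R (fun x => c * x) (chisq_kernel m) (1 / i.+1%:R)).
- apply: eq_integral => x; rewrite inE /= in_itv /= andbT => ax.
  rewrite F'; congr EFin; rewrite -[in RHS]cE -chisq_kernel_scale//.
  exact: lt_le_trans a0 ax.
- by move=> x y _ _ xy; rewrite ltr_pM2l.
- by move=> x _; rewrite F'; exact: cst_continuous.
- by rewrite F'; apply/cvg_ex; exists c; exact: cvg_cst.
- by rewrite F'; apply/cvg_ex; exists c; exact: cvg_cst.
- split=> [x _|]; first by have h := dF x; exact: ex_derive.
  exact: cvg_at_right_filter (is_derive_continuous _ _ _ (dF (1 / i.+1%:R))).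
- by apply: gt0_cvgMry => //; exact: cvg_id.
- apply: continuous_in_subspaceT => x; rewrite inE /= in_itv /= andbT => ax.
  by apply: chisq_kernel_continuous; apply: lt_le_trans ax; rewrite mulr_gt0.
- by move=> x _; exact: chisq_kernel_ge0.
Qed.

End ChiSquareIntegral.

(** * Chi-square moments of exp(-X) and continuity of the distribution function *)

Section ChiSquareMoments.
Context {R : realType} (m : nat).
Notation mu := (@lebesgue_measure R).
Local Notation ker := (@chisq_kernel R m.+1).

Definition chisq_mass : R := \int[mu]_(t in posray) ker t.
(** The Laplace transform at [k] for [m.+1] degrees of freedom; the successor keeps their number
    positive. *)
Definition chisq_laplace (k : nat) : R := (1 + 2 * k%:R) `^ (- (m.+1%:R / 2)).

Lemma integrable_chisq_exp (k : nat) :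
  mu.-integrable posray (EFin \o (fun t : R => ker t * expR (- (k%:R * t)))).
Proof.
have ik : mu.-integrable posray (EFin \o ker).
  apply/integrableP; split; first by apply/measurable_EFinP; exact: measurable_chisq_kernel.
  have := @integral_chisq_kernel_lty R m; congr (_ < _)%E; apply: eq_integral => t _ /=.
  by rewrite ger0_norm// chisq_kernel_ge0.
apply: le_integrable ik; first exact: measurable_posray.
  by apply/measurable_EFinP; exact: measurable_chisq_exp.
move=> t; rewrite posrayE => t0 /=.
rewrite lee_fin normrM ler_piMr// ger0_norm ?expR_ge0// expR_le1 oppr_le0.
by rewrite mulr_ge0// ltW.
Qed.

Lemma integrable_chisq : mu.-integrable posray (EFin \o ker).
Proof.
have := integrable_chisq_exp 0; congr (mu.-integrable _ _).
by apply/funext => t /=; rewrite mul0r oppr0 expR0 mulr1.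
Qed.

Lemma chisq_mass_gt0 : 0 < chisq_mass.
Proof.
have sub : (`[1, 2]%classic : set R) `<=` posray.
  by move=> t /=; rewrite posrayE in_itv /= => /andP[t1 _]; lra.
have iI : mu.-integrable `[1, 2] (EFin \o ker).
  apply: integrableS integrable_chisq => //; exact: measurable_posray.
have : expR (- 1) / 2 <= \int[mu]_(t in `[1, 2]) ker t.
  have -> : expR (-1) / 2 = \int[mu]_(t in `[1, 2]) (expR (- 1) / 2) :> R.
    rewrite Rintegral_cst//= lebesgue_measure_itv /= lte_fin ltr1n /=.
    by ring.
  apply: le_Rintegral => //.
    apply: continuous_compact_integrable; first exact: segment_compact.
    by apply: continuous_subspaceT => x; exact: cvg_cst.
  move=> t; rewrite /= in_itv /= => /andP[t1 t2].
  rewrite /chisq_kernel mulrC; apply: ler_pM; rewrite ?expR_ge0//.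
    have t0 : 0 < t by lra.
    apply: (@le_trans _ _ (t `^ (-1))).
      by rewrite powR_inv1 ?(ltW t0)// lef_pV2 ?posrE.
    apply: ler_powR => //; rewrite lerDr divr_ge0//.
  by rewrite ler_expR; lra.
move=> h; apply: lt_le_trans (_ : \int[mu]_(t in `[1, 2]) ker t <= _).
  by apply: lt_le_trans h; rewrite divr_gt0 ?expR_gt0.
rewrite /chisq_mass /Rintegral; apply: fine_le.
- by apply: integrable_fin_num iI.
- by apply: integrable_fin_num integrable_chisq; exact: measurable_posray.
- apply: ge0_subset_integral => //; first exact: measurable_posray.
  + by apply/measurable_EFinP; exact: measurable_chisq_kernel.
  + by move=> t _; rewrite lee_fin chisq_kernel_ge0.
Qed.

Lemma Rintegral_chisq_exp (k : nat) :
  \int[mu]_(t in posray) (ker t * expR (- (k%:R * t))) = chisq_laplace k * chisq_mass.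
Proof.
have c0 : 0 < 1 + 2 * k%:R :> R by rewrite ltr_pwDl// mulr_ge0.
have E : chisq_mass = (1 + 2 * k%:R) `^ (m.+1%:R / 2) *
    \int[mu]_(t in posray) (ker t * expR (- (k%:R * t))).
  rewrite /chisq_mass /Rintegral (integral_chisq_scale m.+1 k) fineM//.
  by apply: integrable_fin_num (integrable_chisq_exp k); exact: measurable_posray.
by rewrite E /chisq_laplace powRN mulrA mulVf ?mul1r// gt_eqF// powR_gt0.
Qed.

(** The expectation of $p(e^{-X})$ for $X$ chi-square with [m.+1] degrees of freedom. *)
Definition chisq_moment (p : {poly R}) : R := \sum_(i < size p) p`_i * chisq_laplace i.

Lemma chisq_poly_expand (p : {poly R}) (t : R) :
  ker t * p.[expR (- t)] = \sum_(0 <= i < size p) p`_i * (ker t * expR (- (i%:R * t))).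
Proof.
rewrite horner_coef big_mkord mulr_sumr; apply: eq_bigr => i _.
by rewrite -expRM_natl mulrN mulrCA.
Qed.

Lemma Rintegral_chisq_sum (N : nat) (c : nat -> R) :
  mu.-integrable posray (EFin \o (fun t : R => \sum_(0 <= i < N) c i * (ker t * expR (- (i%:R * t))))) /\
  \int[mu]_(t in posray) (\sum_(0 <= i < N) c i * (ker t * expR (- (i%:R * t)))) =
    (\sum_(0 <= i < N) c i * chisq_laplace i) * chisq_mass.
Proof.
elim: N => [|N [IH1 IH2]].
  rewrite big_nil mul0r; split.
    have -> : EFin \o (fun t : R => \sum_(0 <= i < 0) c i * (ker t * expR (- (i%:R * t)))) = cst 0%E.
      by apply/funext => t /=; rewrite big_nil.
    exact: integrable0.
  by under eq_Rintegral do rewrite big_nil; rewrite Rintegral_cst ?mul0r//; exact: measurable_posray.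
have iN : mu.-integrable posray (EFin \o (fun t : R => c N * (ker t * expR (- (N%:R * t))))).
  by apply: (integrableZl _ (c N) (integrable_chisq_exp N)); exact: measurable_posray.
have E : (fun t : R => \sum_(0 <= i < N.+1) c i * (ker t * expR (- (i%:R * t)))) =
  (fun t : R => \sum_(0 <= i < N) c i * (ker t * expR (- (i%:R * t))) + c N * (ker t * expR (- (N%:R * t)))).
  by apply/funext => t; rewrite big_nat_recr.
rewrite E big_nat_recr//=; split.
  by apply: (integrableD _ IH1 iN); exact: measurable_posray.
rewrite (RintegralD _ IH1 iN); last exact: measurable_posray.
rewrite IH2 mulrDl; congr (_ + _).
rewrite (RintegralZl _ _ (integrable_chisq_exp N)); last exact: measurable_posray.
by rewrite Rintegral_chisq_exp mulrA.
Qed.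

Lemma integrable_chisq_poly (p : {poly R}) :
  mu.-integrable posray (EFin \o (fun t : R => ker t * p.[expR (- t)])).
Proof.
have [h _] := Rintegral_chisq_sum (size p) (fun i => p`_i).
move: h; congr (mu.-integrable _ _).
by apply/funext => t /=; rewrite chisq_poly_expand.
Qed.

Lemma Rintegral_chisq_poly (p : {poly R}) :
  \int[mu]_(t in posray) (ker t * p.[expR (- t)]) = chisq_moment p * chisq_mass.
Proof.
have [_ h] := Rintegral_chisq_sum (size p) (fun i => p`_i).
rewrite /chisq_moment -(big_mkord xpredT (fun i => p`_i * chisq_laplace i)) -h.
by apply: eq_Rintegral => t _; rewrite chisq_poly_expand.
Qed.

Lemma chisq_cdfE (x : R) : chisq_cdf m.+1 x = (\int[mu]_(t in `]0, x]) ker t) / chisq_mass.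
Proof. by []. Qed.

Lemma Rintegral_chisq_cut (x : R) : \int[mu]_(t in `]0, x]) ker t =
  \int[mu]_(t in posray) (ker \_ `]-oo, x]) t.
Proof.
rewrite -Rintegral_mkcondr; congr (Rintegral _ _ _).
by rewrite /posray -set_itvI /= /Order.meet /= ; apply/seteqP; split => t /=; rewrite !in_itv /=; lra.
Qed.

Lemma integrable_chisq_cut (x : R) :
  mu.-integrable posray (EFin \o (ker \_ `]-oo, x])).
Proof.
apply: le_integrable integrable_chisq; first exact: measurable_posray.
  apply/measurable_EFinP; apply/measurable_restrict => //.
    exact: measurable_posray.
  exact: measurable_chisq_kernel.
move=> t _ /=; rewrite lee_fin patchE; case: ifP => // _.
by rewrite normr0.
Qed.

Lemma chisq_cut_val (x t : R) : (ker \_ `]-oo, x]) t = ker t * (t <= x)%R%:R.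
Proof.
rewrite patchE (_ : (t \in _) = (t <= x)); first by case: ifP => _; rewrite ?mulr1 ?mulr0.
by rewrite mem_setE in_itv.
Qed.

Lemma chisq_cdf_le_moment (p : {poly R}) (x : R) :
  (forall t, 0 < t -> (t <= x)%R%:R <= p.[expR (- t)]) -> chisq_cdf m.+1 x <= chisq_moment p.
Proof.
move=> h; rewrite chisq_cdfE ler_pdivrMr ?chisq_mass_gt0// -Rintegral_chisq_poly Rintegral_chisq_cut.
apply: le_Rintegral.
- exact: measurable_posray.
- exact: integrable_chisq_cut.
- exact: integrable_chisq_poly.
- move=> t; rewrite posrayE => t0; rewrite chisq_cut_val.
  by apply: ler_wpM2l; [exact: chisq_kernel_ge0|exact: h].
Qed.

Lemma chisq_moment_le_cdf (p : {poly R}) (x : R) :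
  (forall t, 0 < t -> p.[expR (- t)] <= (t <= x)%R%:R) -> chisq_moment p <= chisq_cdf m.+1 x.
Proof.
move=> h; rewrite chisq_cdfE ler_pdivlMr ?chisq_mass_gt0// -Rintegral_chisq_poly Rintegral_chisq_cut.
apply: le_Rintegral.
- exact: measurable_posray.
- exact: integrable_chisq_poly.
- exact: integrable_chisq_cut.
- move=> t; rewrite posrayE => t0; rewrite chisq_cut_val.
  by apply: ler_wpM2l; [exact: chisq_kernel_ge0|exact: h].
Qed.

Lemma chisq_cdf_le0 (x : R) : x <= 0 -> chisq_cdf m.+1 x = 0.
Proof.
move=> x0; rewrite chisq_cdfE; have -> : `]0, x]%classic = set0 :> set R.
  by apply/seteqP; split => // t /=; rewrite in_itv /=; lra.
by rewrite Rintegral_set0 mul0r.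
Qed.

Lemma integrable_chisq_itv (x : R) : mu.-integrable `[0, x] (EFin \o ker).
Proof.
have h : mu.-integrable `]0, x] (EFin \o ker).
  apply: integrableS integrable_chisq => //; first exact: measurable_posray.
  by move=> t /=; rewrite posrayE in_itv /= => /andP[].
apply/integrableP; split; first by apply/measurable_EFinP; exact: measurable_chisq_kernel.
have /integrableP[_] := h; rewrite integral_itv_obnd_cbnd//.
apply/measurable_EFinP; apply: measurableT_comp => //; exact: measurable_chisq_kernel.
Qed.

Lemma chisq_cdf_param (x : R) : chisq_cdf m.+1 x = parameterized_integral mu 0 x ker / chisq_mass.
Proof.
rewrite chisq_cdfE /parameterized_integral Rintegral_itv_obnd_cbnd//.
apply: integrableS (integrable_chisq_itv x) => //.
by apply: subset_itvScc; rewrite bnd_simp.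
Qed.

Lemma chisq_cdf_cvg_right (x : R) : 0 <= x ->
  chisq_cdf m.+1 y @[y --> x^'+] --> (chisq_cdf m.+1 x : R).
Proof.
move=> x0; have x1 : 0 < x + 1 by lra.
have := parameterized_integral_continuous (ltW x1) (integrable_chisq_itv (x + 1)).
move/(continuous_within_itvP _ x1) => [ci cl cr].
have -> : chisq_cdf m.+1 = (fun y => parameterized_integral mu 0 y ker / chisq_mass) :> (R -> R).
  by apply/funext => y; exact: chisq_cdf_param.
apply: cvgM; last exact: cvg_cst.
have [xe|xn] := eqVneq x 0; first by rewrite xe.
apply: cvg_at_right_filter; apply: ci; rewrite in_itv /=; apply/andP; split; last lra.
by rewrite lt_neqAle eq_sym xn.
Qed.

Lemma chisq_cdf_cvg_left (x : R) : 0 < x ->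
  chisq_cdf m.+1 y @[y --> x^'-] --> (chisq_cdf m.+1 x : R).
Proof.
move=> x0; have x1 : 0 < x + 1 by lra.
have := parameterized_integral_continuous (ltW x1) (integrable_chisq_itv (x + 1)).
move/(continuous_within_itvP _ x1) => [ci _ _].
have -> : chisq_cdf m.+1 = (fun y => parameterized_integral mu 0 y ker / chisq_mass) :> (R -> R).
  by apply/funext => y; exact: chisq_cdf_param.
apply: cvgM; last exact: cvg_cst.
apply: cvg_at_left_filter; apply: ci; rewrite in_itv /=; apply/andP; split; lra.
Qed.

Lemma chisq_cdf_right (x e : R) : 0 < e ->
  exists2 x', x < x' & chisq_cdf m.+1 x' <= chisq_cdf m.+1 x + e.
Proof.
move=> e0; have [x0|x0] := leP 0 x; last first.
  by exists (x / 2); [lra|rewrite !chisq_cdf_le0; lra].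
have /cvgrPdist_le/(_ _ e0) H := chisq_cdf_cvg_right x x0.
have [y [xy hy]] : exists y, x < y /\ `|chisq_cdf m.+1 x - chisq_cdf m.+1 y| <= e.
  apply: (@filter_ex _ (x^'+)); near=> y; split.
    by near: y; exact: nbhs_right_gt.
  by near: y.
by exists y => //; move: hy; rewrite ler_norml => /andP[]; lra.
Unshelve. all: by end_near. Qed.

Lemma chisq_cdf_left (x e : R) : 0 < e ->
  exists2 x', x' < x & chisq_cdf m.+1 x - e <= chisq_cdf m.+1 x'.
Proof.
move=> e0; have [x0|x0] := ltP 0 x; last first.
  by exists (x - 1); [lra|rewrite !chisq_cdf_le0; lra].
have /cvgrPdist_le/(_ _ e0) H := chisq_cdf_cvg_left x x0.
have [y [xy hy]] : exists y, y < x /\ `|chisq_cdf m.+1 x - chisq_cdf m.+1 y| <= e.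
  apply: (@filter_ex _ (x^'-)); near=> y; split.
    by near: y; exact: nbhs_left_lt.
  by near: y.
by exists y => //; move: hy; rewrite ler_norml => /andP[]; lra.
Unshelve. all: by end_near. Qed.

End ChiSquareMoments.

(** * From Laplace transforms at integers to distribution functions *)

Section LaplaceToCdf.
Context {R : realType}.

(** With $u=e^{-t}$ the half-line becomes $(0,1]$, and a Lipschitz ramp between $e^{-x'}$ and
    $e^{-x}$ separates the two indicators. Half of [kappa] is the approximation error; adding it
    back makes the polynomial a majorant. *)
Lemma poly_step_approx (x x' kappa : R) : x < x' -> 0 < kappa ->
  exists p : {poly R}, forall t, 0 <= t ->
    (t <= x)%R%:R <= p.[expR (- t)] <= (t <= x')%R%:R + kappa.
Proof.
move=> xx' k0.
pose a := expR (- x'); pose c := expR (- x).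
have ac : a < c by rewrite ltr_expR ltrN2.
have d0 : 0 < c - a by rewrite subr_gt0.
pose f (u : R) := Num.min 1 (Num.max 0 ((u - a) / (c - a))).
have lip (u v : R) : 0 <= u <= 1 -> 0 <= v <= 1 -> `|f u - f v| <= (c - a)^-1 * `|u - v|.
  move=> _ _.
  have -> : (c - a)^-1 * `|u - v| = `|(u - a) / (c - a) - (v - a) / (c - a)|.
    rewrite -mulrBl normrM [ `|(c - a)^-1|]gtr0_norm ?invr_gt0// mulrC; congr (_ * _); congr (`|_|); ring.
  rewrite /f; move: ((u - a) / (c - a)) ((v - a) / (c - a)) => U V.
  have lmax (A B : R) : `|Num.max 0 A - Num.max 0 B| <= `|A - B|.
    have h1 := ler_norm (A - B); have h2 := ler_norm (B - A); rewrite distrC in h2.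
    move: `|A - B| h1 h2 => d h1 h2; rewrite ler_norml.
    by case: (leP 0 A) => hA; case: (leP 0 B) => hB; apply/andP; split; lra.
  have lmin (A B : R) : `|Num.min 1 A - Num.min 1 B| <= `|A - B|.
    have h1 := ler_norm (A - B); have h2 := ler_norm (B - A); rewrite distrC in h2.
    move: `|A - B| h1 h2 => d h1 h2; rewrite ler_norml.
    by case: (leP 1 A) => hA; case: (leP 1 B) => hB; apply/andP; split; lra.
  exact: le_trans (lmin _ _) (lmax _ _).
have ic : 0 <= (c - a)^-1 by rewrite invr_ge0 ltW.
have k2 : 0 < kappa / 2 by rewrite divr_gt0.
have [p hp] := @bernstein_approx R f (c - a)^-1 (kappa / 2) ic k2 lip.
exists (p + (kappa / 2)%:P) => t t0.
have u01 : 0 <= expR (- t) <= 1 by rewrite expR_ge0 expR_le1 oppr_le0.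
have := hp _ u01; rewrite hornerD hornerC ler_norml => /andP[h1 h2].
have f1 : (t <= x)%R%:R <= f (expR (- t)).
  rewrite /f; have [tx|tx] := leP t x; last by rewrite le_min ler01 le_max lexx.
  rewrite le_min lexx /= le_max; apply/orP; right.
  by rewrite ler_pdivlMr// mul1r lerD2r ler_expR lerN2.
have f2 : f (expR (- t)) <= (t <= x')%R%:R.
  rewrite /f; have [tx|tx] := leP t x'; first by rewrite ge_min lexx.
  rewrite ge_min ge_max lexx /=; apply/orP; right.
  by rewrite pmulr_lle0 ?invr_gt0// subr_le0 ler_expR lerN2 ltW.
by apply/andP; split; lra.
Qed.

Lemma chisq_moment_subC m (p : {poly R}) (k : R) :
  chisq_moment m (p - k%:P) = chisq_moment m p - k.
Proof.
have Z0 := @chisq_mass_gt0 R m.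
apply: (mulIf (lt0r_neq0 Z0)); rewrite mulrBl -!Rintegral_chisq_poly.
have iZ : (@lebesgue_measure R).-integrable posray (EFin \o (fun t : R => k * chisq_kernel m.+1 t)).
  by apply: (integrableZl _ k (@integrable_chisq R m)); exact: measurable_posray.
transitivity (\int[lebesgue_measure]_(t in posray)
   (chisq_kernel m.+1 t * p.[expR (- t)] - k * chisq_kernel m.+1 t)).
  by apply: eq_Rintegral => t _; rewrite hornerD hornerN hornerC; ring.
rewrite RintegralB//; [|exact: measurable_posray|exact: integrable_chisq_poly].
congr (_ - _); rewrite RintegralZl//; [exact: measurable_posray|exact: integrable_chisq].
Qed.

Lemma cvg_sumr (I : Type) (r : seq I) (F : I -> nat -> R) (l : I -> R) :
  (forall i, F i @ \oo --> l i) -> (fun n => \sum_(i <- r) F i n) @ \oo --> \sum_(i <- r) l i.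
Proof.
move=> cF; elim: r => [|i r IH].
  have -> : (fun n => \sum_(i <- [::]) F i n) = cst 0 by apply/funext => n; rewrite big_nil.
  by rewrite big_nil; exact: cvg_cst.
have -> : (fun n => \sum_(i <- i :: r) F i n) = (fun n => F i n + \sum_(i <- r) F i n).
  by apply/funext => n; rewrite big_cons.
by rewrite big_cons; apply: cvgD; [exact: cF|exact: IH].
Qed.

(* The indicator of [T <= x] is squeezed between polynomials in [expR (- T)], by Bernstein approximation. *)
Lemma cdf_cvg_of_laplace (m : nat) (Om : nat -> finType)
    (P Q T : forall n, Om n -> R) :
  (forall n a, 0 <= P n a) -> (forall n, \sum_a P n a = 1) ->
  (\forall n \near \oo, forall a, 0 <= Q n a) ->
  (forall k : nat, (fun n => \sum_a P n a * expR (- (k%:R * Q n a))) @ \oo --> (chisq_laplace m k : R)) ->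
  (forall eta : R, 0 < eta -> (fun n => \sum_(a | eta < `|T n a - Q n a|) P n a) @ \oo --> (0 : R)) ->
  forall x : R, (fun n => \sum_(a | T n a <= x) P n a) @ \oo --> (chisq_cdf m.+1 x : R).
Proof.
move=> P0 P1 Q0 lap TQ x.
have Ep (p : {poly R}) : (fun n => \sum_a P n a * p.[expR (- Q n a)]) @ \oo --> chisq_moment m p.
  have -> : (fun n => \sum_a P n a * p.[expR (- Q n a)]) =
     (fun n => \sum_(i < size p) p`_i * \sum_a P n a * expR (- (i%:R * Q n a))).
    apply/funext => n; transitivity (\sum_a \sum_(i < size p) p`_i * (P n a * expR (- (i%:R * Q n a)))).
      apply: eq_bigr => a _; rewrite horner_coef mulr_sumr; apply: eq_bigr => i _.
      by rewrite -expRM_natl mulrN mulrCA.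
    by rewrite exchange_big /=; apply: eq_bigr => i _; rewrite mulr_sumr.
  rewrite /chisq_moment; apply: (@cvg_sumr 'I_(size p)) => i.
  apply: cvgM; first exact: cvg_cst.
  exact: lap.
have shift n (y z : R) : \sum_(a | T n a <= y) P n a <=
    \sum_(a | Q n a <= z) P n a + \sum_(a | (z - y) < `|T n a - Q n a|) P n a.
  rewrite big_mkcond [X in X + _]big_mkcond [X in _ + X]big_mkcond -big_split /=.
  apply: ler_sum => a _; have Pa := P0 n a.
  case: (leP (T n a) y) => Ty; case: (leP (Q n a) z) => Qz; case: ltP => h;
    rewrite ?addr0 ?add0r ?lerDl//; try exact: addr_ge0.
  have : Q n a - T n a <= z - y by apply: le_trans h; rewrite distrC ler_norm.
  by lra.
have shift' n (y z : R) : \sum_(a | Q n a <= z) P n a <=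
    \sum_(a | T n a <= y) P n a + \sum_(a | (y - z) < `|T n a - Q n a|) P n a.
  rewrite big_mkcond [X in X + _]big_mkcond [X in _ + X]big_mkcond -big_split /=.
  apply: ler_sum => a _; have Pa := P0 n a.
  case: (leP (Q n a) z) => Qz; case: (leP (T n a) y) => Ty; case: ltP => h;
    rewrite ?addr0 ?add0r ?lerDl//; try exact: addr_ge0.
  have : T n a - Q n a <= y - z by apply: le_trans h; exact: ler_norm.
  by lra.
apply/cvgrPdist_le => eps eps0.
have e4 : 0 < eps / 4 by rewrite divr_gt0.
have [x' xx' Fx'] := @chisq_cdf_right R m x (eps / 4) e4.
have [x'' xx'' Fx''] := @chisq_cdf_left R m x (eps / 4) e4.
(* Midpoints split each gap: one half absorbs the difference between [T] and [Q], the other carries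
   the ramp. *)
pose z := (x + x') / 2; pose z' := (x'' + x) / 2.
have [p hp] := @poly_step_approx z x' (eps / 4) ltac:(by rewrite /z; lra) e4.
have [p' hp'] := @poly_step_approx x'' z' (eps / 4) ltac:(by rewrite /z'; lra) e4.
have mp : chisq_moment m p <= chisq_cdf m.+1 x' + eps / 4.
  rewrite -lerBlDr -chisq_moment_subC; apply: chisq_moment_le_cdf => t t0.
  by have /andP[_] := hp t (ltW t0); rewrite hornerD hornerN hornerC; lra.
have mp' : chisq_cdf m.+1 x'' <= chisq_moment m p'.
  by apply: chisq_cdf_le_moment => t t0; have /andP[] := hp' t (ltW t0).
have zx : 0 < z - x by rewrite /z; lra.
have zx' : 0 < x - z' by rewrite /z'; lra.
have /cvgrPdist_le/(_ _ e4) E1 := Ep p.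
have /cvgrPdist_le/(_ _ e4) E2 := Ep p'.
have /cvgrPdist_le/(_ _ e4) E3 := TQ _ zx.
have /cvgrPdist_le/(_ _ e4) E4 := TQ _ zx'.
near=> n.
have Qn a : 0 <= Q n a by move: a; near: n.
have e1 : `|chisq_moment m p - \sum_a P n a * p.[expR (- Q n a)]| <= eps / 4 by near: n.
have e2 : `|chisq_moment m p' - \sum_a P n a * p'.[expR (- Q n a)]| <= eps / 4 by near: n.
have e3 : `|0 - \sum_(a | z - x < `|T n a - Q n a|) P n a| <= eps / 4 by near: n.
have e4' : `|0 - \sum_(a | x - z' < `|T n a - Q n a|) P n a| <= eps / 4 by near: n.
have q1 : \sum_(a | Q n a <= z) P n a <= \sum_a P n a * p.[expR (- Q n a)].
  rewrite big_mkcond; apply: ler_sum => a _; have /andP[h _] := hp _ (Qn a).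
  have := ler_wpM2l (P0 n a) h; case: ifP => _; by rewrite ?mulr1 ?mulr0.
have q2 : \sum_a P n a * p'.[expR (- Q n a)] <= \sum_(a | Q n a <= z') P n a + eps / 4.
  have -> : eps / 4 = \sum_a P n a * (eps / 4) by rewrite -mulr_suml P1 mul1r.
  rewrite [X in X + _]big_mkcond -big_split /=.
  apply: ler_sum => a _; have /andP[_ h] := hp' _ (Qn a).
  have := ler_wpM2l (P0 n a) h; rewrite mulrDr; case: ifP => _; by rewrite ?mulr1 ?mulr0.
have s1 := shift n x z; have s2 := shift' n x z'.
move: e1 e2 e3 e4'; rewrite !ler_norml => /andP[? ?] /andP[? ?] /andP[? ?] /andP[? ?].
by apply/andP; split; lra.
Unshelve. all: by end_near. Qed.

End LaplaceToCdf.

Section PairSums.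
Context {R : realType} {n : nat}.

Lemma sum_pairs (F : 'I_n -> 'I_n -> R) :
  \sum_(i < n) \sum_(j < n | j != i) F i j = \sum_(i < n) \sum_(j < n | (i < j)%N) (F i j + F j i).
Proof.
have -> : \sum_(i < n) \sum_(j < n | (i < j)%N) (F i j + F j i) =
   \sum_(i < n) \sum_(j < n | (i < j)%N) F i j + \sum_(i < n) \sum_(j < n | (j < i)%N) F i j.
  rewrite [X in _ + X](exchange_big_dep xpredT)//= -big_split /=; apply: eq_bigr => i _.
  by rewrite -big_split.
rewrite -big_split /=; apply: eq_bigr => i _.
rewrite (bigID (fun j : 'I_n => (i < j)%N)) /=; congr (_ + _); apply: eq_bigl => j.
  by rewrite neq_ltn; case: ltngtP.
by rewrite neq_ltn; case: ltngtP.
Qed.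

End PairSums.

(** * The Bradley-Terry outcome as a product measure *)

Section Model.
Context {R : realType} {n K : nat}.
Variables (k : 'I_n -> 'I_n -> nat) (beta : 'I_n -> R).
Hypothesis k_sym : forall i j, k i j = k j i.
Hypothesis k_bnd : forall i j, i != j -> (1 <= k i j <= K)%N.

(** Coordinates other than increasing pairs get the point mass at 0, so the whole array has a
    product law, and this law gives invalid outcomes weight 0. *)
Definition bt_q (p : 'I_n * 'I_n) (x : 'I_K.+1) : R :=
  if (p.1 < p.2)%N then
    'C(k p.1 p.2, x)%:R * btp (beta p.1) (beta p.2) ^+ x
      * (1 - btp (beta p.1) (beta p.2)) ^+ (k p.1 p.2 - x)
  else (nat_of_ord x == 0%N)%:R.

Lemma k_le (i j : 'I_n) : (i < j)%N -> (k i j <= K)%N.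
Proof.
by move=> h; have /andP[] : (1 <= k i j <= K)%N by apply: k_bnd; rewrite neq_ltn h.
Qed.

Lemma bt_q_ge0 p x : 0 <= bt_q p x.
Proof.
rewrite /bt_q; case: ifP => // _.
have h1 : 0 < btp (beta p.1) (beta p.2) := sig_gt0 _.
have h2 : btp (beta p.1) (beta p.2) < 1 := sig_lt1 _.
by rewrite !mulr_ge0 ?exprn_ge0 ?subr_ge0 ?(ltW h1) ?(ltW h2).
Qed.

Lemma bt_q_exp (p : 'I_n * 'I_n) (f : nat -> R) : (p.1 < p.2)%N ->
  \sum_x bt_q p x * f x = binom_exp (k p.1 p.2) (sig (beta p.1 - beta p.2)) f.
Proof.
move=> lt12; rewrite -(@binom_exp_widen R K _ _ _ (k_le _ _ lt12)).
by apply: eq_bigr => x _; rewrite /bt_q lt12.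
Qed.

Lemma bt_q_sum1 p : \sum_x bt_q p x = 1.
Proof.
have [lt12|ge12] := boolP (p.1 < p.2)%N.
  have := bt_q_exp p (fun=> 1) lt12; rewrite binom_exp_cst => <-.
  by apply: eq_bigr => x _; rewrite mulr1.
rewrite (bigD1 ord0)//= /bt_q (negbTE ge12) eqxx big1 ?addr0// => x.
by rewrite -val_eqE /= => /negbTE ->.
Qed.

Lemma bt_probE (a : outcome n K) : bt_prob k beta a = pweight bt_q a.
Proof.
have prodE : pweight bt_q a = \prod_(i < n) \prod_(j < n) bt_q (i, j) (a (i, j)).
  by rewrite /pweight pair_big; apply: eq_bigr => -[i j] _.
rewrite /bt_prob prodE; case: ifPn => [val|].
  apply: eq_bigr => i _; rewrite [RHS](bigID (fun j : 'I_n => (i < j)%N)) /=.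
  rewrite [X in _ * X]big1 ?mulr1 => [|j /negbTE nij].
    by apply: eq_bigr => j ij; rewrite /bt_q /= ij.
  rewrite /bt_q /= nij; move: val => /forallP/(_ i)/forallP/(_ j); rewrite nij => ->.
  by [].
move=> /forallPn[i /forallPn[j nv]].
rewrite (bigD1 i)//= (bigD1 j)//=; suff -> : bt_q (i, j) (a (i, j)) = 0 by rewrite !mul0r.
move: nv; rewrite /bt_q /=; case: ifP => _; last by move/negbTE => ->.
by rewrite -ltnNge => h; rewrite bin_small// !mul0r.
Qed.

Lemma pweight_valid (a : outcome n K) : pweight bt_q a != 0 -> valid_outcome k a.
Proof. by rewrite -bt_probE /bt_prob; case: ifP => //; rewrite eqxx. Qed.

Definition kap (i j : 'I_n) : R := if i == j then 0 else (k i j)%:R.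

Lemma kap_sym i j : kap i j = kap j i.
Proof. by rewrite /kap eq_sym k_sym. Qed.

Lemma kap_ge0 i j : 0 <= kap i j.
Proof. by rewrite /kap; case: ifP. Qed.

Lemma kap_ge1 i j : i != j -> 1 <= kap i j.
Proof. by move=> ij; rewrite /kap (negbTE ij) ler1n; case/andP: (k_bnd _ _ ij). Qed.

Lemma kap_leK i j : kap i j <= K%:R.
Proof. by rewrite /kap; case: eqVneq => // ij; rewrite ler_nat; case/andP: (k_bnd _ _ ij). Qed.

Lemma sum_kap (i : 'I_n) (F : 'I_n -> R) : \sum_j kap i j * F j = \sum_(j | j != i) (k i j)%:R * F j.
Proof.
rewrite [RHS]big_mkcond; apply: eq_bigr => j _; rewrite /kap eq_sym.
by case: ifP => _ //=; rewrite mul0r.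
Qed.

(* The score [dscore] recentred by half the number of comparisons, to match the even [Hl]. *)
Definition esc (a : outcome n K) (i : 'I_n) : R := (dscore k a i)%:R - 1 / 2 * \sum_j kap i j * 1.

Lemma ln_expD (x y : R) : ln (expR x + expR y) = (x + y) / 2 + Hl (x - y).
Proof.
have -> : expR x + expR y = expR y * (1 + expR (x - y)).
  by rewrite mulrDr mulr1 -expRD subrKC addrC.
by rewrite lnM ?posrE ?expR_gt0 ?expR1D_gt0// expRK /Hl; field.
Qed.

Lemma ell_btE (a : outcome n K) (g : 'I_n -> R) : ell_bt k a g = lik kap (esc a) g.
Proof.
rewrite /ell_bt /lik.
have -> : \sum_(i < n) \sum_(j < n | (i < j)%N) (k i j)%:R * ln (expR (g i) + expR (g j)) =
   1 / 2 * \sum_i \sum_j kap i j * ln (expR (g i) + expR (g j)).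
  under [in RHS]eq_bigr do rewrite sum_kap.
  rewrite sum_pairs mulr_sumr; apply: eq_bigr => i _; rewrite mulr_sumr; apply: eq_bigr => j _.
  by rewrite (k_sym j i) [expR (g j) + _]addrC; field.
have -> : \sum_i \sum_j kap i j * ln (expR (g i) + expR (g j)) =
  \sum_i \sum_j kap i j * g i + \sum_i \sum_j kap i j * Hl (g i - g j).
  have -> : \sum_i \sum_j kap i j * ln (expR (g i) + expR (g j)) =
     \sum_i \sum_j kap i j * (g i / 2) + \sum_i \sum_j kap i j * (g j / 2)
     + \sum_i \sum_j kap i j * Hl (g i - g j).
    rewrite -!big_split /=; apply: eq_bigr => i _; rewrite -!big_split /=; apply: eq_bigr => j _.
    by rewrite ln_expD; field.
  congr (_ + _); rewrite [X in _ + X]exchange_big /= -big_split /=; apply: eq_bigr => i _.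
  rewrite -big_split /=; by apply: eq_bigr => j _; rewrite (kap_sym j i); field.
rewrite mulrDr opprD addrA; congr (_ - _).
rewrite mulr_sumr -sumrB; apply: eq_bigr => i _; rewrite /esc mulrBl mulrC; congr (_ - _).
by rewrite -[RHS]mulrA; congr (_ * _); rewrite mulr_suml; apply: eq_bigr => j _; rewrite mulr1.
Qed.

(** The centred result of [i] against [j] in either orientation, antisymmetric for distinct items on
    valid outcomes; [xi0] is its version for the stored coordinate. *)
Definition ctr (a : outcome n K) (i j : 'I_n) : R :=
  (aij k a i j)%:R - (k i j)%:R * sig (beta i - beta j).

Definition xi0 (p : 'I_n * 'I_n) (x : 'I_K.+1) : R :=
  if (p.1 < p.2)%N then (nat_of_ord x)%:R - (k p.1 p.2)%:R * sig (beta p.1 - beta p.2) else 0.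

Lemma ctr_lt a (i j : 'I_n) : (i < j)%N -> ctr a i j = xi0 (i, j) (a (i, j)).
Proof. by move=> ij; rewrite /ctr /xi0 /aij /= ij. Qed.

Lemma ctr_gt a (i j : 'I_n) : valid_outcome k a -> (j < i)%N -> ctr a i j = - xi0 (j, i) (a (j, i)).
Proof.
move=> val ji; rewrite /ctr /xi0 /aij /= ji ltnNge (ltnW ji) /=.
have := val => /forallP/(_ j)/forallP/(_ i); rewrite ji => h.
by rewrite (k_sym i j) natrB// -[beta i - beta j]opprB sigN; ring.
Qed.

Lemma score_ctr a i : score kap (esc a) beta i = \sum_(j | j != i) ctr a i j.
Proof.
rewrite /score /esc.
have -> : (dscore k a i)%:R - 1 / 2 * (\sum_j kap i j * 1)
   - \sum_j kap i j * (sig (beta i - beta j) - 1 / 2) =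
   (dscore k a i)%:R - \sum_j kap i j * sig (beta i - beta j).
  rewrite -addrA -opprD mulr_sumr -big_split /=; congr (_ - _); apply: eq_bigr => j _.
  by field.
by rewrite sum_kap /dscore natr_sum -sumrB.
Qed.

Lemma esc_sum0 a : valid_outcome k a -> \sum_i esc a i = 0.
Proof.
move=> val; rewrite /esc sumrB -mulr_sumr.
have -> : \sum_i (dscore k a i)%:R = \sum_(i < n) \sum_(j < n | (i < j)%N) (k i j)%:R :> R.
  rewrite (eq_bigr (fun i => \sum_(j | j != i) (aij k a i j)%:R)) => [|i _]; last by rewrite /dscore natr_sum.
  rewrite sum_pairs; apply: eq_bigr => i _; apply: eq_bigr => j ij.
  have := val => /forallP/(_ i)/forallP/(_ j); rewrite ij => h.
  by rewrite /aij ij ltnNge (ltnW ij) /= (k_sym j i) -natrD subnKC.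
under [X in _ - _ * X]eq_bigr do rewrite sum_kap.
rewrite sum_pairs mulr_sumr -sumrB big1// => i _; rewrite mulr_sumr -sumrB big1// => j _.
by rewrite (k_sym j i); field.
Qed.

(** Each comparison enters the scores of its two items with opposite signs, so any linear
    combination of scores is a sum of independent terms, as Hoeffding's inequality requires. *)
Lemma linear_score a (c : 'I_n -> R) : valid_outcome k a ->
  \sum_i c i * score kap (esc a) beta i = \sum_p (c p.1 - c p.2) * xi0 p (a p).
Proof.
move=> val.
rewrite (eq_bigr (fun i => \sum_(j | j != i) c i * ctr a i j)) => [|i _]; last by rewrite score_ctr mulr_sumr.
have -> : \sum_p (c p.1 - c p.2) * xi0 p (a p) =
  \sum_i \sum_j (c i - c j) * xi0 (i, j) (a (i, j)).
  by rewrite pair_bigA; apply: eq_bigr => -[i j] _.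
rewrite sum_pairs.
apply: eq_bigr => i _; rewrite big_mkcond; apply: eq_bigr => j _; case: ifPn => [ij|nij].
  by rewrite ctr_lt// ctr_gt//; ring.
by rewrite /xi0 /= (negbTE nij) mulr0.
Qed.

Lemma xi0_mean0 p : \sum_x bt_q p x * xi0 p x = 0.
Proof.
have [lt12|ge12] := boolP (p.1 < p.2)%N.
  have := bt_q_exp p (fun x => x%:R - (k p.1 p.2)%:R * sig (beta p.1 - beta p.2)) lt12.
  by rewrite binom_exp_center => h; rewrite -[RHS]h; apply: eq_bigr => x _; rewrite /xi0 lt12.
by rewrite big1// => x _; rewrite /xi0 (negbTE ge12) mulr0.
Qed.

Lemma xi0_var (p : 'I_n * 'I_n) : (p.1 < p.2)%N -> \sum_x bt_q p x * xi0 p x ^+ 2 = vmat kap beta p.1 p.2.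
Proof.
move=> lt12.
have := bt_q_exp p (fun x => (x%:R - (k p.1 p.2)%:R * sig (beta p.1 - beta p.2)) ^+ 2) lt12.
rewrite binom_exp_var /vmat /kap /wt -val_eqE /= ltn_eqF// mulrA => <-.
by apply: eq_bigr => x _; rewrite /xi0 lt12.
Qed.

Lemma xi0_le p x : `|xi0 p x| <= K%:R.
Proof.
rewrite /xi0; case: ifP => [lt12|_]; last by rewrite normr0.
have xK : (nat_of_ord x)%:R <= K%:R :> R by rewrite ler_nat -ltnS.
have kK : (k p.1 p.2)%:R <= K%:R :> R by rewrite ler_nat k_le.
have s0 := sig_gt0 (beta p.1 - beta p.2); have s1 := sig_lt1 (beta p.1 - beta p.2).
have x0 : 0 <= (nat_of_ord x)%:R :> R by [].
have k0 : 0 <= (k p.1 p.2)%:R :> R by [].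
have h1 : (k p.1 p.2)%:R * sig (beta p.1 - beta p.2) <= K%:R :> R by nra.
have h2 : 0 <= (k p.1 p.2)%:R * sig (beta p.1 - beta p.2) :> R by rewrite mulr_ge0// ltW.
by rewrite ler_norml; apply/andP; split; lra.
Qed.

Lemma linear_score_tail (c : 'I_n -> R) (V t : R) :
  \sum_(p : 'I_n * 'I_n) ((c p.1 - c p.2) * K%:R) ^+ 2 <= V -> 0 < V -> 0 < t ->
  pprob bt_q (fun a => t < `|\sum_i c i * score kap (esc a) beta i|)
  <= 2 * expR (- (t ^+ 2 / (16 * V))).
Proof.
move=> cV V0 t0.
apply: (@le_trans _ _ (pprob bt_q (fun a => t < `|\sum_p (c p.1 - c p.2) * xi0 p (a p)|))).
  by apply: pprob_le => [p x|a /pweight_valid val]; [exact: bt_q_ge0|rewrite linear_score].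
apply: (@pprob_hoeffding R _ _ bt_q bt_q_ge0 bt_q_sum1 (fun p x => (c p.1 - c p.2) * xi0 p x)
  (fun p => `|(c p.1 - c p.2) * K%:R|)) => //.
- move=> p; under eq_bigr do rewrite mulrCA.
  by rewrite -mulr_sumr xi0_mean0 mulr0.
- move=> p x _; rewrite !normrM; apply: ler_wpM2l => //.
  by rewrite [leRHS]ger0_norm// xi0_le.
- by apply: le_trans cV; rewrite le_eqVlt; apply/orP; left; apply/eqP; apply: eq_bigr => p _; rewrite -normrX ger0_norm ?sqr_ge0.
Qed.

Lemma ctr_le a i j : valid_outcome k a -> i != j -> `|ctr a i j| <= K%:R.
Proof.
move=> val; rewrite neq_ltn => /orP[ij|ji]; first by rewrite ctr_lt// xi0_le.
by rewrite ctr_gt// normrN xi0_le.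
Qed.

(** * Laplace transform of the block quadratic form *)

Section BlockCLT.
Variables (B : pred 'I_n) (M A : R).
Local Notation v := (vmat kap beta).
Local Notation vd := (vdeg kap beta B).
Hypothesis vd_gt0 : forall i, 0 < vd i.
Hypothesis M_ge : forall i, K%:R <= M * Num.sqrt (vd i).
Hypotheses (M_le1 : M <= 1) (A_ge1 : 1 <= A) (AM : 4 * A * M ^+ 2 <= 1).
Variable ib : 'I_n.
Hypothesis B_ib : B ib.

Let sd i : R := Num.sqrt (vd i).
Let sd_gt0 i : 0 < sd i. Proof. by rewrite sqrtr_gt0. Qed.
Let sd_sqr i : sd i ^+ 2 = vd i. Proof. by rewrite sqr_sqrtr// ltW. Qed.
Let V := \sum_(i | B i) vd i.
Let V_gt0 : 0 < V.
Proof.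
by rewrite /V (bigD1 ib)//= ltr_pwDl// sumr_ge0// => i _; rewrite ltW.
Qed.

Definition pairc (i j : 'I_n) : 'I_n * 'I_n := if (i < j)%N then (i, j) else (j, i).
(** The comparisons of [i] with outer items. For distinct [i] in the block these lists are disjoint,
    which is the independence of the [Dblk]. *)
Definition blk (i : 'I_n) : seq ('I_n * 'I_n) := [seq pairc i j | j <- enum 'I_n & ~~ B j].
Definition Dblk (a : outcome n K) (i : 'I_n) : R := \sum_(j | ~~ B j) ctr a i j.

(** Contribution of a comparison to the standardized score of its block item, with the sign of the
    stored orientation; comparisons that do not join the block to its complement get 0. *)
Let xiL (p : 'I_n * 'I_n) (x : 'I_K.+1) : R :=
  if B p.1 && ~~ B p.2 then xi0 p x / sd p.1
  else if ~~ B p.1 && B p.2 then - xi0 p x / sd p.2 else 0.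

Let big_blk i (F : 'I_n * 'I_n -> R) : \sum_(p <- blk i) F p = \sum_(j | ~~ B j) F (pairc i j).
Proof. by rewrite /blk big_map big_filter big_enum_cond; apply: eq_bigl => j. Qed.

Let xiL_ctr a i j : valid_outcome k a -> B i -> ~~ B j ->
  xiL (pairc i j) (a (pairc i j)) = ctr a i j / sd i.
Proof.
move=> val Bi nBj; rewrite /pairc; case: ifPn => ij; rewrite /xiL /=.
  by rewrite Bi nBj /= ctr_lt.
have ji : (j < i)%N.
  by rewrite ltn_neqAle leqNgt ij andbT; apply: contra nBj => /eqP/val_inj ->.
by rewrite Bi (negbTE nBj) /= ctr_gt.
Qed.

Let blk_sum a i : valid_outcome k a -> B i -> \sum_(p <- blk i) xiL p (a p) = Dblk a i / sd i.
Proof.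
by move=> val Bi; rewrite big_blk /Dblk mulr_suml; apply: eq_bigr => j nBj; rewrite xiL_ctr.
Qed.

Let xiL_mean0 p : \sum_x bt_q p x * xiL p x = 0.
Proof.
rewrite /xiL; case: (B p.1 && ~~ B p.2); [|case: (~~ B p.1 && B p.2)]; last by rewrite big1// => x _; rewrite mulr0.
  by under eq_bigr do rewrite mulrA; rewrite -mulr_suml xi0_mean0 mul0r.
under eq_bigr do rewrite mulNr mulrN mulrA.
by rewrite sumrN -mulr_suml xi0_mean0 mul0r oppr0.
Qed.

Let xiL_le p x : `|xiL p x| <= M.
Proof.
have M0 : 0 <= M.
  have h := M_ge ib; rewrite -(pmulr_lge0 _ (sd_gt0 ib)); exact: le_trans h.
have key i : `|xi0 p x| / sd i <= M.
  by rewrite ler_pdivrMr//; apply: le_trans (M_ge i); exact: xi0_le.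
rewrite /xiL; case: ifP => _; [|case: ifP => _]; last by rewrite normr0.
  by rewrite normrM [ `|_^-1|]gtr0_norm ?invr_gt0.
by rewrite mulNr normrN normrM [ `|_^-1|]gtr0_norm ?invr_gt0.
Qed.

Let vmat_sym i j : v i j = v j i.
Proof. by rewrite /vmat kap_sym -[beta i - beta j]opprB wtN. Qed.

Let xiL_var i j : B i -> ~~ B j ->
  \sum_x bt_q (pairc i j) x * xiL (pairc i j) x ^+ 2 = v i j / vd i.
Proof.
move=> Bi nBj; rewrite /pairc; case: ifPn => ij; rewrite /xiL /=.
  rewrite Bi nBj /= -(xi0_var (i, j) ij) mulr_suml; apply: eq_bigr => x _.
  by rewrite exprMn exprVn sd_sqr mulrA.
have ji : (j < i)%N.
  by rewrite ltn_neqAle leqNgt ij andbT; apply: contra nBj => /eqP/val_inj ->.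
rewrite Bi (negbTE nBj) /= vmat_sym -(xi0_var (j, i) ji) mulr_suml; apply: eq_bigr => x _.
by rewrite exprMn exprVn sd_sqr sqrrN mulrA.
Qed.

Let blk_var i : B i -> \sum_(p <- blk i) \sum_x bt_q p x * xiL p x ^+ 2 = 1.
Proof.
move=> Bi; rewrite big_blk (eq_bigr (fun j => v i j / vd i)) => [|j nBj]; last exact: xiL_var.
by rewrite -mulr_suml -/(vd i) divff// gt_eqF// vd_gt0.
Qed.

Let pairc_inj i i' j j' : B i -> B i' -> ~~ B j -> ~~ B j' ->
  pairc i j = pairc i' j' -> i = i' /\ j = j'.
Proof.
move=> Bi Bi' nBj nBj'; rewrite /pairc; case: ifP => _; case: ifP => _ [e1 e2] //.
- by rewrite -e1 Bi in nBj'.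
- by rewrite -e2 Bi in nBj'.
Qed.

Let uniq_blk i : B i -> uniq (blk i).
Proof.
move=> Bi; rewrite map_inj_in_uniq; first by apply: filter_uniq; exact: enum_uniq.
move=> j j'.
by rewrite !mem_filter => /andP[nj _] /andP[nj' _] /(pairc_inj _ _ _ _ Bi Bi nj nj')[].
Qed.

Let disj_blk i i' p : B i -> B i' -> p \in blk i -> p \in blk i' -> i = i'.
Proof.
move=> Bi Bi' /mapP[j]; rewrite mem_filter => /andP[nj _] -> /mapP[j'].
by rewrite mem_filter => /andP[nj' _] /(pairc_inj _ _ _ _ Bi Bi' nj nj')[].
Qed.

(** Squared length minus squared projection on the unit vector with entries $\sqrt{v_i/V}$, the form
    that [laplace_projection] handles. *)
Lemma block_quad_std (D : 'I_n -> R) : block_quad kap beta B D =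
  \sum_(i <- enum B) (D i / sd i) ^+ 2 - (\sum_(i <- enum B) sd i / Num.sqrt V * (D i / sd i)) ^+ 2.
Proof.
rewrite /block_quad -!big_enum /= -/V.
have e1 : \sum_(i <- enum B) (D i / sd i) ^+ 2 = \sum_(i <- enum B) D i ^+ 2 / vd i.
  by apply: eq_bigr => i _; rewrite exprMn exprVn sd_sqr.
have e2 : \sum_(i <- enum B) sd i / Num.sqrt V * (D i / sd i) = (\sum_(i <- enum B) D i) / Num.sqrt V.
  by rewrite mulr_suml; apply: eq_bigr => i _; field; rewrite !gt_eqF// sqrtr_gt0.
have VE : \sum_(i <- enum B) vd i = V by rewrite big_enum.
by rewrite VE e1 e2 exprMn exprVn sqr_sqrtr ?(ltW V_gt0).
Qed.

Let u_sum1 : \sum_(i <- enum B) (sd i / Num.sqrt V) ^+ 2 = 1.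
Proof.
rewrite (eq_bigr (fun i => vd i / V)) => [|i _]; last first.
  by rewrite exprMn exprVn sd_sqr sqr_sqrtr ?(ltW V_gt0).
by rewrite -mulr_suml big_enum /= -/V divff// gt_eqF.
Qed.

Lemma block_quad_ge0 (D : 'I_n -> R) : 0 <= block_quad kap beta B D.
Proof.
rewrite block_quad_std subr_ge0.
apply: (le_trans (@cauchy_schwarz_seq R _ _ _ _)).
by rewrite u_sum1 mul1r.
Qed.

(** [laplace_projection] with $c=k=l$ and a unit vector: the rank-one factor is
    $1-2l/(1+2l)=(1+2l)^{-1}$, which cancels one of the [#|B|] factors. This is the lost degree of
    freedom. *)
Lemma block_laplace (l : R) : 0 <= l <= A ->
  `|pexp bt_q (fun a => expR (- (l * block_quad kap beta B (Dblk a))))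
    - expR (- ((#|B|%:R - 1) * ln (1 + 2 * l)) / 2)| <= #|B|%:R * (lindeberg_cst A * M).
Proof.
move=> l0A; have /andP[l0 lA] := l0A.
have M0 : 0 <= M by exact: le_trans (xiL_le (ib, ib) ord0).
have mB i : (i \in enum B) = B i by rewrite mem_enum.
have := @laplace_projection R _ _ bt_q bt_q_ge0 bt_q_sum1 xiL M A xiL_mean0 (fun p x _ => xiL_le p x)
  M0 M_le1 A_ge1 AM _ blk (fun i => sd i / Num.sqrt V) l (enum B) l l0A (enum_uniq _).
rewrite u_sum1 mulr1 => H.
have {}H := H (fun i Bi => uniq_blk i (etrans (esym (mB i)) Bi))
  (fun i i' p Bi Bi' => disj_blk i i' p (etrans (esym (mB i)) Bi) (etrans (esym (mB i')) Bi'))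
  (fun i Bi => blk_var i (etrans (esym (mB i)) Bi)) l0 (lexx _).
move: H; rewrite -cardE.
have -> : pexp bt_q (fun a => expR (- (l * \sum_(b <- enum B) (\sum_(i <- blk b) xiL i (a i)) ^+ 2) +
     l * (\sum_(b <- enum B) sd b / Num.sqrt V * \sum_(i <- blk b) xiL i (a i)) ^+ 2)) =
   pexp bt_q (fun a => expR (- (l * block_quad kap beta B (Dblk a)))).
  apply: eq_bigr => a _; have [->|/pweight_valid val] := eqVneq (pweight bt_q a) 0.
    by rewrite !mul0r.
  congr (_ * expR _); rewrite block_quad_std.
  have e1 : \sum_(b <- enum B) (\sum_(i <- blk b) xiL i (a i)) ^+ 2 = \sum_(i <- enum B) (Dblk a i / sd i) ^+ 2.
    by apply: eq_big_seq => i; rewrite mB => Bi; rewrite blk_sum.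
  have e2 : \sum_(b <- enum B) sd b / Num.sqrt V * \sum_(i <- blk b) xiL i (a i) =
     \sum_(i <- enum B) sd i / Num.sqrt V * (Dblk a i / sd i).
    by apply: eq_big_seq => i; rewrite mB => Bi; rewrite blk_sum.
  by rewrite e1 e2; ring.
rewrite mulr1.
have -> // : - (#|B|%:R * ln (1 + 2 * l) + ln (1 - 2 * l / (1 + 2 * l))) / 2 = - ((#|B|%:R - 1) * ln (1 + 2 * l)) / 2 :> R.
have l1 : 0 < 1 + 2 * l by lra.
have -> : 1 - 2 * l / (1 + 2 * l) = (1 + 2 * l)^-1 by field; rewrite gt_eqF.
by rewrite lnV ?posrE//; ring.
Qed.

(** The difference consists of the comparisons inside the block, at most [#|B|] terms bounded by
    [K]. *)
Lemma Dblk_score a i : valid_outcome k a -> B i ->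
  `|Dblk a i - score kap (esc a) beta i| <= #|B|%:R * K%:R.
Proof.
move=> val Bi; rewrite score_ctr.
have -> : Dblk a i - \sum_(j | j != i) ctr a i j = - \sum_(j | (j != i) && B j) ctr a i j.
  have -> : Dblk a i = \sum_(j | (j != i) && ~~ B j) ctr a i j.
    by apply: eq_bigl => j; case: eqVneq => // ->; rewrite Bi.
  by rewrite [X in _ - X](bigID B) /= opprD addrCA subrr addr0.
rewrite normrN; apply: norm_sum_le_card => [j /andP[ji _]||] //.
  by rewrite ctr_le// eq_sym.
by rewrite ler_nat; apply/subset_leq_card/fintype.subsetP => j; rewrite !unfold_in => /andP[].
Qed.

End BlockCLT.

End Model.

(** * The null block and bounds at fixed n *)

(** Index 0 is the reference item with parameter 0 and is left out, so the block has [r.-1]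
    elements. *)
Definition eqblock (r n : nat) : pred 'I_n := fun i => (0 < i < r)%N.

Lemma card_eqblock r n : (r <= n)%N -> #|eqblock r n| = r.-1.
Proof.
move=> rn; rewrite -sum1_card -(big_mkord (fun i => (0 < i < r)%N) (fun=> 1%N)).
rewrite -subn1 -[RHS]muln1 -sum_nat_const_nat (big_nat_widen 1 r n)// (big_nat_widenl 1 0)//.
by apply: eq_bigl => i; rewrite andbC.
Qed.

Lemma card_eqblockC r n : (2 * r <= n)%N -> (n <= 2 * #|predC (eqblock r n)|)%N.
Proof.
rewrite !mul2n -!addnn => rn; have rn' : (r <= n)%N := leq_trans (leq_addl _ _) rn.
have := cardC (eqblock r n); rewrite card_ord card_eqblock// => nE.
rewrite -[leqLHS]nE leq_add2r -(leq_add2l r.-1) nE; apply: leq_trans rn.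
by rewrite leq_add ?leq_pred.
Qed.

Section Finite.
Context {R : realType} {n K : nat}.
Variables (r : nat) (k : 'I_n -> 'I_n -> nat) (beta : 'I_n -> R).
Hypothesis r_gt2 : (2 < r)%N.
Hypothesis k_sym : forall i j, k i j = k j i.
Hypothesis k_bnd : forall i j, i != j -> (1 <= k i j <= K)%N.
Hypothesis beta0 : forall i : 'I_n, nat_of_ord i = 0%N -> beta i = 0.
Local Notation B := (eqblock r n).
Hypothesis beta_B : forall i j, B i -> B j -> beta i = beta j.
Hypothesis n_ge : (2 * r <= n)%N.
Variables (C b y L : R).
Hypotheses (C_ge8 : 8 <= C) (K_le : K%:R <= C) (r_le : r%:R <= C).
Hypothesis b_ge1 : 1 <= b.
Hypothesis kap_wt : forall i j, i != j -> 1 <= b * (kap k i j * wt (beta i - beta j)).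
Hypotheses (L_ge1 : 1 <= L) (ny2 : n%:R * y ^+ 2 = C ^+ 4 * L) (y_gt0 : 0 < y).
Hypotheses (b3y : b ^+ 3 * y <= 1) (Cby : 16 * C * b * y < 1).

Let n_gt1 : (1 < n)%N. Proof. exact: (leq_trans (ltnW r_gt2) (leq_trans (leq_pmull r (isT : (0 < 2)%N)) n_ge)). Qed.
Let o : 'I_n := Ordinal (ltnW n_gt1).
Let ib : 'I_n := Ordinal n_gt1.
Let B_ib : B ib. Proof. by rewrite /eqblock /= (ltnW r_gt2). Qed.
Let nB_o : ~~ B o. Proof. by []. Qed.
Let n_gt0 : 0 < n%:R :> R. Proof. by rewrite ltr0n ltnW. Qed.
Let card_B_le : #|B|%:R <= C.
Proof.
by apply: le_trans r_le; rewrite ler_nat card_eqblock ?leq_pred// (leq_trans _ n_ge)// leq_pmull.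
Qed.
Let card_nB : n%:R <= 2 * #|predC B|%:R :> R.
Proof.
by rewrite -natrM ler_nat card_eqblockC.
Qed.
Let n_ge4 : 4 <= n%:R :> R. Proof. by rewrite ler_nat (leq_trans _ n_ge)// (leq_mul2l 2 2) ltnW. Qed.
Let C_ge1 : 1 <= C. Proof. by have := C_ge8; lra. Qed.
Let kap_leC i j : kap k i j <= C. Proof. exact: le_trans (kap_leK _ k_bnd _ _) K_le. Qed.

Local Notation sc a := (score (kap k) (esc k a) beta).
Local Notation v := (vmat (kap k) beta).
Local Notation vd := (vdeg (kap k) beta B).

Let vd_gt0 i : 0 < vd i.
Proof. exact: (vdeg_gt0 _ (kap_ge0 k) _ _ _ b_ge1 kap_wt card_nB n_ge4). Qed.

(* [y] stands for C^2 (L / n)^(1/2) with L = log n. *)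
Definition good_outcome (a : outcome n K) : bool :=
  [forall i, `|sc a i| <= n%:R * y] &&
  [forall i, `|\sum_(j | ~~ B j) v i j * (sc a j / vd j)| <= b * n%:R * y ^+ 2].

Let tail_le (x : R) : 2 * L <= x -> 2 * expR (- x) <= 2 * expR (- (2 * L)).
Proof. by move=> h; rewrite ler_wpM2l// ler_expR lerN2. Qed.

Let score_tail i : pprob (bt_q k beta) (fun a : outcome n K => n%:R * y < `|sc a i|) <= 2 * expR (- (2 * L)).
Proof.
pose c (j : 'I_n) : R := (j == i)%:R.
have cE (a : outcome n K) : \sum_j c j * sc a j = sc a i.
  by rewrite (bigD1 i)//= /c eqxx mul1r big1 ?addr0// => j /negbTE ->; rewrite mul0r.
have C0 : 0 < C by have := C_ge1; lra.
(* Only ordered pairs containing [i] count, at most $2n$ of them, each with squared range at most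
   $C^2$. *)
have V0 : 0 < 2 * n%:R * C ^+ 2 by rewrite !mulr_gt0 ?exprn_gt0.
have := linear_score_tail k beta k_sym k_bnd c (2 * n%:R * C ^+ 2) (n%:R * y) _ V0 (mulr_gt0 n_gt0 y_gt0).
move=> h; apply: (le_trans (pprob_le _ (bt_q_ge0 k beta) _ (fun a => n%:R * y < `|\sum_j c j * sc a j|) _)).
  by move=> a _; rewrite cE.
apply: (le_trans (h _)).
  apply: (@le_trans _ _ (\sum_(p : 'I_n * 'I_n) (c p.1 + c p.2) * C ^+ 2)).
    apply: ler_sum => p _; rewrite exprMn; apply: ler_pM; rewrite ?sqr_ge0//.
      by rewrite /c; do 2!case: (_ == _); rewrite /=; lra.
    by rewrite lerXn2r ?nnegrE ?(ltW C0).
  have c1 : \sum_j c j = 1.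
    by rewrite (bigD1 i)//= /c eqxx big1 ?addr0// => l /negbTE ->.
  have -> : \sum_(p : 'I_n * 'I_n) (c p.1 + c p.2) * C ^+ 2 =
     \sum_(j < n) \sum_(l < n) (c j + c l) * C ^+ 2 by rewrite pair_bigA.
  under eq_bigr do rewrite -mulr_suml big_split /= c1 sumr_const card_ord -mulr_natr.
  rewrite -mulr_suml big_split /= -mulr_suml c1 sumr_const card_ord mul1r.
  by rewrite ler_wpM2r ?sqr_ge0//; lra.
(* With $ny^2=C^4L$ the exponent is $C^2L/32$, which $C\ge 8$ makes at least $2L$. *)
apply: tail_le; rewrite ler_pdivlMr ?mulr_gt0//.
have := ny2; set N := n%:R; move=> ny.
have -> : (N * y) ^+ 2 = N * (C ^+ 4 * L) by rewrite -ny; ring.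
have -> : 2 * L * (16 * (2 * N * C ^+ 2)) = 64 * (N * C ^+ 2 * L) by ring.
have -> : N * (C ^+ 4 * L) = C ^+ 2 * (N * C ^+ 2 * L) by ring.
apply: ler_wpM2r; first by rewrite !mulr_ge0 ?sqr_ge0// ?(ltW n_gt0)//; have := L_ge1; lra.
by have := C_ge8; nra.
Qed.

(** The scores carry coefficients at most $4Cb/n$, so the variance proxy $16C^4b^2$ does not contain
    $n$. Cancellation thus makes this average smaller by a factor of order [y] than the bounds on
    single scores allow. *)
Let vmat_tail i : pprob (bt_q k beta)
  (fun a : outcome n K => b * n%:R * y ^+ 2 < `|\sum_(j | ~~ B j) v i j * (sc a j / vd j)|) <= 2 * expR (- (2 * L)).
Proof.
pose c (j : 'I_n) : R := if B j then 0 else v i j / vd j.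
have cE (a : outcome n K) : \sum_j c j * sc a j = \sum_(j | ~~ B j) v i j * (sc a j / vd j).
  rewrite [RHS]big_mkcond; apply: eq_bigr => j _; rewrite /c; case: (B j); rewrite ?mul0r//=.
  by rewrite mulrA mulrAC.
have C0 : 0 < C by have := C_ge1; lra.
have b0 : 0 < b by have := b_ge1; lra.
have V0 : 0 < 16 * C ^+ 4 * b ^+ 2 by rewrite !mulr_gt0 ?exprn_gt0.
have t0 : 0 < b * n%:R * y ^+ 2 by rewrite !mulr_gt0 ?exprn_gt0.
have := linear_score_tail k beta k_sym k_bnd c _ _ _ V0 t0.
move=> h; apply: (le_trans (pprob_le _ (bt_q_ge0 k beta) _ (fun a => b * n%:R * y ^+ 2 < `|\sum_j c j * sc a j|) _)).
  by move=> a _; rewrite cE.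
apply: (le_trans (h _)).
  have d0 : 0 <= 4 * C * b / n%:R by rewrite !mulr_ge0 ?invr_ge0// ltW.
  have c0 j : 0 <= c j <= 4 * C * b / n%:R.
    rewrite /c; case: (B j); first by rewrite lexx.
    have v0 : 0 <= v i j by rewrite mulr_ge0 ?kap_ge0// ltW ?wt_gt0.
    rewrite divr_ge0 ?(ltW (vd_gt0 _))//=.
    have -> : 4 * C * b / n%:R = C * (4 * b / n%:R) by ring.
    apply: ler_pM; rewrite ?invr_ge0 ?(ltW (vd_gt0 _))//.
      exact: (vmat_le _ _ (kap_ge0 k) kap_leC).
    exact: (vdegV_le _ (kap_ge0 k) _ _ _ b_ge1 kap_wt card_nB n_ge4).
  apply: (@le_trans _ _ (\sum_(p : 'I_n * 'I_n) (4 * C * b / n%:R * C) ^+ 2)).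
    apply: ler_sum => p _; rewrite !exprMn; apply: ler_pM; rewrite ?sqr_ge0//.
      rewrite -!exprMn -real_normK ?num_real// ler_pXn2r ?nnegrE//.
      by have /andP[h1 h2] := c0 p.1; have /andP[h3 h4] := c0 p.2; rewrite ler_norml; apply/andP; split; lra.
    by rewrite lerXn2r ?nnegrE ?(ltW C0).
  rewrite sumr_const card_prod card_ord -[leLHS]mulr_natr natrM.
  by rewrite le_eqVlt; apply/orP; left; apply/eqP; field; rewrite gt_eqF.
(* Here the exponent is $C^4L^2/256$, and $C^4\ge 512$ with $L\ge 1$ suffices. *)
apply: tail_le; rewrite ler_pdivlMr ?mulr_gt0//.
have -> : b * n%:R * y ^+ 2 = b * (C ^+ 4 * L) by rewrite -ny2 mulrA.
have -> : 2 * L * (16 * (16 * C ^+ 4 * b ^+ 2)) = (512 * L) * (b ^+ 2 * C ^+ 4) by ring.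
have -> : (b * (C ^+ 4 * L)) ^+ 2 = (C ^+ 4 * L ^+ 2) * (b ^+ 2 * C ^+ 4) by ring.
apply: ler_wpM2r; first by rewrite mulr_ge0// exprn_ge0 ?ltW.
have h1 := L_ge1.
have c2 : 64 <= C ^+ 2 by have := C_ge8; nra.
have c4 : 512 <= C ^+ 4.
  by rewrite (exprM C 2 2); move: (C ^+ 2) c2 => z z64; nra.
by apply: ler_pM; [lra|lra| |nra].
Qed.

Lemma good_outcome_tail :
  pprob (bt_q k beta) (fun a : outcome n K => ~~ good_outcome a) <= n%:R * (4 * expR (- (2 * L))).
Proof.
have q0 := @bt_q_ge0 R n K k beta.
have -> : (fun a : outcome n K => ~~ good_outcome a) = (fun a : outcome n K => [exists i, n%:R * y < `|sc a i|] ||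
   [exists i, b * n%:R * y ^+ 2 < `|\sum_(j | ~~ B j) v i j * (sc a j / vd j)|]).
  apply/funext => a; rewrite /good_outcome negb_and !negb_forall.
  by congr (_ || _); apply: eq_existsb => i; rewrite -ltNge.
apply: (le_trans (pprobU _ q0 _ _)).
have -> : n%:R * (4 * expR (- (2 * L))) = n%:R * (2 * expR (- (2 * L))) + n%:R * (2 * expR (- (2 * L))) by ring.
by apply: lerD; rewrite -[n in X in _ <= X]card_ord; apply: (pprob_exists _ q0).
Qed.

Section LR.
Variable a : outcome n K.
Hypotheses (val : valid_outcome k a) (good : good_outcome a).
Local Notation sc' g := (score (kap k) (esc k a) g).

Let pi0 (i : 'I_n) : 'I_n := if B i then ib else i.

Let fibre_B i : (pi0 i == ib) = B i.
Proof.
rewrite /pi0; case: ifPn => [|nBi]; first by rewrite eqxx.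
by apply/negbTE; apply: contra nBi => /eqP ->.
Qed.

Let fibre_nB i j : ~~ B j -> (pi0 i == j) = (i == j).
Proof.
move=> nBj; rewrite /pi0; case: ifPn => // Bi.
transitivity false; last by apply/esym/negbTE; apply: contra nBj => /eqP <-.
by apply/negbTE; apply: contra nBj => /eqP <-.
Qed.

Let score_le i : `|sc a i| <= n%:R * y.
Proof. by have /andP[/forallP] := good. Qed.

Let b_gt0 : 0 < b. Proof. by have := b_ge1; lra. Qed.
Let ny_ge0 : 0 <= n%:R * y. Proof. by rewrite mulr_ge0// ltW. Qed.
Let ny_le : n%:R * y <= C * (n%:R * y).
Proof. by rewrite -[leLHS]mul1r ler_wpM2r. Qed.

Let A_smallE : 8 * b * (C * (n%:R * y)) / n%:R = 8 * C * b * y.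
Proof. by field; rewrite gt_eqF. Qed.
Let A_small : 8 * b * (C * (n%:R * y)) / n%:R < 1 / 2.
Proof. by rewrite A_smallE; have := Cby; lra. Qed.

Lemma full_maximizer_exists : exists del : 'I_n -> R,
  [/\ del o = 0, forall i j, `|del i - del j| <= 8 * C * b * y &
      forall i, sc' (fun l => beta l + del l) i = 0].
Proof.
have [|del [_ d0 osc s0]] := maximizer_exists _ _ (kap_sym k k_sym) (kap_ge0 k)
  (esc_sum0 _ k_sym _ val) beta id b _ o b_gt0 kap_wt _ A_small.
  by move=> j; rewrite big_pred1_eq; exact: le_trans (score_le _) ny_le.
exists del; split => // [i j|i]; first by rewrite -A_smallE.
by have := s0 i; rewrite big_pred1_eq.
Qed.

(** The existence lemma with the block collapsed to [ib]. A fibre then has at most [C] items, hence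
    the bound [C * (n%:R * y)] on the fibre scores. *)
Lemma null_maximizer_exists : exists del : 'I_n -> R,
  [/\ forall i j, B i -> B j -> del i = del j, del o = 0,
      forall i j, `|del i - del j| <= 8 * C * b * y,
      forall i, ~~ B i -> sc' (fun l => beta l + del l) i = 0 &
      \sum_(i | B i) sc' (fun l => beta l + del l) i = 0].
Proof.
have [|del [dB d0 osc s0]] := maximizer_exists _ _ (kap_sym k k_sym) (kap_ge0 k)
  (esc_sum0 _ k_sym _ val) beta pi0 b _ o b_gt0 kap_wt _ A_small.
  move=> j; apply: norm_sum_le_card => //.
  have [Bj|nBj] := boolP (B j).
    apply: le_trans card_B_le; rewrite ler_nat; apply/subset_leq_card/fintype.subsetP => i.
    by rewrite !unfold_in /pi0; case: ifPn => // _ /eqP ->.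
  by rewrite (eq_card (B := pred1 j)) ?card1 // => i; rewrite !unfold_in fibre_nB.
exists del; split => // [i j Bi Bj|i j|i nBi|].
- by apply: dB; rewrite /pi0 Bi Bj.
- by rewrite -A_smallE.
- by have := s0 i; rewrite (big_pred1 i) => // j; rewrite fibre_nB.
- by have := s0 ib; rewrite (eq_bigl _ _ fibre_B).
Qed.

(** [T] is known only through maximizers, so both stationary points are first shown to be such: by
    concavity the gain is at most the score term, which vanishes in every admissible direction. *)
Lemma good_outcome_lr (T : R) :
  (forall g g0, is_maximizer k a (@full_space R n) g -> is_maximizer k a (@null_space R n r) g0 ->
     T = 2 * (ell_bt k a g - ell_bt k a g0)) ->
  `|T - block_quad (kap k) beta B (Dblk k beta B a)| <= C ^+ 24 * (b ^+ 6 * (n%:R * y ^+ 3)).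
Proof.
move=> hT.
have [del1 [d1o osc1 s1]] := full_maximizer_exists.
have [del0 [d0B d0o osc0 s0 s0B]] := null_maximizer_exists.
have oE (i : 'I_n) : nat_of_ord i = 0%N -> i = o by move=> i0; apply: val_inj.
rewrite (hT (fun l => beta l + del1 l) (fun l => beta l + del0 l)); last 2 first.
- split; first by move=> i i0; rewrite beta0// (oE i i0) d1o addr0.
  move=> h _; rewrite !ell_btE//.
  apply: (le_trans (lik_concave _ _ (kap_sym k k_sym) (kap_ge0 k) (fun l => beta l + del1 l) _)).
  by rewrite big1 ?addr0// => i _; rewrite s1 mul0r.
- split.
    split; first by move=> i i0; rewrite beta0// (oE i i0) d0o addr0.
    move=> i j i1 ir j1 jr; have Bi : B i by rewrite /eqblock i1.
    have Bj : B j by rewrite /eqblock j1.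
    by rewrite (beta_B i j)// (d0B i j).
  move=> h [h0 hB]; rewrite !ell_btE//.
  apply: (le_trans (lik_concave _ _ (kap_sym k k_sym) (kap_ge0 k) (fun l => beta l + del0 l) _)).
  rewrite (bigID B) /= [X in _ + (_ + X)]big1 => [|i nBi]; last by rewrite s0// mul0r.
  rewrite addr0 (eq_bigr (fun i => sc' (fun l => beta l + del0 l) i * (h ib - (beta ib + del0 ib)))).
    by rewrite -mulr_suml s0B mul0r addr0.
  move=> i Bi; have /andP[i1 ir] := Bi; have /andP[ib1 ibr] := B_ib.
  by rewrite (hB i ib)// (beta_B i ib)// (d0B i ib).
rewrite !ell_btE//.
have C0 : 0 < C by have := C_ge1; lra.
have Cb0 : 0 < C * b * y by rewrite !mulr_gt0.
have y1 : y <= 1.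
  apply: le_trans b3y; rewrite -[leLHS]mul1r ler_wpM2r ?(ltW y_gt0)//.
  exact: exprn_ege1.
apply: (lr_block_quad_rate _ _ C (kap_sym k k_sym) (kap_ge0 k) kap_leC beta B b o b_ge1 kap_wt
  C_ge1 card_B_le card_nB n_ge4 nB_o del0 del1 (8 * C * b * y) _ _ osc0 osc1 d0o d1o s0 s0B s1
  (4 * (16 * b * (2 * C ^+ 2 * (8 * C * b * y))) / n%:R) _ y (ltW y_gt0) score_le
  (b * n%:R * y ^+ 2) _ _ (C ^+ 2) (del0 ib) _ _ ib B_ib C_ge8) => //.
- by move: Cb0; lra.
- by have := Cby; lra.
- by rewrite mulrC divfK// gt_eqF.
- by have /andP[_ /forallP] := good.
- move=> i Bi; apply: le_trans (Dblk_score _ _ k_sym k_bnd _ _ _ val Bi) _.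
  by rewrite expr2; apply: ler_pM.
- by move=> i Bi; exact: d0B.
- have -> : C ^+ 2 * b * y = C * (C * b * y) by ring.
  have -> : 8 * C * b * y = 8 * (C * b * y) by ring.
  by rewrite ler_wpM2r// ltW.
- rewrite ny2; have c2 : 1 <= C ^+ 4 by exact: exprn_ege1.
  by have := L_ge1; nra.
Qed.

End LR.

(** Outside the good event a maximizer may fail to exist and [T] is arbitrary; there only the
    probability is used. *)
Lemma lr_block_quad_tail (T : outcome n K -> R) :
  (forall a g g0, is_maximizer k a (@full_space R n) g -> is_maximizer k a (@null_space R n r) g0 ->
     T a = 2 * (ell_bt k a g - ell_bt k a g0)) ->
  pprob (bt_q k beta) (fun a => C ^+ 24 * (b ^+ 6 * (n%:R * y ^+ 3)) <
     `|T a - block_quad (kap k) beta B (Dblk k beta B a)|) <= n%:R * (4 * expR (- (2 * L))).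
Proof.
move=> hT; apply: le_trans good_outcome_tail; apply: pprob_le; first exact: bt_q_ge0.
move=> a /pweight_valid val; apply: contraTN => good; rewrite -leNgt.
by apply: good_outcome_lr => // g g0; exact: hT.
Qed.

End Finite.

(** * Bounds through [b_n] and [c_n] *)

Section VarianceBounds.
Context {R : realType}.

Lemma vfun_gt0 (x : R) : 0 < vfun x.
Proof. by rewrite -invr_gt0 -wt_vfun wt_gt0. Qed.

Lemma vfun_ge4 (x : R) : 4 <= vfun x.
Proof.
rewrite -[leRHS]invrK -wt_vfun -[leLHS]invrK lef_pV2 ?posrE ?invr_gt0 ?wt_gt0//.
by have := wt_le x; lra.
Qed.

Lemma vfun0 : vfun (0 : R) = 4.
Proof. by rewrite /vfun expR0; field. Qed.

Context {n : nat} (beta : 'I_n -> R).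

Lemma vfun_le_b_n i j : i != j -> vfun (beta i - beta j) <= b_n beta.
Proof.
move=> ij; rewrite /b_n; apply: le_trans (le_bigmax _ _ i).
by apply: (le_bigmax_cond _ (fun j => vfun (beta i - beta j))); rewrite eq_sym.
Qed.

Lemma b_n_ge4 i j : i != j :> 'I_n -> 4 <= b_n beta.
Proof. by move=> ij; apply: le_trans (vfun_le_b_n _ _ ij); exact: vfun_ge4. Qed.

Lemma c_n_le_vfun i j : i != j -> c_n beta <= vfun (beta i - beta j).
Proof.
move=> ij; rewrite /c_n; apply: (le_trans (bigmin_le _ i _)).
by apply: (bigmin_le_cond _ (fun j => vfun (beta i - beta j))); rewrite eq_sym.
Qed.

Lemma c_n_gt0 : 0 < b_n beta -> 0 < c_n beta.
Proof.
move=> b0; rewrite /c_n; apply: lt_bigmin => // i _; apply: lt_bigmin => // j _; exact: vfun_gt0.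
Qed.

Lemma kap_wt_b_n K (k : 'I_n -> 'I_n -> nat) :
  (forall i j, i != j -> (1 <= k i j <= K)%N) -> forall i j, i != j ->
  1 <= b_n beta * (kap k i j * wt (beta i - beta j)).
Proof.
move=> k_bnd i j ij; rewrite wt_vfun mulrCA -[leLHS]mulr1.
apply: ler_pM => //; first exact: kap_ge1 k_bnd _ _ ij.
by rewrite ler_pdivlMr ?vfun_gt0// mul1r vfun_le_b_n.
Qed.

End VarianceBounds.

(** * Asymptotics under the rate condition *)

Section Asymptotics.
Context {R : realType}.
Variables (K r : nat) (k : forall n : nat, 'I_n -> 'I_n -> nat) (beta : forall n : nat, 'I_n -> R).
Hypothesis r_gt2 : (2 < r)%N.
Hypothesis k_sym : forall n (i j : 'I_n), k n i j = k n j i.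
Hypothesis k_bnd : forall n (i j : 'I_n), i != j -> (1 <= k n i j <= K)%N.
Hypothesis beta0 : forall n (i : 'I_n), nat_of_ord i = 0%N -> beta n i = 0.
Hypothesis beta_eq : forall n (i j : 'I_n),
  (1 <= i)%N -> (i < r)%N -> (1 <= j)%N -> (j < r)%N -> beta n i = beta n j.
Hypothesis rate : (fun n : nat => (b_n (beta n) ^+ 11 / c_n (beta n) ^+ 6)
  / (Num.sqrt (n%:R : R) / powR (ln (n%:R : R)) (5 / 2))) @ \oo --> (0 : R).

Local Notation b n := (b_n (beta n)).
Local Notation s n := (Num.sqrt (ln (n%:R : R))).
Local Notation N n := (Num.sqrt (n%:R : R)).
Local Notation B n := (eqblock r n).
Let C : R := (8 + K + r)%:R.

Let C_ge8 : 8 <= C. Proof. by rewrite ler_nat -addnA leq_addr. Qed.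
Let K_le : K%:R <= C. Proof. by rewrite ler_nat addnAC leq_addl. Qed.
Let r_le : r%:R <= C. Proof. by rewrite ler_nat leq_addl. Qed.
Let C_gt0 : 0 < C. Proof. by have := C_ge8; lra. Qed.

Let beta_B n (i j : 'I_n) : B n i -> B n j -> beta n i = beta n j.
Proof. by move=> /andP[i1 ir] /andP[j1 jr]; exact: beta_eq. Qed.

(* Since [r > 2], items 2 and 3 have equal merits, so the factor [c_n ^+ 6] is harmless. *)
Let c_n_le4 n : (2 < n)%N -> 0 < c_n (beta n) <= 4.
Proof.
move=> n2; pose i1 : 'I_n := Ordinal (ltnW n2); pose i2 : 'I_n := Ordinal n2.
have i12 : i1 != i2 by [].
rewrite c_n_gt0; last by have := b_n_ge4 (beta n) i1 i2 i12; lra.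
rewrite /=; apply: (le_trans (c_n_le_vfun _ i1 i2 i12)).
by rewrite (beta_eq n i1 i2)//= ?(ltnW r_gt2)// subrr vfun0.
Qed.

Lemma rate_near (e : R) : 0 < e -> \forall n \near \oo,
  [/\ (2 * r <= n)%N, 1 <= b n, 1 <= ln (n%:R : R) & b n ^+ 11 * s n ^+ 5 <= e * N n].
Proof.
move=> e0.
(* The factor $4^6$ pays for replacing [c_n] by its bound 4. *)
have e'0 : 0 < e / 4 ^+ 6 by rewrite divr_gt0// exprn_gt0.
have /cvgrPdist_le/(_ _ e'0) := rate.
apply: filterS3 (nbhs_infty_ge (2 * r)%N) (nbhs_infty_ger (expR 1 : R)) => n rn en.
rewrite sub0r normrN => X.
have n2 : (2 < n)%N by rewrite (leq_trans r_gt2)// (leq_trans _ rn)// leq_pmull.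
have /andP[c0 c4] := c_n_le4 n n2.
have b4 : 4 <= b n := b_n_ge4 (beta n) (Ordinal (ltnW n2)) (Ordinal n2) isT.
have n0 : 0 < n%:R :> R by exact: lt_le_trans (expR_gt0 1) en.
have L1 : 1 <= ln (n%:R : R) by rewrite -[leLHS]expRK ler_ln// ?posrE ?expR_gt0.
have L0 : 0 <= ln (n%:R : R) by lra.
split => //; first lra.
have sE : powR (ln (n%:R : R)) (5 / 2) = s n ^+ 5.
  rewrite (_ : 5 / 2 = 2%:R + 2^-1); last by field.
  rewrite powRD; last by rewrite (gt_eqF (lt_le_trans ltr01 L1)) implybT.
  by rewrite powR_mulrn// powR12_sqrt// -{1}(sqr_sqrtr L0); ring.
have N0 : 0 < N n by rewrite sqrtr_gt0.
have s0 : 0 < s n by rewrite sqrtr_gt0; lra.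
have c60 : 0 < c_n (beta n) ^+ 6 by rewrite exprn_gt0.
move: X; rewrite sE ger0_norm; last first.
  by rewrite !divr_ge0 ?exprn_ge0// ?ltW//; lra.
have -> : b n ^+ 11 / c_n (beta n) ^+ 6 / (N n / s n ^+ 5) =
   (b n ^+ 11 * s n ^+ 5) / (c_n (beta n) ^+ 6 * N n).
  by field; rewrite !gt_eqF.
rewrite ler_pdivrMr ?mulr_gt0// => h; apply: (le_trans h).
rewrite mulrA ler_wpM2r ?(ltW N0)// -[leRHS](divfK (_ : 4 ^+ 6 != 0)) ?expf_neq0//.
by rewrite ler_wpM2l ?(ltW e'0)// lerXn2r ?nnegrE// ltW.
Qed.

(** Every remainder is a monomial in $b$ and $\sqrt{\log n}$ of smaller degrees than the one in the
    rate, and both bases are at least 1. *)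
Let monomial_le (p q n : nat) : (p <= 11)%N -> (q <= 5)%N -> 1 <= b n -> 1 <= ln (n%:R : R) ->
  b n ^+ p * s n ^+ q <= b n ^+ 11 * s n ^+ 5.
Proof.
move=> p11 q5 b1 L1; have s1 : 1 <= s n by rewrite -[leLHS]sqrtr1 ler_sqrt ?(le_trans ler01).
by apply: ler_pM; rewrite ?exprn_ge0 ?(le_trans ler01)// ler_weXn2l.
Qed.

Definition lr_approx n (a : outcome n K) : R :=
  block_quad (kap (k n)) (beta n) (B n) (Dblk (k n) (beta n) (B n) a).

Let size_facts n : (2 * r <= n)%N ->
  [/\ (4 : R) <= n%:R, (n%:R : R) <= 2 * #|predC (B n)|%:R & exists ib, B n ib].
Proof.
move=> rn; have n4 : (4 <= n)%N by rewrite (leq_trans _ rn)// (leq_mul2l 2 2) ltnW.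
split; [by rewrite ler_nat| by rewrite -natrM ler_nat card_eqblockC|].
by exists (Ordinal (ltnW (ltnW n4))); rewrite /eqblock /= (ltnW r_gt2).
Qed.

Lemma lr_approx_ge0_near : \forall n \near \oo, forall a, 0 <= lr_approx n a.
Proof.
apply: filterS (rate_near 1 ltr01) => n [rn b1 _ _] a.
have [n4 cB [ib Bib]] := size_facts n rn.
apply: (block_quad_ge0 _ _ _ _ ib Bib).
exact: (vdeg_gt0 _ (kap_ge0 (k n)) _ _ _ b1 (kap_wt_b_n _ _ _ (k_bnd n)) cB n4).
Qed.

Lemma lr_approx_laplace (j : nat) :
  \sum_a bt_prob (k n) (beta n) a * expR (- (j%:R * lr_approx n a)) @[n --> \oo]
  --> (chisq_laplace (r - 3) j : R).
Proof.
apply/cvgrPdist_le => eps eps0.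
pose A : R := 1 + j%:R; have A1 : 1 <= A by rewrite lerDl.
have lc0 := lindeberg_cst_ge0 A; set lc := lindeberg_cst A in lc0.
(* The first bound gives the smallness of [M] required for the replacement, the second makes
   [C * (lc * M)] at most [eps]. *)
pose d := Num.min (4 * A)^-1 (eps / (C * (lc + 1))).
have d0 : 0 < d.
  have Clc : 0 < C * (lc + 1) by rewrite mulr_gt0//; lra.
  by rewrite /d lt_min invr_gt0 divr_gt0// andbT; lra.
have d0' : 0 < d / (2 * C) by rewrite divr_gt0// mulr_gt0.
apply: filterS (rate_near _ d0') => n [rn b1 L1 bN].
have [n4 cB [ib Bib]] := size_facts n rn.
have n0 : 0 < n%:R :> R by lra.
have N0 : 0 < N n by rewrite sqrtr_gt0.
have {bN} bN := le_trans (monomial_le 1 0 n isT isT b1 L1) bN.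
rewrite expr1 expr0 mulr1 in bN.
(* As [vdeg] is at least $n/(4b)$ and $K\le C$, this bounds every standardized comparison. *)
pose M := 2 * C * b n / N n.
have M0 : 0 <= M by rewrite /M !mulr_ge0 ?invr_ge0 ?(ltW C_gt0) ?(ltW N0)//; lra.
have Md : M <= d.
  rewrite /M ler_pdivrMr// (_ : d * N n = 2 * C * (d / (2 * C) * N n)).
    by rewrite ler_wpM2l// mulr_ge0 ?(ltW C_gt0).
  by field; rewrite gt_eqF.
have M1 : M <= (4 * A)^-1 by apply: le_trans Md _; rewrite /d ge_min lexx.
have M2 : M <= eps / (C * (lc + 1)) by apply: le_trans Md _; rewrite /d ge_min lexx orbT.
have AM1 : 4 * A * M <= 1 by rewrite mulrC -ler_pdivlMr ?mul1r//; lra.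
have kw := kap_wt_b_n (beta n) _ _ (k_bnd n).
have vd0 := vdeg_gt0 _ (kap_ge0 (k n)) _ _ _ b1 kw cB n4.
have KM i : K%:R <= M * Num.sqrt (vdeg (kap (k n)) (beta n) (B n) i).
  have h := vdeg_ge _ (kap_ge0 (k n)) _ _ _ b1 kw cB n4 i.
  apply: le_trans K_le _; have -> : M = Num.sqrt (M ^+ 2) by rewrite sqrtr_sqr ger0_norm.
  rewrite -sqrtrM ?sqr_ge0// -[leLHS]ger0_norm ?(ltW C_gt0)// -sqrtr_sqr ler_sqrt; last first.
    by rewrite mulr_ge0 ?sqr_ge0 ?(ltW (vd0 _)).
  rewrite /M exprMn exprVn sqr_sqrtr ?(ltW n0)// mulrAC ler_pdivlMr//.
  have -> : (2 * C * b n) ^+ 2 * vdeg (kap (k n)) (beta n) (B n) i =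
     C ^+ 2 * (b n * (4 * b n * vdeg (kap (k n)) (beta n) (B n) i)) by ring.
  rewrite ler_wpM2l ?sqr_ge0//; apply: (le_trans h); rewrite -[leLHS]mul1r ler_wpM2r//.
  by rewrite !mulr_ge0 ?(ltW (vd0 _))//; lra.
have M_le1 : M <= 1 by move: AM1 A1 M0; nra.
have AM0 : 0 <= 4 * A * M by rewrite mulr_ge0//; lra.
have AMsq : 4 * A * M ^+ 2 <= 1 by rewrite expr2 mulrA mulr_ile1.
have j0A : 0 <= (j%:R : R) <= A by rewrite ler0n /A; lra.
have := block_laplace (k n) (beta n) (k_sym n) (k_bnd n) (B n) M A vd0 KM M_le1 A1 AMsq ib Bib j%:R j0A.
have cardB : #|B n| = r.-1 by rewrite card_eqblock// (leq_trans _ rn)// leq_pmull.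
rewrite cardB => h.
have -> : \sum_a bt_prob (k n) (beta n) a * expR (- (j%:R * lr_approx n a)) =
   pexp (bt_q (k n) (beta n)) (fun a => expR (- (j%:R * lr_approx n a))).
  by apply: eq_bigr => a _; rewrite bt_probE.
(* The index [r - 3] stands for $r-2$ degrees of freedom, which is the block size minus 1. *)
have -> : chisq_laplace (r - 3) j = expR (- ((r.-1%:R - 1) * ln (1 + 2 * j%:R)) / 2) :> R.
  rewrite /chisq_laplace /powR gt_eqF; last by have : 0 <= (j%:R : R) by []; lra.
  congr expR; case: r r_gt2 => [|[|[|r']]]// _; rewrite !subSS subn0 /= -(natr1 r'.+1).
  by field.
rewrite distrC; apply: (le_trans h); apply: (@le_trans _ _ (C * (lc * M))).
  apply: ler_wpM2r; first exact: mulr_ge0.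
  by apply: le_trans r_le; rewrite ler_nat leq_pred.
move: M2; rewrite ler_pdivlMr; last by rewrite mulr_gt0//; lra.
move=> M2; apply: le_trans M2; rewrite [leRHS]mulrCA.
apply: ler_wpM2l; first exact: ltW.
by rewrite mulrC; apply: ler_wpM2l => //; lra.
Qed.

Lemma lr_approx_tail (T : forall n, outcome n K -> R) :
  (forall n (a : outcome n K) (g g0 : 'I_n -> R),
     is_maximizer (k n) a (@full_space R n) g -> is_maximizer (k n) a (@null_space R n r) g0 ->
     T n a = 2 * (ell_bt (k n) a g - ell_bt (k n) a g0)) ->
  forall eta : R, 0 < eta ->
  \sum_(a | eta < `|T n a - lr_approx n a|) bt_prob (k n) (beta n) a @[n --> \oo] --> (0 : R).
Proof.
move=> hT eta eta0; apply/cvgrPdist_le => eps eps0.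
(* The first bound serves the conditions on [y], the second the remainder, where $C^{30}$ is
   $C^{24}$ times the $C^6$ contained in $y^3$. *)
pose e := Num.min (32 * C ^+ 3)^-1 (eta / C ^+ 30).
have e0 : 0 < e by rewrite lt_min invr_gt0 divr_gt0 ?mulr_gt0 ?exprn_gt0.
apply: filterS2 (rate_near _ e0) (nbhs_infty_ger (4 / eps)) => n [rn b1 L1 bN] n_eps.
have [n4 cB _] := size_facts n rn.
have n0 : 0 < n%:R :> R by lra.
have N0 : 0 < N n by rewrite sqrtr_gt0.
have s0 : 0 < s n by rewrite sqrtr_gt0; lra.
have C3 : 0 < C ^+ 3 by rewrite exprn_gt0.
have C30 : 0 < C ^+ 30 by rewrite exprn_gt0.
have e1 : 32 * C ^+ 3 * e <= 1.
  by rewrite mulrC -ler_pdivlMr ?mulr_gt0// mul1r /e ge_min lexx.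
have e2 : C ^+ 30 * e <= eta by rewrite mulrC -ler_pdivlMr// /e ge_min lexx orbT.
have mon p q : (p <= 11)%N -> (q <= 5)%N -> b n ^+ p * s n ^+ q / N n <= e.
  by move=> p11 q5; rewrite ler_pdivrMr//; exact: le_trans (monomial_le p q n p11 q5 b1 L1) bN.
pose y := C ^+ 2 * (s n / N n).
have y0 : 0 < y by rewrite /y !mulr_gt0 ?invr_gt0 ?exprn_gt0.
have ny2 : n%:R * y ^+ 2 = C ^+ 4 * ln (n%:R : R).
  rewrite /y !exprMn exprVn !sqr_sqrtr ?(ltW n0)//; last lra.
  by field; rewrite gt_eqF.
have b3y : b n ^+ 3 * y <= 1.
  have -> : b n ^+ 3 * y = C ^+ 2 * (b n ^+ 3 * s n ^+ 1 / N n) by rewrite /y; ring.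
  apply: le_trans (_ : C ^+ 3 * e <= 1); last by move: (mulr_gt0 C3 e0) e1; lra.
  apply: ler_pM; rewrite ?sqr_ge0 ?mon//.
    by rewrite divr_ge0 ?mulr_ge0 ?exprn_ge0 ?(ltW s0) ?(ltW N0)//; lra.
  by rewrite ler_weXn2l//; have := C_ge8; lra.
have Cby : 16 * C * b n * y < 1.
  have -> : 16 * C * b n * y = 16 * C ^+ 3 * (b n ^+ 1 * s n ^+ 1 / N n) by rewrite /y; ring.
  apply: (@le_lt_trans _ _ (16 * C ^+ 3 * e)); first by rewrite ler_wpM2l ?mon// mulr_ge0 ?(ltW C3).
  by move: (mulr_gt0 C3 e0) e1; lra.
have rem : C ^+ 24 * (b n ^+ 6 * (n%:R * y ^+ 3)) <= eta.
  apply: le_trans e2.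
  have -> : C ^+ 24 * (b n ^+ 6 * (n%:R * y ^+ 3)) = C ^+ 30 * (b n ^+ 6 * s n ^+ 3 / N n).
    by rewrite /y -{1}(sqr_sqrtr (ltW n0)); field; rewrite gt_eqF.
  by rewrite ler_wpM2l ?mon// ltW.
have key := lr_block_quad_tail r (k n) (beta n) r_gt2 (k_sym n) (k_bnd n) (beta0 n) (beta_B n) rn
  C (b n) y (ln n%:R) C_ge8 K_le r_le b1 (kap_wt_b_n _ _ _ (k_bnd n)) L1 ny2 y0 b3y Cby (T n) (hT n).
rewrite sub0r normrN ger0_norm; last first.
  by apply: sumr_ge0 => a _; rewrite bt_probE pweight_ge0//; exact: bt_q_ge0.
rewrite (eq_bigr _ (fun a _ => bt_probE (k n) (beta n) a)).
apply: le_trans (le_trans key _).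
  apply: (pprob_le _ (bt_q_ge0 (k n) (beta n)) (fun a => eta < `|T n a - lr_approx n a|)) => a _.
  exact: le_lt_trans.
(* With $L=\log n$ the failure probability is at most $4n\cdot n^{-2}=4/n$. *)
have -> : - (2 * ln (n%:R : R)) = - ln n%:R + - ln n%:R by ring.
rewrite expRD expRN lnK ?posrE//.
have -> : n%:R * (4 * (n%:R^-1 * n%:R^-1)) = 4 / n%:R :> R by field; rewrite gt_eqF.
by move: n_eps; rewrite !ler_pdivrMr// mulrC.
Qed.

End Asymptotics.

Theorem theorem4 (R : realType) (K r : nat) (hr : (2 < r)%N)
  (k : forall n : nat, 'I_n -> 'I_n -> nat)
  (hk_sym : forall n (i j : 'I_n), k n i j = k n j i)
  (hk_bnd : forall n (i j : 'I_n), i != j -> (1 <= k n i j <= K)%N)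
  (beta : forall n : nat, 'I_n -> R)
  (hbeta1 : forall n (i : 'I_n), nat_of_ord i = 0%N -> beta n i = 0)
  (hH0 : forall n (i j : 'I_n), (1 <= i)%N -> (i < r)%N -> (1 <= j)%N -> (j < r)%N ->
           beta n i = beta n j)
  (hbc : (fun n : nat => (b_n (beta n) ^+ 11 / c_n (beta n) ^+ 6)
            / (Num.sqrt (n%:R : R) / powR (ln (n%:R : R)) (5 / 2)))
         @ \oo --> (0 : R))
  (T : forall n : nat, outcome n K -> R)
  (hT : forall n (a : outcome n K) (g g0 : 'I_n -> R),
          is_maximizer (k n) a (@full_space R n) g ->
          is_maximizer (k n) a (@null_space R n r) g0 ->
          T n a = 2 * (ell_bt (k n) a g - ell_bt (k n) a g0)) :
  forall x : R,
    (fun n : nat => bt_cdf (k n) (beta n) (T n) x) @ \oo --> chisq_cdf (r - 2) x.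
Proof.
(* Turns $r-2$ into [(r - 3).+1], a visibly positive number of degrees of freedom. *)
rewrite -(subnSK hr).
apply: (cdf_cvg_of_laplace (r - 3) (fun n => outcome n K)
  (fun n => bt_prob (k n) (beta n)) (fun n a => lr_approx K r k beta n a) T).
- by move=> n a; rewrite bt_probE pweight_ge0//; exact: bt_q_ge0.
- move=> n; rewrite (eq_bigr _ (fun a _ => bt_probE (k n) (beta n) a)) pweight_sum1// => p.
  by apply: bt_q_sum1; exact: hk_bnd.
- exact: lr_approx_ge0_near.
- by move=> j; exact: lr_approx_laplace.
- exact: lr_approx_tail.
Qed.
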